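(* Let $a,b,c,d$ be real constants satisfying all of the following linear inequalities: $$\begin{aligned} & a \ge 0, \quad 1-a \ge 0, \quad b \ge 0, \quad c \ge 0, \quad d \ge 0,\\ & 1-a+b-c \ge 0, \quad 1-a+b-d \ge 0, \quad 5b-a \ge 0,\\ & 5-8a+12b+c \ge 0, \quad 4-6a+8b+d \ge 0, \quad 5-8a+13b \ge 0,\\ & 5+13b-8a+c-d \ge 0, \quad 4+9b-6a-d \ge 0,\\ & 5-8a+14b-d \ge 0, \quad 5-8a+14b-c \ge 0, \quad 5-8a+15b-c-d \ge 0,\\ & 3-5a+10b-c \ge 0, \quad 3-5a+10b-d \ge 0, \quad 3-4a+4b \ge 0. \end{aligned}$$ Then every triangle-free planar graph $G$ that contains no $Q_3^{1-}$ subgraph and no $T_6$ component has an induced forest of order at least $(a-2b)\,n(G)$.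
   Context: Graphs are finite and simple. The order of a graph is its number of vertices. An induced forest of $G$ is an induced subgraph of $G$ that is acyclic. $n(G)$ denotes the number of vertices of $G$. For an induced subgraph $H$ of $G$, the degree $\deg_G(H)$ is the number of edges of $G$ with exactly one endpoint in $V(H)$. $Q_3$ denotes the planar cube, i.e. the graph of the 3-dimensional cube (3-regular, 8 vertices, 12 edges). $T_6$ denotes the graph $K_{3,3}$ minus one edge (6 vertices, 8 edges). A $Q_3^{1-}$ subgraph of $G$ is an induced subgraph $H$ of $G$ that is isomorphic to $Q_3$ and has $\deg_G(H)\le 1$. A $T_6$ component of $G$ is a connected component of $G$ isomorphic to $T_6$. *)

(* Defs.v *)
From HB Require Import structures.
From mathcomp Require Import all_boot all_order all_algebra.
From mathcomp Require Import all_classical all_reals all_analysis.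
Set Implicit Arguments.
Unset Strict Implicit.
Unset Printing Implicit Defensive.
Import Order.TTheory GRing.Theory Num.Theory.
Import numFieldNormedType.Exports.
Local Open Scope ring_scope.

Record sgraph := SGraph {
  vertex :> finType;
  adj : rel vertex;
  adj_sym : symmetric adj;
  adj_irr : irreflexive adj }.
Arguments adj {s} x y.

Section Graphs.
Variable G : sgraph.
Implicit Types (S : {set G}).

Definition edges : {set {set G}} :=
  [set E : {set G} | [exists x, exists y, adj x y && (E == [set x; y]%SET)]]%SET.

Definition triangle_free : Prop :=
  forall x y z : G, ~ [/\ adj x y, adj y z & adj z x].

(* [ucycle] alone also accepts the empty sequence and the two traversals
   x, y, x of an edge, whence the bound on the length. *)
Definition acyclic : Prop :=
  forall s : seq G, ucycle adj s -> (size s < 3)%N.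

Definition component (x : G) : {set G} := [set y | connect adj x y]%SET.

Definition boundary_degree S : nat :=
  #|[set E in edges | #|(E :&: S)%SET| == 1%N]%SET|.

Section Induced.
Variable S : {set G}.
Definition induced_adj : rel {x : G | x \in S} := fun x y => adj (val x) (val y).
Fact induced_sym : symmetric induced_adj.
Proof. by move=> x y; rewrite /induced_adj adj_sym. Qed.
Fact induced_irr : irreflexive induced_adj.
Proof. by move=> x; rewrite /induced_adj adj_irr. Qed.
Definition induced : sgraph := SGraph induced_sym induced_irr.
End Induced.

End Graphs.

Definition isomorphic (G H : sgraph) : Prop :=
  exists2 f : G -> H, bijective f & forall x y, adj (f x) (f y) = adj x y.

Definition induced_forest (G : sgraph) (S : {set G}) : Prop :=
  acyclic (induced S).

Section Cube.
Definition Q3_adj : rel {ffun 'I_3 -> bool} :=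
  fun x y => #|[set i | x i != y i]%SET| == 1%N.
Fact Q3_sym : symmetric Q3_adj.
Proof.
move=> x y; rewrite /Q3_adj; congr (_ == _); apply: eq_card => i.
by rewrite !inE eq_sym.
Qed.
Fact Q3_irr : irreflexive Q3_adj.
Proof.
move=> x; rewrite /Q3_adj (_ : [set i | _]%SET = finset.set0) ?cards0 //.
by apply/setP=> i; rewrite !inE eqxx.
Qed.
Definition Q3 : sgraph := SGraph Q3_sym Q3_irr.
End Cube.

(* The vertex (s, i) is the i-th vertex on side s of K_{3,3}; the deleted edge
   joins (false, 0) and (true, 0). *)
Section T6.
Definition T6_adj : rel (bool * 'I_3) :=
  fun x y => (x.1 != y.1) && ~~ ((x.2 == ord0) && (y.2 == ord0)).
Fact T6_sym : symmetric T6_adj.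
Proof. by move=> x y; rewrite /T6_adj eq_sym andbC [X in ~~ X]andbC andbC. Qed.
Fact T6_irr : irreflexive T6_adj.
Proof. by move=> x; rewrite /T6_adj eqxx. Qed.
Definition T6 : sgraph := SGraph T6_sym T6_irr.
End T6.

Definition Q3_1minus_subgraph (G : sgraph) (S : {set G}) : Prop :=
  isomorphic (induced S) Q3 /\ (boundary_degree S <= 1)%N.

Definition T6_component (G : sgraph) (S : {set G}) : Prop :=
  (exists x : G, S = component x) /\ isomorphic (induced S) T6.

Definition is_arc (R : realType) (x y : R * R) (f : R -> R * R) : Prop :=
  [/\ {within `[0, 1], continuous f}%classic, {in `[0, 1] &, injective f},
      f 0 = x & f 1 = y].

(* Arcs are indexed by oriented edges; [curve_rev] says that the two
   orientations of an edge are drawn as the same arc, traversed backwards. *)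
Record plane_drawing (R : realType) (G : sgraph) := PlaneDrawing {
  pos : G -> R * R;
  curve : G -> G -> R -> R * R;
  pos_inj : injective pos;
  curve_arc : forall x y : G, adj x y -> is_arc (pos x) (pos y) (curve x y);
  curve_rev : forall (x y : G) (t : R),
    adj x y -> t \in `[0, 1] -> curve y x t = curve x y (1 - t);
  curve_pos : forall (x y z : G) (t : R),
    adj x y -> t \in `]0, 1[ -> curve x y t <> pos z;
  curve_disjoint : forall (x y x' y' : G) (s t : R),
    adj x y -> adj x' y' -> [set x; y]%SET != [set x'; y']%SET ->
    s \in `]0, 1[ -> t \in `]0, 1[ -> curve x y s <> curve x' y' t }.

Definition planar (R : realType) (G : sgraph) : Prop :=
  inhabited (plane_drawing R G).

(* Main.v *)
Require Import Defs.
From HB Require Import structures.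
From mathcomp Require Import all_boot all_order all_algebra.
From mathcomp Require Import zify lra.
From mathcomp Require Import boolp.
Set Implicit Arguments.
Unset Strict Implicit.
Unset Printing Implicit Defensive.

(* The hypotheses [h8] and [h11] give [a - 2 b <= 5 / 9], so it is enough to hit all
   cycles of a triangle-free planar graph on [n] vertices with [4 n / 9] of them.

   Let [tau] be the least size of such a hitting set and give the vertices of degree
   0, 1, 2, 3, 4, ... the weights 0, 5, 11, 19, 24, ..., that is [4 + 5 d] from degree
   [d = 3] on. For connected graphs [54 tau] is at most the total weight plus 10: in a
   minimal counterexample one deletes a few vertices, strips leaves, and suppresses
   vertices of degree two, which is blocked only by 4-cycles. This makes the graph
   3-edge-connected with degrees 3 and 4, and then reduces a cubic graph to [K_{3,3}]
   or the cube, and a vertex of degree 3 with a neighbour of degree 4 to a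
   configuration in which all its neighbours have degree 4 and pairwise share one
   further neighbour. As a triangle-free planar graph has at most [2 n - 2] edges, the
   total weight is at most [24 n - 20].

   Planarity enters through minors of the square grid. Following the arcs of a drawing
   with a fine mesh gives such a minor, whose branch sets are discretised stars. In the
   grid every even set of edges is the coboundary over F_2 of a function on the
   squares, hence the cycle space of a minor is spanned by the boundaries of its faces;
   an edge lies on at most two faces and, without triangles, a nonzero boundary has at
   least four edges, so that [m - (n - 1) <= 2 m / 4]. *)

(** * Cores and feedback vertex sets *)

(** The weights follow from a budget of 54 for each vertex put into the hitting set. Deleting a
    vertex of degree [d >= 3] frees its weight [4 + 5 d] and at least 5 at each neighbour,
    [4 + 10 d] in all: 54 for [d = 5], but only 44 for [d = 4] and 34 for [d = 3]. The deficits of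
    10 and 20 are recovered from three sources: 3 when a vertex falls from degree 3 or 4 to degree
    at most 2, where the weight lies below the line [4 + 5 d]; 11 when a vertex of degree two is
    suppressed; 10 for each edge between two parts that are separated. The additive 10 is attained
    by the 4-cycle, by [K_{3,3}] minus an edge and by the cube. The obstacle is connectivity: the
    inductive bound holds for connected graphs only, and every further component left by a deletion
    costs another 10. Hence the many arguments that count components or show that a deletion does
    not disconnect. No reduction handles 4-regular graphs; they are excluded because the edge bound
    keeps the average degree below 4. *)

Section Cores.
Variable T : finType.
Implicit Types (e : rel T) (A B C D S V W R : {set T}) (x y z : T).

Definition nb e V x : {set T} := [set y in V | e x y].
Definition dg e V x := #|nb e V x|.
(* A set induces a cycle if and only if it contains a core. *)
Definition core e A := (A != set0) && [forall x in A, 1 < dg e A x].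
Definition fvs e V S :=
  [forall A : {set T}, (A \subset V) && core e A ==> ~~ [disjoint A & S]].
Definition tau e V := #|[arg min_(S < V | fvs e V S) #|S|]|.
(* A part is a union of connected components. *)
Definition part e V A :=
  (A \subset V) && [forall x in A, forall y in V, e x y ==> (y \in A)].
(** Phrased by closed subsets rather than by paths: below, a set is shown to be everything by
    checking that no edge leaves it. *)
Definition conn e V :=
  (V != set0) && [forall A : {set T}, part e V A && (A != set0) ==> (A == V)].

Lemma in_nb e V x y : (y \in nb e V x) = (y \in V) && e x y.
Proof. by rewrite inE. Qed.

Lemma nbS e A B x : A \subset B -> nb e A x \subset nb e B x.
Proof. by move=> /subsetP AB; apply/subsetP=> y; rewrite !in_nb => /andP[/AB-> ->]. Qed.

Lemma dgS e A B x : A \subset B -> dg e A x <= dg e B x.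
Proof. by move=> AB; apply/subset_leq_card/nbS. Qed.

Lemma coreP e A :
  reflect (A != set0 /\ forall x, x \in A -> 1 < dg e A x) (core e A).
Proof. by apply: (iffP andP) => -[A0 /'forall_implyP]. Qed.

Lemma fvsP e V S :
  reflect (forall A, A \subset V -> core e A -> exists2 x, x \in A & x \in S)
    (fvs e V S).
Proof.
apply: (iffP forallP) => [h A AV cA | h A].
  have := h A; rewrite AV cA /= -setI_eq0 => /set0Pn[x].
  by rewrite inE => /andP[xA xS]; exists x.
apply/implyP=> /andP[AV cA]; have [x xA xS] := h A AV cA.
by rewrite -setI_eq0; apply/set0Pn; exists x; rewrite inE xA.
Qed.

Lemma fvs_self e V : fvs e V V.
Proof.
apply/fvsP=> A AV /coreP[/set0Pn[x xA] _]; exists x => //.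
exact: (subsetP AV).
Qed.

Lemma tau_fvs e V : exists2 S, fvs e V S & #|S| = tau e V.
Proof. by rewrite /tau; case: arg_minnP => [|S fS _]; [exact: fvs_self | exists S]. Qed.

Lemma tau_le e V S : fvs e V S -> tau e V <= #|S|.
Proof. by rewrite /tau; case: arg_minnP => [|S' _ h]; [exact: fvs_self | exact: h]. Qed.

Lemma partP e V A :
  reflect (A \subset V /\ forall x y, x \in A -> y \in V -> e x y -> y \in A)
    (part e V A).
Proof.
apply: (iffP andP) => -[AV h]; split=> //.
  by move=> x y xA yV exy; move/'forall_implyP/(_ x xA)/'forall_implyP/(_ y yV)/implyP: h; apply.
apply/'forall_implyP=> x xA; apply/'forall_implyP=> y yV; apply/implyP.
exact: h.
Qed.

Lemma partD e V A : symmetric e -> part e V A -> part e V (V :\: A).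
Proof.
move=> se /partP[AV h]; apply/partP; split; first exact: subsetDl.
move=> x y; rewrite !inE => /andP[xA xV] yV exy; rewrite yV andbT.
by apply: contra xA => yA; apply: h yA xV _; rewrite se.
Qed.

Lemma partI e V A B : part e V A -> part e V B -> part e V (A :&: B).
Proof.
move=> /partP[AV hA] /partP[BV hB]; apply/partP; split.
  exact: subset_trans (subsetIl _ _) AV.
move=> x y; rewrite !inE => /andP[xA xB] yV exy.
by rewrite (hA x) // (hB x).
Qed.

Lemma part_sub e V A B : part e V A -> part e A B -> part e V B.
Proof.
move=> /partP[AV hA] /partP[BA hB]; apply/partP; split.
  exact: subset_trans BA AV.
move=> x y xB yV exy; apply: (hB x) => //; apply: (hA x) => //.
exact: (subsetP BA).
Qed.

Lemma connP e V :
  reflect (V != set0 /\ forall A, part e V A -> A != set0 -> A = V) (conn e V).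
Proof.
apply: (iffP andP) => -[V0 h]; split=> //.
  by move=> A pA A0; move/forallP/(_ A): h; rewrite pA A0 => /eqP.
by apply/forallP=> A; apply/implyP=> /andP[pA A0]; apply/eqP/h.
Qed.

Lemma nconn_part e V : V != set0 -> ~~ conn e V ->
  exists A, [/\ part e V A, A != set0 & A != V].
Proof.
move=> V0; rewrite /conn V0 /= negb_forall => /existsP[A].
by rewrite negb_imply => /andP[/andP[pA A0] AV]; exists A.
Qed.

Lemma dg_part e V A x : part e V A -> x \in A -> dg e A x = dg e V x.
Proof.
move=> /partP[AV h] xA; apply: eq_card => y; rewrite !in_nb.
have [exy|] := boolP (e x y); rewrite ?andbF // !andbT.
by apply/idP/idP => [/(subsetP AV)//|yV]; apply: h xA yV exy.
Qed.

Lemma coreI_part e V A C : part e V A -> C \subset V -> core e C ->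
  C :&: A != set0 -> core e (C :&: A).
Proof.
move=> /partP[AV h] CV /coreP[_ hC] CA0; apply/coreP; split=> // x.
rewrite inE => /andP[xC xA]; apply: leq_trans (hC x xC) _.
apply/subset_leq_card/subsetP=> y; rewrite !in_nb !inE => /andP[yC exy].
by rewrite yC exy (h x y) // (subsetP CV).
Qed.

(** If [v] has at most one neighbour [u] in [A], removing [v] lowers the degree of [u] alone, so
    that [u] becomes the exceptional vertex of a smaller set. Cut vertices and bridges are handled
    by this, without following cycles. *)
Lemma near_core e A v : symmetric e -> irreflexive e ->
  (forall x, x \in A -> x != v -> 1 < dg e A x) ->
  (exists2 x, x \in A & x != v) -> exists2 B : {set T}, B \subset A & core e B.
Proof.
move=> se ie; have [n] := ubnP #|A|; elim: n A v => // n IH A v cA hA [x xA xv].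
have [cv|] := boolP ((v \in A) ==> (1 < dg e A v)).
  exists A => //; apply/coreP; split; first by apply/set0Pn; exists x.
  move=> y yA; have [yv|] := eqVneq y v; last exact: hA.
  by rewrite yv in yA *; move: cv; rewrite yA.
rewrite negb_imply -leqNgt => /andP[vA dv].
have [u hu] : exists u, forall y, y \in A -> e v y -> y = u.
  move: dv; rewrite leq_eqVlt ltnS leqn0 => /orP[/cards1P[u hu]|].
    by exists u => y yA evy; apply/set1P; rewrite -hu in_nb yA.
  rewrite cards_eq0 => /eqP nv; exists v => y yA evy.
  by have := in_set0 y; rewrite -nv in_nb yA evy.
have card' : #|A :\ v| < n by move: cA; rewrite [X in X < _](cardsD1 v) vA.
have hA' y : y \in A :\ v -> y != u -> 1 < dg e (A :\ v) y.
  rewrite !inE => /andP[yv yA] yu; apply: leq_trans (hA y yA yv) _.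
  apply/subset_leq_card/subsetP=> z; rewrite !in_nb !inE => /andP[zA eyz].
  rewrite zA eyz !andbT; apply: contraNneq yu => zv.
  by apply/eqP; apply: hu => //; rewrite se -zv.
have [B BA cB] : exists2 B : {set T}, B \subset A :\ v & core e B.
  apply: (IH _ u card' hA').
  have [xu|] := eqVneq x u; last by exists x => //; rewrite !inE xv.
  have := hA x xA xv; rewrite /dg (cardsD1 v) => dx.
  have /card_gt0P[y] : 0 < #|nb e A x :\ v|.
    by case: (v \in _) dx => /=; lia.
  rewrite !inE => /and3P[yv yA exy]; exists y; first by rewrite !inE yv.
  by apply: contraTneq exy => ->; rewrite -xu ie.
by exists B => //; apply: subset_trans BA (subD1set _ _).
Qed.

Lemma tau0 e : tau e set0 = 0.
Proof.
apply/eqP; rewrite -leqn0 -(cards0 T); apply/tau_le/fvsP => A.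
by rewrite subset0 => /eqP-> /coreP[]; rewrite eqxx.
Qed.

(** [D] goes into the hitting set and [W] may then be discarded, because no cycle avoiding [D]
    passes through it: typically [D] together with the leaves stripped after its deletion. *)
Lemma tau_red e V W D :
  (forall A, A \subset V -> core e A -> [disjoint A & D] -> [disjoint A & W]) ->
  tau e V <= #|D| + tau e (V :\: W).
Proof.
move=> h; have [S fS <-] := tau_fvs e (V :\: W).
apply: leq_trans (leq_card_setU D S); apply/tau_le/fvsP=> A AV cA.
have [dA|] := boolP [disjoint A & D]; last first.
  by rewrite -setI_eq0 => /set0Pn[x]; rewrite inE => /andP[xA xD]; exists x; rewrite // inE xD.
have dW := h A AV cA dA.
have AVW : A \subset V :\: W by rewrite subsetD AV.
by have /fvsP/(_ A AVW cA)[x xA xS] := fS; exists x; rewrite // inE xS orbT.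
Qed.

Lemma tau_set1 e V x : tau e V <= (tau e (V :\ x)).+1.
Proof.
have := @tau_red e V [set x] [set x]; rewrite cards1; apply.
by [].
Qed.

Lemma tau_split e V A : symmetric e -> part e V A ->
  tau e V <= tau e A + tau e (V :\: A).
Proof.
move=> se pA; have [S1 f1 <-] := tau_fvs e A; have [S2 f2 <-] := tau_fvs e (V :\: A).
apply: leq_trans (leq_card_setU S1 S2); apply/tau_le/fvsP=> C CV cC.
have [C0|C0] := eqVneq (C :&: A) set0.
  have CA : C \subset V :\: A by rewrite subsetD CV -setI_eq0 C0 eqxx.
  by have /fvsP/(_ _ CA cC)[x xC xS] := f2; exists x; rewrite // inE xS orbT.
have cCA := coreI_part pA CV cC C0.
have /fvsP/(_ _ (subsetIr _ _) cCA)[x xC xS] := f1.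
by exists x; [move: xC; rewrite inE => /andP[] | rewrite inE xS].
Qed.

(* A vertex set whose vertices, [v] excepted, have all their [C]-neighbours in
   [A] meets a core [C] in the empty set, in [{v}], or in a set containing a core. *)
Lemma core_side e A C v : symmetric e -> irreflexive e -> core e C ->
  (forall x y, x \in C :&: A -> x != v -> y \in C -> e x y -> y \in A) ->
  (exists2 x, x \in C :&: A & x != v) ->
  exists2 B : {set T}, B \subset C :&: A & core e B.
Proof.
move=> se ie /coreP[_ cC] h ex; apply: (near_core se ie _ ex) => x xCA xv.
have xC : x \in C by move: xCA; rewrite inE => /andP[].
apply: leq_trans (cC x xC) _; apply/subset_leq_card/subsetP=> y.
by rewrite !in_nb inE => /andP[yC exy]; rewrite yC exy (h x).
Qed.

(** Every core contains one that lies on a single side, [v] included, so the two sides can be hit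
    separately. If adding [v] to [A] does not raise the optimum, the first bound follows; if it
    does, the extra unit pays for choosing [v] itself. *)
Lemma tau_cutv e V A B v : symmetric e -> irreflexive e ->
  V = v |: (A :|: B) -> [disjoint A & B] -> v \notin A -> v \notin B ->
  (forall x y, x \in A -> y \in B -> ~~ e x y) ->
  tau e V <= tau e A + tau e (v |: B) \/ tau e V <= tau e (v |: A) + tau e B.
Proof.
move=> se ie VE dAB vA vB nAB.
have le1 : tau e V <= tau e (v |: A) + tau e (v |: B).
  have [S1 f1 <-] := tau_fvs e (v |: A); have [S2 f2 <-] := tau_fvs e (v |: B).
  apply: leq_trans (leq_card_setU S1 S2); apply/tau_le/fvsP=> C CV cC.
  have side X Y S : V = v |: (X :|: Y) -> (forall x y, x \in X -> y \in Y -> ~~ e x y) ->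
      fvs e (v |: X) S -> (exists2 x, x \in C & x \in X) -> v \notin X -> exists2 x, x \in C & x \in S.
    move=> VX nXY fS [x xC xX] vX.
    have [D DC cD] : exists2 D : {set T}, D \subset C :&: (v |: X) & core e D.
      apply: (core_side (v := v) se ie cC).
        move=> z y; rewrite !inE => /andP[zC]; case: eqVneq => //= _ zX _ yC ezy.
        have := subsetP CV y yC; rewrite VX !inE => /or3P[-> //|->|yY]; first by rewrite orbT.
        by move: (nXY _ _ zX yY); rewrite ezy.
      by exists x; [rewrite !inE xC xX orbT | apply: contraNneq vX => <-].
    have DX := subset_trans DC (subsetIr _ _).
    have /fvsP/(_ _ DX cD)[z zD zS] := fS; exists z => //.
    by apply: (subsetP (subset_trans DC (subsetIl _ _))).
  have [/exists_inP[x xC xA]|nA] := boolP [exists x in C, x \in A].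
    have [z zC zS] := side _ _ _ VE nAB f1 (ex_intro2 _ _ x xC xA) vA.
    by exists z; rewrite // inE zS.
  have [/exists_inP[x xC xA]|nB] := boolP [exists x in C, x \in B].
    have [||z zC zS] := side B A _ _ _ f2 (ex_intro2 _ _ x xC xA) vB.
    - by rewrite setUC [B :|: A]setUC setUC.
    - by move=> y z yB zA; rewrite se nAB.
    by exists z; rewrite // inE zS orbT.
  have Cv : C \subset [set v].
    apply/subsetP=> x xC; have := subsetP CV x xC; rewrite VE !inE => /or3P[//|xA|xB].
      by case/exists_inP: nA; exists x.
    by case/exists_inP: nB; exists x.
  have C1 : C \subset v |: A by apply: subset_trans Cv (subsetUl _ _).
  by have /fvsP/(_ _ C1 cC)[z zC zS] := f1; exists z; rewrite // inE zS.
have [leA|gtA] := leqP (tau e (v |: A)) (tau e A); first by left; lia.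
right; apply: (leq_trans (n := (tau e A).+1 + tau e B)); last by lia.
apply: (leq_trans (tau_set1 e V v)); rewrite addSn ltnS.
have -> : V :\ v = A :|: B.
  apply/setP=> x; rewrite VE !inE; case: eqVneq => //= ->.
  by rewrite (negPf vA) (negPf vB).
have pA : part e (A :|: B) A.
  apply/partP; split; first exact: subsetUl.
  move=> x y xA; rewrite inE => /orP[//|yB] exy.
  by move: (nAB _ _ xA yB); rewrite exy.
apply: leq_trans (tau_split se pA) _; rewrite leq_add2l.
by rewrite setDUl setDv set0U (setDidPl _) // disjoint_sym.
Qed.

(** A core meeting [A] outside [c] can leave [A] only at [c], hence contains a core inside [A];
    likewise beyond the bridge with [d]. A core within [{c, d}] would be too small for minimum
    degree two. *)
Lemma tau_bridge e V A c d : symmetric e -> irreflexive e -> A \subset V ->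
  (forall x y, x \in A -> y \in V :\: A -> e x y -> x = c /\ y = d) ->
  tau e V <= tau e A + tau e (V :\: A).
Proof.
move=> se ie AV br.
have [S1 f1 <-] := tau_fvs e A; have [S2 f2 <-] := tau_fvs e (V :\: A).
apply: leq_trans (leq_card_setU S1 S2); apply/tau_le/fvsP=> C CV cC.
have side X S u : fvs e X S ->
    (forall x y, x \in C :&: X -> x != u -> y \in C -> e x y -> y \in X) ->
    (exists2 x, x \in C & (x \in X) && (x != u)) -> exists2 x, x \in C & x \in S.
  move=> fS h [x xC /andP[xX xu]].
  have [|D DC cD] := core_side (v := u) se ie cC h; first by exists x; rewrite // inE xC.
  have DX := subset_trans DC (subsetIr _ _).
  have /fvsP/(_ _ DX cD)[z zD zS] := fS; exists z => //.
  by apply: (subsetP (subset_trans DC (subsetIl _ _))).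
have [/exists_inP[x xC xA]|nA] := boolP [exists x in C, (x \in A) && (x != c)].
  have [||z zC zS] := side _ _ c f1; [|by exists x|by exists z; rewrite // inE zS].
  move=> z y; rewrite inE => /andP[zC zA] zc yC ezy; apply: contraNT zc => yA.
  by have [] := br z y zA; rewrite ?inE ?yA ?(subsetP CV) //; move->.
have [/exists_inP[x xC xA]|nB] := boolP [exists x in C, (x \in V :\: A) && (x != d)].
  have [||z zC zS] := side _ _ d f2; [|by exists x|by exists z; rewrite // inE zS orbT].
  move=> z y; rewrite inE => /andP[zC zA] zd yC ezy.
  rewrite inE (subsetP CV) // andbT; apply: contraNN zd => yA.
  by have [|_ ->] := br y z yA zA; rewrite // se.
have Ccd : C \subset [set c; d].
  apply/subsetP=> x xC; rewrite !inE; have := subsetP CV x xC => xV.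
  have [xA|xA] := boolP (x \in A).
    by apply/orP; left; apply: contraNT nA => xc; apply/exists_inP; exists x; rewrite ?xA.
  by apply/orP; right; apply: contraNT nB => xd; apply/exists_inP; exists x; rewrite // inE xA xV.
have /coreP[/set0Pn[x xC] /(_ x) ] := cC; move/(_ xC).
have : nb e C x \subset [set c; d] :\ x.
  apply/subsetP=> y; rewrite in_nb => /andP[yC exy]; rewrite 2!inE (subsetP Ccd) // andbT.
  by apply: contraTneq exy => ->; rewrite ie.
move/subset_leq_card => le1 lt1; have lt2 := leq_trans lt1 le1.
have : #|[set c; d]| <= 2 by rewrite cards2; case: eqP.
by rewrite (cardsD1 x) (subsetP Ccd) // add1n ltnS leqNgt lt2.
Qed.

(** Deleting [a], or deleting [b], turns the other edge of the cut into a bridge. If one of these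
    deletions lowers the optimum of its side, the unit spent is recovered; if neither does, the end
    on the other side is removed for free. *)
Lemma tau_2cut e V A a b c d : symmetric e -> irreflexive e -> A \subset V ->
  a \in A -> b \in V :\: A ->
  (forall x y, x \in A -> y \in V :\: A -> e x y ->
     x = a /\ y = b \/ x = c /\ y = d) ->
  tau e V <= tau e A + tau e (V :\: A) \/
  tau e V <= (tau e (A :\ a) + tau e (V :\: A :\ b)).+1.
Proof.
move=> se ie AV aA bB br.
have bA : b \notin A by move: bB; rewrite inE => /andP[].
have le1 : tau e V <= (tau e (A :\ a) + tau e (V :\: A)).+1.
  apply: leq_trans (tau_set1 e V a) _; rewrite ltnS.
  have E : V :\ a :\: (A :\ a) = V :\: A.
    by apply/setP=> x; rewrite !inE; case: eqVneq => //= ->; rewrite aA.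
  rewrite -E; apply: (tau_bridge (c := c) (d := d)) => //; first exact: setSD.
  move=> x y; rewrite E inE => /andP[xa xA] yB exy.
  by have [[xa' _]|//] := br x y xA yB exy; rewrite xa' inE eqxx in xa.
have le2 : tau e V <= (tau e A + tau e (V :\: A :\ b)).+1.
  apply: leq_trans (tau_set1 e V b) _; rewrite ltnS.
  have E : V :\ b :\: A = V :\: A :\ b by rewrite !setDDl setUC.
  rewrite -E; apply: (tau_bridge (c := c) (d := d)) => //.
    by rewrite subsetD1 AV.
  move=> x y xA; rewrite E inE => /andP[yb yB] exy.
  by have [[_ yb']|//] := br x y xA yB exy; rewrite yb' inE eqxx in yb.
have := tau_set1 e A a; have := tau_set1 e (V :\: A) b; lia.
Qed.

Lemma leaf_notin e V A x y : core e A -> A \subset V ->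
  (forall z, z \in V -> e x z -> z \in A -> z = y) -> x \notin A.
Proof.
move=> /coreP[_ cA] AV h; apply/negP => /cA; rewrite ltnNge => /negP; apply.
rewrite -(cards1 y); apply/subset_leq_card/subsetP=> z; rewrite in_nb => /andP[zA exz].
by rewrite inE; apply/eqP/h => //; apply: (subsetP AV).
Qed.

End Cores.

(** * Vertex weights *)

Section Weights.
Variable T : finType.
Implicit Types (e : rel T) (A B C D S V W R : {set T}) (x y z : T).

Definition wgt d := match d with 0 => 0 | 1 => 5 | 2 => 11 | d'.+3 => 19 + 5 * d' end.
Definition wt e V := \sum_(x in V) wgt (dg e V x).
(* Deleting [k] neighbours of a vertex of degree [d] lowers its weight by at least
   [5 k], and by [3] more when [bonus d k]. *)
Definition bonus d k := ((d == 3) && (0 < k)) || ((d == 4) && (1 < k)).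
Definition deg_to e (s : seq T) x := \sum_(y <- s) (e x y : nat).

Lemma wgt3 n : wgt n.+3 = 19 + 5 * n.
Proof. by []. Qed.

(** The excess of the line [4 + 5 d] over the weight is 4, 4, 3 for [d = 0, 1, 2] and zero from then
    on. It does not increase with [d], whence the slope 5, and it changes by 3 between degrees 2 and
    3, whence the bonus. *)
Lemma wgt_drop n k : wgt n + 5 * k + 3 * bonus (n + k) k <= wgt (n + k).
Proof.
case: n => [|[|[|n]]]; last first.
  have -> : n.+3 + k = (n + k).+3 by [].
  rewrite !wgt3 /bonus !eqSS; case b: (_ || _); last by rewrite muln0; lia.
  by case/orP: b => /andP[/eqP b1 b2]; lia.
all: case: k => [|[|[|[|[|k]]]]] //.
all: have b0 d : bonus (d + k.+4.+1) k.+4.+1 = false by rewrite /bonus !addnS.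
all: have E d : wgt (d + k.+4.+1) = 29 + 5 * (d + k) by rewrite !addnS wgt3; lia.
all: rewrite b0 E muln0.
- by change (wgt 2) with 11; lia.
- by change (wgt 1) with 5; lia.
- by change (wgt 0) with 0; lia.
Qed.

Lemma wgt_lin d : 2 < d -> wgt d = 4 + 5 * d.
Proof. by case: d => [|[|[|d]]] //= _; lia. Qed.

Lemma wgt_le d : wgt d <= 4 + 5 * d.
Proof. by case: d => [|[|[|d]]] //=; lia. Qed.

Lemma dg_sum e V x : dg e V x = \sum_(y in V) (e x y : nat).
Proof.
rewrite /dg -sum1_card; under eq_bigl do rewrite in_nb.
by rewrite -big_mkcondr /=; apply: eq_bigl.
Qed.

Lemma dg_set e s x : uniq s -> dg e [set y in s] x = deg_to e s x.
Proof.
move=> us; rewrite dg_sum /deg_to [RHS]big_uniq //=.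
by apply: eq_bigl => y; rewrite inE.
Qed.

Lemma dgD e V W x : W \subset V -> dg e V x = dg e (V :\: W) x + dg e W x.
Proof.
move=> WV; rewrite !dg_sum (big_setID W) /= (setIidPr WV) addnC; congr (_ + _).
Qed.

Lemma sum_dg_sym e A B : symmetric e ->
  \sum_(x in A) dg e B x = \sum_(x in B) dg e A x.
Proof.
move=> se; under eq_bigr do rewrite dg_sum; rewrite exchange_big /=.
by apply: eq_bigr => y _; rewrite dg_sum; apply: eq_bigr => x _; rewrite se.
Qed.

Lemma wt_side e V B (Y : {set T}) : B \subset V -> Y \subset B ->
  {in Y, forall y, bonus (dg e V y) (dg e (V :\: B) y)} ->
  wt e B + 5 * (\sum_(x in B) dg e (V :\: B) x) + 3 * #|Y| <= \sum_(x in B) wgt (dg e V x).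
Proof.
move=> BV YB hY; rewrite /wt -sum1_card.
have -> : \sum_(i in Y) 1 = \sum_(x in B) (x \in Y : nat).
  rewrite [RHS]big_mkcond [LHS]big_mkcond; apply: eq_bigr => x _.
  by case: ifP => [/(subsetP YB)->//|]; case: ifP.
rewrite !big_distrr /= -!big_split /=; apply: leq_sum => x xB.
have := @wgt_drop (dg e B x) (dg e (V :\: B) x).
have -> : dg e B x + dg e (V :\: B) x = dg e V x by rewrite (dgD e x BV) addnC.
by have [/hY->|_] := boolP (x \in Y); lia.
Qed.

Lemma wt_cat e V B : B \subset V ->
  wt e V = \sum_(x in B) wgt (dg e V x) + \sum_(x in V :\: B) wgt (dg e V x).
Proof. by move=> BV; rewrite /wt (big_setID B) /= (setIidPr BV). Qed.

(** A cut edge lowers a degree on either side, hence 10 for each. A second connected part needs an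
    additive 10 of its own, so a single cut edge already pays for a split. *)
Lemma wt_split e V A (Y : {set T}) : symmetric e -> A \subset V -> Y \subset A ->
  {in Y, forall y, bonus (dg e V y) (dg e (V :\: A) y)} ->
  wt e A + wt e (V :\: A) + 10 * (\sum_(x in A) dg e (V :\: A) x) + 3 * #|Y| <= wt e V.
Proof.
move=> se AV YA hY; rewrite (wt_cat _ AV).
have := wt_side AV YA hY.
have h0 : {in (set0 : {set T}),
    forall y, bonus (dg e V y) (dg e (V :\: (V :\: A)) y)} by move=> y; rewrite inE.
have := wt_side (subsetDl V A) (sub0set _) h0.
rewrite setDDr setDv set0U (setIidPr AV) cards0 (sum_dg_sym (V :\: A) A se); lia.
Qed.

(** The deleted vertices give up their weight, and each edge from [s] to the rest takes 5 from its
    outer end. Summing degrees over [s] also counts the inner edges, twice, although they take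
    nothing outside; the right-hand side returns this. *)
Lemma wt_removal e V (s ys : seq T) : symmetric e -> uniq s -> uniq ys ->
  {subset s <= V} -> {in ys, forall y, [&& y \in V, y \notin s & bonus (dg e V y) (deg_to e s y)]} ->
  wt e (V :\: [set x in s]) + \sum_(x <- s) (wgt (dg e V x) + 5 * dg e V x) + 3 * size ys
    <= wt e V + 5 * \sum_(x <- s) deg_to e s x.
Proof.
move=> se us uy sV hY; set W := [set x in s].
have WV : W \subset V by apply/subsetP=> x; rewrite inE => /sV.
have := @wt_side e V (V :\: W) [set y in ys] (subsetDl _ _).
have -> : V :\: (V :\: W) = W by rewrite setDDr setDv set0U (setIidPr WV).
rewrite (wt_cat e WV) cardsE (card_uniqP uy) => h.
have YS : [set y in ys] \subset V :\: W.
  by apply/subsetP=> y; rewrite !inE => /hY/and3P[-> ->].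
have hB : {in [set y in ys], forall y, bonus (dg e V y) (dg e W y)}.
  by move=> y; rewrite inE => /hY/and3P[_ _]; rewrite /W dg_set.
move: {h YS hB} (h YS hB) => h.
have E F : \sum_(x in W) F x = \sum_(x <- s) F x.
  by rewrite [RHS]big_uniq //=; apply: eq_bigl => x; rewrite inE.
have h2 : \sum_(x in V :\: W) dg e W x + \sum_(x in W) dg e W x = \sum_(x in W) dg e V x.
  by rewrite (sum_dg_sym (V :\: W) W se) -big_split; apply: eq_bigr => x _; rewrite (dgD e x WV).
have h3 : \sum_(x in W) dg e W x = \sum_(x <- s) deg_to e s x.
  by rewrite E; apply: eq_bigr => x _; rewrite /W dg_set.
rewrite -h3 -E big_split -big_distrr /=; lia.
Qed.

End Weights.

(** * Reductions in an inductive class of graphs *)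

Section Reductions.
Variable T : finType.
Implicit Types (e : rel T) (A B C D S V W R : {set T}) (x y z : T) (s ys : seq T).

Definition rem V s := V :\: [set x in s].
Definition tfree e V := forall x y z, x \in V -> y \in V -> z \in V ->
  e x y -> e y z -> e z x -> False.
Definition add_edge e p q : rel T :=
  fun x y => [|| e x y, (x == p) && (y == q) | (x == q) && (y == p)].

Lemma in_rem V s x : (x \in rem V s) = (x \notin s) && (x \in V).
Proof. by rewrite !inE. Qed.

Lemma rem_sub V s : rem V s \subset V.
Proof. exact: subsetDl. Qed.

Lemma rem1 V x : rem V [:: x] = V :\ x.
Proof. by apply/setP=> y; rewrite !inE. Qed.

Lemma rem_cat V s1 s2 : rem (rem V s1) s2 = rem V (s1 ++ s2).
Proof. by apply/setP=> y; rewrite !inE mem_cat negb_or andbCA andbA. Qed.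

Lemma card_rem V s x : x \in s -> x \in V -> #|rem V s| < #|V|.
Proof.
move=> xs xV; apply: proper_card; apply/properP; split; first exact: rem_sub.
by exists x; rewrite // in_rem xs.
Qed.

(** Suppression replaces the adjacency relation, so the induction cannot stay within the induced
    subgraphs of one graph. Planarity is kept abstract, as a property stable under the two
    operations in use; grid minors will be its instance. *)
Variable Pl : rel T -> {set T} -> Prop.

Record good e V : Prop := Good {
  gsym : symmetric e; girr : irreflexive e; gtf : tfree e V; gpl : Pl e V }.

Hypothesis Pl_sub : forall e V W, W \subset V -> Pl e V -> Pl e W.
Hypothesis Pl_sup : forall e V x p q, symmetric e -> Pl e V ->
  x \in V -> p \in V -> q \in V -> p != x -> q != x -> e x p -> e x q ->
  Pl (add_edge e p q) (V :\ x).

(* The bound proved for connected graphs by induction is [slack e V 0]. *)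
Definition slack e V K := 54 * tau e V + K <= wt e V + 10.

Lemma good_sub e V W : W \subset V -> good e V -> good e W.
Proof.
move=> WV [se ie te pe]; split=> //; last exact: Pl_sub pe.
by move=> x y z xW yW zW; apply: te; apply: (subsetP WV).
Qed.

Lemma good_rem e V s : good e V -> good e (rem V s).
Proof. exact/good_sub/rem_sub. Qed.

Lemma wt_part e V A : symmetric e -> part e V A -> wt e V = wt e A + wt e (V :\: A).
Proof.
move=> se pA; have [AV _] := partP _ _ _ pA.
rewrite (wt_cat e AV) /wt; congr (_ + _); apply: eq_bigr => x xA.
  by rewrite (dg_part pA).
by rewrite (dg_part (partD se pA)).
Qed.

(** A cycle through [x] runs through both [p] and [q] and becomes one through the new edge. The
    degrees of [p] and [q] are unchanged, so exactly the weight 11 of [x] is saved, and no triangle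
    arises as [p] and [q] have no common neighbour besides [x]. *)
Lemma suppress_spec e V x p q : good e V -> conn e V -> x \in V -> p \in V -> q \in V ->
  p != q -> e x p -> e x q -> (forall z, z \in V -> e x z -> z = p \/ z = q) ->
  (forall z, z \in V -> z != x -> e p z -> e q z -> False) ->
  let e' := add_edge e p q in let V' := V :\ x in
  [/\ good e' V', conn e' V', wt e V = wt e' V' + 11 & tau e V <= tau e' V'].
Proof.
move=> [se ie te pe] /connP[V0 cV] xV pV qV pq exp exq nbx cpq e' V'.
have px : p != x by apply: contraTneq exp => ->; rewrite ie.
have qx : q != x by apply: contraTneq exq => ->; rewrite ie.
have se' : symmetric e'.
  move=> y z; rewrite /e' /add_edge se; congr (_ || _); rewrite orbC.
  by congr (_ || _); apply: andbC.
have epq : e p q = false by apply/negP=> h; apply: (te x p q) => //; rewrite se.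
have exx y : e x y -> y != x by move=> h; apply: contraTneq h => ->; rewrite ie.
have xN y : y \in V -> y != p -> y != q -> e y x = false.
  by move=> yV yp yq; apply/negP; rewrite se => /(nbx _ yV)[E|E]; rewrite E eqxx in yp yq.
have dgo A y : y \in V -> y != p -> y != q -> dg e' (A :\ x) y = dg e A y.
  move=> yV yp yq; apply: eq_card => z; rewrite !in_nb !inE /e' /add_edge.
  rewrite (negPf yp) (negPf yq) /= orbF; case: eqVneq => //= ->.
  by rewrite xN // andbF.
(* An end of the new edge trades [x] for the other end. Stated for every [A], since it serves both
   for the weights, with [A = V], and for cores. *)
have dgu A u v : u = p /\ v = q \/ u = q /\ v = p ->
    dg e' (A :\ x) u + (x \in A) = dg e A u + (v \in A).
  move=> uv.
  have e'u z : e' u z = e u z || (z == v).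
    rewrite /e' /add_edge; case: uv => -[-> ->]; rewrite eqxx /= ?(negPf pq) //=.
      by rewrite orbF.
    by rewrite eq_sym (negPf pq).
  have uvF : e u v = false by case: uv => -[-> ->] //; rewrite se.
  have ux : e u x by case: uv => -[-> _]; rewrite se.
  have vx : v != x by case: uv => -[_ ->].
  have -> : dg e' (A :\ x) u = #|nb e A u :\ x| + (v \in A).
    rewrite /dg; have [vA|vA] := boolP (v \in A).
      have -> : nb e' (A :\ x) u = v |: (nb e A u :\ x).
        apply/setP=> z; rewrite !inE e'u; have [->|zv] := eqVneq z v.
          by rewrite vA vx orbT.
        by rewrite orbF andbA.
      by rewrite cardsU1 !inE uvF !andbF addnC.
    rewrite addn0; apply: eq_card => z; rewrite !inE e'u.
    have [->|zv] := eqVneq z v; first by rewrite (negPf vA) /= !andbF.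
    by rewrite orbF andbA.
  by rewrite /dg [in RHS](cardsD1 x (nb e A u)) in_nb ux andbT addnAC; congr (_ + _); rewrite addnC.
have V'E : V' = rem V [:: x] by rewrite rem1.
have te' : tfree e' V'.
  have h y z t : y \in V' -> z \in V' -> t \in V' -> e y z -> e z t ->
      (t == p) && (y == q) || (t == q) && (y == p) -> False.
    rewrite !inE => /andP[yx yV] /andP[zx zV] /andP[tx tV] eyz ezt /orP[]/andP[/eqP E1 /eqP E2]; subst.
      by apply: (cpq z) => //; rewrite se.
    by apply: (cpq z) => //; rewrite se.
  have h2 y z : e' y z = e y z || ((y == p) && (z == q) || (y == q) && (z == p)) by [].
  have h3 a b c : (a == p) && (b == q) || (a == q) && (b == p) ->
     (b == p) && (c == q) || (b == q) && (c == p) -> (a == p) && (c == p) || (a == q) && (c == q).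
    case/orP=> /andP[/eqP-> /eqP->] /orP[]/andP[E1 /eqP->]; rewrite ?eqxx ?orbT //.
      by rewrite eq_sym (negPf pq) in E1.
    by rewrite (negPf pq) in E1.
  have nn a b : (a == p) && (b == q) || (a == q) && (b == p) -> a != b.
    by case/orP=> /andP[/eqP-> /eqP->] //; rewrite eq_sym.
  have sy a b : (a == p) && (b == q) || (a == q) && (b == p) ->
     (b == p) && (a == q) || (b == q) && (a == p).
    by case/orP=> /andP[-> ->]; rewrite ?orbT.
  move=> y z t yV zV tV; rewrite !h2 => /orP[eyz|Ayz] /orP[ezt|Azt] /orP[ety|Aty].
  - by move: yV zV tV; rewrite !inE => /andP[_ ?] /andP[_ ?] /andP[_ ?]; apply: (te y z t).
  - exact: (h y z t).
  - exact: (h t y z).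
  - by case/orP: (h3 _ _ _ Azt Aty) => /andP[/eqP E1 /eqP E2]; move: eyz; rewrite E1 E2 ie.
  - exact: (h z t y).
  - by case/orP: (h3 _ _ _ Aty Ayz) => /andP[/eqP E1 /eqP E2]; move: ezt; rewrite E1 E2 ie.
  - by case/orP: (h3 _ _ _ Ayz Azt) => /andP[/eqP E1 /eqP E2]; move: ety; rewrite E1 E2 ie.
  - by have := nn _ _ Aty; case/orP: (h3 _ _ _ Ayz Azt) => /andP[/eqP-> /eqP->]; rewrite eqxx.
split.
- split=> //; last exact: Pl_sup.
  move=> y; rewrite /e' /add_edge ie /=; apply/negP => /orP[]/andP[/eqP-> /eqP E];
    by rewrite E eqxx in pq.
- apply/connP; split; first by apply/set0Pn; exists p; rewrite !inE px.
  move=> A /partP[AV hA] A0; pose A2 := if p \in A then x |: A else A.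
  have xA : x \notin A by apply/negP=> /(subsetP AV); rewrite !inE eqxx.
  have pqA : (p \in A) = (q \in A).
    have epq' : e' p q by rewrite /e' /add_edge !eqxx orbT.
    apply/idP/idP => h; apply: hA h _ _; rewrite ?inE ?px ?qx //.
    by rewrite se'.
  have pA2 : part e V A2.
    apply/partP; split.
      rewrite /A2; case: ifP => _; rewrite ?subUset ?sub1set ?xV /=;
      exact: (subset_trans AV (subD1set _ _)).
    move=> y z yA2 zV eyz; have [zx|zx] := eqVneq z x.
      subst z; rewrite /A2; have yA : y \in A.
        by move: yA2; rewrite /A2; case: ifP; rewrite // !inE => _ /orP[/eqP E|//]; rewrite E ie in eyz.
      have yV : y \in V by move: (subsetP AV y yA); rewrite !inE => /andP[].
      have [yp|yp] := eqVneq y p; first by rewrite -yp yA !inE eqxx.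
      have [yq|yq] := eqVneq y q; first by rewrite pqA -yq yA !inE eqxx.
      by rewrite xN in eyz.
    have [yx|yx] := eqVneq y x.
      subst y; have pA : p \in A by move: yA2; rewrite /A2; case: ifP => // _; rewrite (negPf xA).
      by rewrite /A2 pA !inE; case: (nbx z zV eyz) => ->; rewrite -?pqA pA orbT.
    have yA : y \in A by move: yA2; rewrite /A2; case: ifP; rewrite // !inE (negPf yx).
    have zA : z \in A by apply: (hA y) => //; rewrite ?inE ?zx // /e' /add_edge eyz.
    by rewrite /A2; case: ifP => //; rewrite !inE zA orbT.
  have A20 : A2 != set0.
    by case/set0Pn: A0 => y yA; apply/set0Pn; exists y; rewrite /A2; case: ifP; rewrite // !inE yA orbT.
  have A2V := cV _ pA2 A20; apply/setP=> y; rewrite !inE; have [->|yx] := eqVneq y x.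
    by rewrite (negPf xA).
  by rewrite -A2V /A2; case: ifP; rewrite // !inE (negPf yx).
- rewrite /wt (big_setD1 x) //=; have -> : dg e V x = 2.
    rewrite /dg (_ : nb e V x = [set p; q]) ?cards2 ?pq //; apply/setP=> z; rewrite !inE.
    apply/andP/orP => [[zV /(nbx _ zV)[]->]|[]/eqP->]; rewrite ?eqxx; by [left|right|].
  rewrite addnC; congr (_ + _); apply: eq_bigr => y; rewrite !inE => /andP[yx yV]; congr wgt.
  have [yp|yp] := eqVneq y p; first by have := dgu V p q (or_introl (conj erefl erefl)); rewrite yp xV qV => /addIn.
  have [yq|yq] := eqVneq y q; first by have := dgu V q p (or_intror (conj erefl erefl)); rewrite yq xV pV => /addIn.
  by rewrite dgo.
have [S fS <-] := tau_fvs e' V'; apply/tau_le/fvsP=> A AV /[dup] cA /coreP[A0 hA].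
have A'V : A :\ x \subset V' by apply: setSD.
have xpq : x \in A -> p \in A /\ q \in A.
  move=> xA; have h := hA x xA.
  have : nb e A x \subset [set p; q].
    apply/subsetP=> z; rewrite in_nb !inE => /andP[zA exz].
    by have [->|->] := nbx z (subsetP AV z zA) exz; rewrite eqxx ?orbT.
  move=> sub; have E : nb e A x = [set p; q].
    by apply/eqP; rewrite eqEcard sub cards2 pq.
  have := in_nb e A x p; have := in_nb e A x q; rewrite E !inE !eqxx orbT /=.
  by do 2!move/esym/andP=> [-> _].
have cA' : core e' (A :\ x).
  apply/coreP; split.
    have [xA|xA] := boolP (x \in A).
      by have [pA _] := xpq xA; apply/set0Pn; exists p; rewrite !inE px.
    by case/set0Pn: A0 => y yA; apply/set0Pn; exists y; rewrite !inE yA andbT; apply: contraNneq xA => <-.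
  move=> y; rewrite !inE => /andP[yx yA]; have := hA y yA => h.
  have yV := subsetP AV y yA.
  have hh u v : u = p /\ v = q \/ u = q /\ v = p -> u \in A -> 1 < dg e' (A :\ x) u.
    move=> uv uA; have := dgu A u v uv; have := hA u uA.
    have : x \in A -> v \in A by move=> /xpq[]; case: uv => -[_ ->].
    clear; case: (x \in A); case: (v \in A) => // hx h1 h2.
    - by move/addIn: h2 => ->.
    - by have := hx isT.
    - by move: h2; rewrite addn0 addn1 => ->; rewrite ltnW.
    - by move: h2; rewrite !addn0 => ->.
  have [yp|yp] := eqVneq y p; first by rewrite yp in yA *; apply: (hh p q) => //; left.
  have [yq|yq] := eqVneq y q; first by rewrite yq in yA *; apply: (hh q p) => //; right.
  by rewrite dgo.
have /fvsP/(_ _ A'V cA')[y yA yS] := fS; exists y => //.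
by move: yA; rewrite !inE => /andP[].
Qed.


Section Induction.
Variable N : nat.
Hypothesis IH : forall e V, good e V -> conn e V -> #|V| < N -> slack e V 0.

(** Every component takes an additive 10 of its own, and their number is bounded by charging at
    least [k] units of [mu] to each. In use, [mu] mostly counts edges to deleted vertices. *)
Lemma parts_bound e R (mu : T -> nat) k : good e R -> #|R| < N -> 0 < k ->
  (forall A, part e R A -> A != set0 -> k <= \sum_(x in A) mu x) ->
  54 * tau e R <= wt e R + 10 * ((\sum_(x in R) mu x) %/ k).
Proof.
move=> + + k0; have [n] := ubnP #|R|; elim: n R => // n IHn R cR gR RN hk.
have [->|R0] := eqVneq R set0; first by rewrite tau0.
have pR : part e R R by apply/partP; split.
have [cR'|] := boolP (conn e R).
  have := IH gR cR' RN; rewrite /slack; have := hk R pR R0.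
  by rewrite -(divn_gt0 _ k0); lia.
move=> /(nconn_part R0)[A [pA A0 AR]]; have [AsR _] := partP _ _ _ pA.
have se := gsym gR; have pB := partD se pA.
have cA : #|A| < #|R| by apply: proper_card; rewrite properEneq AR.
have cB : #|R :\: A| < #|R|.
  by rewrite -(cardsID A R) (setIidPr AsR) -[X in X < _]add0n ltn_add2r card_gt0.
have hA := IHn A _ (good_sub AsR gR) _ _; have {}hA := hA ltac:(lia) ltac:(lia).
have hB := IHn (R :\: A) _ (good_sub (subsetDl R A) gR) _ _; have {}hB := hB ltac:(lia) ltac:(lia).
have {}hA := hA (fun B pB0 => hk B (part_sub pA pB0)).
have {}hB := hB (fun B pB0 => hk B (part_sub pB pB0)).
have := tau_split se pA; rewrite (wt_part se pA) (big_setID A) /= (setIidPr AsR).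
have divD m n' : m %/ k + n' %/ k <= (m + n') %/ k.
  by rewrite leq_divRL // mulnDl leq_add ?leq_divM.
have := divD (\sum_(x in A) mu x) (\sum_(x in R :\: A) mu x); lia.
Qed.

(** All edges leaving [A] end in [v], so a part of [V :\: A] that misses [v] would already be closed
    in [V]. *)
Lemma conn_cut e V v A : symmetric e -> conn e V -> v \in V -> part e (V :\ v) A ->
  conn e (V :\: A).
Proof.
move=> se /connP[V0 cV] vV pA; have [AV hA] := partP _ _ _ pA.
have vA : v \notin A by apply/negP=> /(subsetP AV); rewrite !inE eqxx.
have AsV : A \subset V := subset_trans AV (subD1set _ _).
apply/connP; split; first by apply/set0Pn; exists v; rewrite inE vA.
move=> P /[dup] pP /partP[PV hP] P0.
have lift Q : part e (V :\: A) Q -> v \notin Q -> part e V Q.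
  move=> /partP[QV hQ] vQ; apply/partP; split; first exact: subset_trans QV (subsetDl _ _).
  move=> x y xQ yV exy; apply: (hQ x) => //; rewrite inE yV andbT; apply/negP=> yA.
  have := subsetP QV x xQ; rewrite inE => /andP[xA xV]; case/negP: xA.
  apply: (hA y) => //; last by rewrite se.
  by rewrite !inE xV andbT; apply: contraNneq vQ => <-.
have [vP|vP] := boolP (v \in P); last first.
  have E := cV P (lift P pP vP) P0.
  by rewrite E vV in vP.
have [E|QN] := eqVneq (V :\: A :\: P) set0.
  by apply/eqP; rewrite eqEsubset PV -setD_eq0 E eqxx.
have pQ := partD se pP; have vQ : v \notin V :\: A :\: P by rewrite inE vP.
have E := cV _ (lift _ pQ vQ) QN.
by move: vQ; rewrite E vV.
Qed.

Lemma conn_strip e V x z : symmetric e -> conn e V -> x \in V -> 1 < #|V| ->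
  (forall y, y \in V -> e x y -> y = z) -> conn e (V :\ x).
Proof.
move=> se /connP[V0 cV] xV V1 hx; apply/connP; split.
  by rewrite -card_gt0; have := cardsD1 x V; rewrite xV; lia.
move=> A /partP[AV hA] A0.
have xA : x \notin A by apply/negP=> /(subsetP AV); rewrite !inE eqxx.
have AsV : A \subset V := subset_trans AV (subD1set _ _).
pose A2 := if z \in A then x |: A else A.
have pA2 : part e V A2.
  apply/partP; split; first by rewrite /A2; case: ifP => //; rewrite subUset sub1set xV.
  move=> u y uA yV euy; have [ux|ux] := eqVneq u x.
    subst u; have zA : z \in A by move: uA; rewrite /A2; case: ifP; rewrite // (negPf xA).
    by rewrite /A2 zA !inE (hx y) // zA orbT.
  have {}uA : u \in A by move: uA; rewrite /A2; case: ifP; rewrite // !inE (negPf ux).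
  have [yx|yx] := eqVneq y x.
    subst y; have uz : u = z by apply: hx; rewrite ?(subsetP AsV) // se.
    by rewrite /A2 -uz uA !inE eqxx.
  have yA : y \in A by apply: (hA u) => //; rewrite !inE yx.
  by rewrite /A2; case: ifP; rewrite // !inE yA orbT.
have A20 : A2 != set0.
  by case/set0Pn: A0 => y yA; apply/set0Pn; exists y; rewrite /A2; case: ifP; rewrite // !inE yA orbT.
have A2V := cV _ pA2 A20; apply/setP=> y; rewrite !inE; have [->|yx] := eqVneq y x.
  by rewrite (negPf xA).
by rewrite -A2V /A2; case: ifP; rewrite // !inE (negPf yx).
Qed.

(** By [tau_cutv] one side can give up [v]. The [d] edges from [v] to it pay [10 d]; that side has
    at most [d / k] components, each taking 10, while the other side with [v] stays connected and
    takes the 10 that the bound grants. *)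
Lemma cut_slack e V v A k : good e V -> conn e V -> #|V| <= N -> v \in V ->
  part e (V :\ v) A -> A != set0 -> A != V :\ v -> 0 < k ->
  (forall P, part e (V :\ v) P -> P != set0 -> k <= dg e P v) ->
  exists2 d, k <= d & slack e V (10 * (d - d %/ k)).
Proof.
move=> gV cV VN vV pA A0 AnV k0 hk; have se := gsym gV; have ie := girr gV.
have AV : A \subset V :\ v by case/partP: pA.
set B := V :\ v :\: A; have pB : part e (V :\ v) B := partD se pA.
have B0 : B != set0.
  by apply: contra AnV; rewrite setD_eq0 => h; rewrite eqEsubset AV.
have BV : B \subset V :\ v := subsetDl _ _.
have vA : v \notin A by apply/negP=> /(subsetP AV); rewrite !inE eqxx.
have vB : v \notin B by rewrite /B !inE eqxx andbF.
have VE : V = v |: (A :|: B).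
  apply/setP=> x; rewrite !inE; have [->|xv] := eqVneq x v; first by rewrite vV.
  by have [xA|//] := boolP (x \in A); have := subsetP AV x xA; rewrite !inE => /andP[_ ->].
have dAB : [disjoint A & B].
  by rewrite -setI_eq0 /B setIDA setDIl setDv set0I.
have nAB x y : x \in A -> y \in B -> ~~ e x y.
  move=> xA yB; apply/negP=> exy; have [_ h] := partP _ _ _ pA.
  by have := h x y xA (subsetP BV y yB) exy; move: yB; rewrite inE => /andP[/negPf->].
have main A' B' : part e (V :\ v) A' -> A' != set0 -> B' != set0 ->
    V = v |: (A' :|: B') -> [disjoint A' & B'] ->
    v \notin A' -> v \notin B' -> tau e V <= tau e A' + tau e (v |: B') ->
    exists2 d, k <= d & slack e V (10 * (d - d %/ k)).
  move=> pA' A'0 B'0 VE' dAB' vA' vB' le; exists (dg e A' v); first exact: hk.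
  have [A'V hA'] := partP _ _ _ pA'.
  have A'sV : A' \subset V := subset_trans A'V (subD1set _ _).
  have BE : v |: B' = V :\: A'.
    apply/setP=> x; rewrite VE' !inE; case: eqVneq => [->|_] /=; first by rewrite vA'.
    have [xA|//] := boolP (x \in A').
    by move/pred0P/(_ x): dAB' => /=; rewrite xA.
  have cB' : conn e (v |: B') by rewrite BE; apply: conn_cut vV pA'.
  have subV : v |: B' \subset V by rewrite BE subsetDl.
  have ltA : #|A'| < N.
    apply: leq_trans VN; apply: proper_card; apply/properP; split=> //.
    by exists v.
  have ltB : #|v |: B'| < N.
    apply: leq_trans VN; apply: proper_card; apply/properP; split=> //.
    by case/set0Pn: A'0 => x xA; exists x; rewrite ?(subsetP A'sV) // BE inE xA.
  have h1 := IH (good_sub subV gV) cB' ltB.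
  have h2 : 54 * tau e A' <= wt e A' + 10 * (dg e A' v %/ k).
    rewrite dg_sum; apply: parts_bound => //; first exact: good_sub A'sV gV.
    by move=> P pP P0; rewrite -dg_sum; apply: hk => //; apply: part_sub pA' pP.
  have h0 : {in (set0 : {set T}), forall y, bonus (dg e V y) (dg e (V :\: A') y)}.
    by move=> y; rewrite inE.
  have := wt_split se A'sV (sub0set _) h0; rewrite cards0.
  have -> : \sum_(x in A') dg e (V :\: A') x = dg e A' v.
    rewrite (sum_dg_sym _ _ se) -BE big_setU1 //= big1 ?addn0 // => y yB.
    apply/eqP; rewrite cards_eq0; apply/eqP/setP=> x; rewrite !inE; apply/negP=> /andP[xA exy].
    have yA : y \in A'.
      apply: (hA' x) => //; last by rewrite se.
      by rewrite VE' !inE yB !orbT andbT; apply: contraNneq vB' => <-.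
    by move/pred0P/(_ y): dAB' => /=; rewrite yA yB.
  have := leq_div (dg e A' v) k; move: h1 h2 le; rewrite /slack -BE; clear; lia.
case: (tau_cutv se ie VE dAB vA vB nAB) => [le|le].
  exact: (main A B).
apply: (main B A); rewrite ?[B :|: A]setUC ?[tau e B + _]addnC //.
by rewrite disjoint_sym.
Qed.

Lemma cutv_slack e V v A : good e V -> conn e V -> #|V| <= N -> v \in V ->
  part e (V :\ v) A -> A != set0 -> A != V :\ v -> slack e V 0.
Proof.
move=> gV cV VN vV pA A0 AV.
have [|d _ h] := cut_slack (k := 1) gV cV VN vV pA A0 AV isT; last first.
  by move: h; rewrite divn1 subnn muln0.
move=> P pP P0; have [PV hP] := partP _ _ _ pP.
rewrite lt0n cards_eq0; apply/negP=> /eqP E; have /connP[_ cV'] := cV.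
have vP : v \notin P by apply/negP=> /(subsetP PV); rewrite !inE eqxx.
have PE : P = V.
  apply: cV' => //; apply/partP; split; first exact: subset_trans PV (subD1set _ _).
  move=> x y xP yV exy; have [yv|yv] := eqVneq y v; last by apply: (hP x); rewrite ?inE ?yv.
  by have := in_set0 x; rewrite -E in_nb xP (gsym gV) -yv exy.
by rewrite PE vV in vP.
Qed.

(** With two edges from [u] to each component, at most half of the [10 d] is spent on components,
    and [d - d / 2 >= 1] leaves a surplus of 10. *)
Lemma del_conn e V u : good e V -> conn e V -> #|V| <= N -> u \in V -> 1 < #|V| ->
  (forall P, part e (V :\ u) P -> P != set0 -> 1 < dg e P u) ->
  conn e (V :\ u) \/ slack e V 10.
Proof.
move=> gV cV VN uV V1 h2; have [|nc] := boolP (conn e (V :\ u)); first by left.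
have V'0 : V :\ u != set0 by rewrite -card_gt0; have := cardsD1 u V; rewrite uV; lia.
have [A [pA A0 AV]] := nconn_part V'0 nc; right.
have [d d2 hs] := cut_slack (k := 2) gV cV VN uV pA A0 AV isT h2.
by move: hs d2; rewrite /slack; have := divn_eq d 2; clear; lia.
Qed.

(** The bridge pays for the second component. If [c] has degree 3, it falls to degree 2, and this
    bonus is the surplus. *)
Lemma bridge_slack e V A c d : good e V -> conn e V -> #|V| <= N -> A \subset V ->
  c \in A -> d \in V :\: A -> e c d ->
  (forall x y, x \in A -> y \in V :\: A -> e x y -> x = c /\ y = d) ->
  slack e V (3 * (dg e V c == 3)).
Proof.
move=> gV /connP[V0 cV] VN AV cA dB ecd br; have se := gsym gV.
have le := tau_bridge se (girr gV) AV br.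
have side (B : {set T}) u : B \subset V -> (forall x y, x \in B -> y \in V :\: B -> e x y -> x = u) ->
   u \in B -> B != V -> 54 * tau e B <= wt e B + 10.
  move=> BV hB uB BnV.
  have ltB : #|B| < N by apply: leq_trans VN; apply: proper_card; rewrite properEneq BnV.
  have E : \sum_(x in B) (x == u : nat) = 1.
    by rewrite (big_setD1 u) //= eqxx big1 // => x; rewrite !inE => /andP[/negPf->].
  have := @parts_bound e B (fun x => x == u) 1 (good_sub BV gV) ltB isT.
  rewrite E => -> // P pP P0; have [PB hP] := partP _ _ _ pP.
  have [uP|uP] := boolP (u \in P); first by rewrite (big_setD1 u) //= eqxx.
  case/negP: BnV; rewrite eqEsubset BV -(cV P) //; apply/partP; split.
    exact: subset_trans PB BV.
  move=> x y xP yV exy; apply: (hP x) => //; apply: contraNT uP => yB.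
  by rewrite -(hB x y) ?(subsetP PB) // inE yB.
have dA : d \notin A by move: dB; rewrite inE => /andP[].
have hA := side A c AV (fun x y xA yB exy => (br x y xA yB exy).1) cA.
have {}hA := hA ltac:(by apply: contraNneq dA => ->; move: dB; rewrite inE => /andP[]).
have hB := side (V :\: A) d (subsetDl _ _).
have VDD : V :\: (V :\: A) = A by rewrite setDDr setDv set0U (setIidPr AV).
rewrite VDD in hB.
have {}hB : 54 * tau e (V :\: A) <= wt e (V :\: A) + 10.
  apply: hB => //; first by move=> x y xB yA exy; have [|_ ->] := br y x yA xB; rewrite // se.
  by apply/eqP=> E; have := subsetP AV c cA; rewrite -E inE cA.
pose Y := if dg e V c == 3 then [set c] else set0.
have YA : Y \subset A by rewrite /Y; case: ifP; rewrite ?sub1set ?sub0set.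
have cB1 : dg e (V :\: A) c = 1.
  rewrite /dg (_ : nb _ _ _ = [set d]) ?cards1 //; apply/setP=> y; rewrite in_nb in_set1.
  by apply/andP/eqP => [[yB ecy]|->//]; have [] := br c y cA yB ecy.
have hY : {in Y, forall y, bonus (dg e V y) (dg e (V :\: A) y)}.
  by move=> y; rewrite /Y; case: ifP => [/eqP E|_]; rewrite inE // => /eqP->; rewrite E cB1.
have := wt_split se AV YA hY.
have -> : #|Y| = (dg e V c == 3) by rewrite /Y; case: ifP; rewrite ?cards1 ?cards0.
rewrite (bigD1 c) //= cB1; move: hA hB le; rewrite /slack; clear; lia.
Qed.

(** The two alternatives of [tau_2cut]. In the first, the two cut edges pay 20, of which the split
    takes 10. In the second, the deletion of [a] and [b] must pay 54, plus 10 for the edge [a b]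
    counted at both ends; the split is paid by the edge [c d]. *)
Lemma twocut_slack e V A a b c d K : good e V -> #|V| <= N -> A \subset V ->
  conn e A -> conn e (V :\: A) -> conn e (A :\ a) -> conn e (V :\: A :\ b) ->
  a \in A -> c \in A -> b \in V :\: A -> d \in V :\: A -> a != c -> b != d ->
  e a b -> e c d ->
  (forall x y, x \in A -> y \in V :\: A -> e x y -> x = a /\ y = b \/ x = c /\ y = d) ->
  K <= 10 -> K + 64 <= wgt (dg e V a) + 5 * dg e V a + wgt (dg e V b) + 5 * dg e V b ->
  slack e V K.
Proof.
move=> gV VN AV cA cB cAa cBb aA cA' bB dB ac bd eab ecd br K10 hK.
have se := gsym gV.
have BV : V :\: A \subset V := subsetDl _ _.
have nA x : x \in V :\: A -> x \notin A by rewrite inE => /andP[].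
have nV x : x \in V :\: A -> x \in V by rewrite inE => /andP[].
have ltA (X : {set T}) : X \subset V -> (exists2 x, x \in V & x \notin X) -> #|X| < N.
  by move=> XV ex; apply: leq_trans VN; apply: proper_card; apply/properP.
have bV := nV b bB; have aV := subsetP AV a aA.
have aBF : a \notin V :\: A by rewrite inE aA.
have h1 := IH (good_sub AV gV) cA (ltA A AV (ex_intro2 _ _ b bV (nA b bB))).
have h2 := IH (good_sub BV gV) cB (ltA _ BV (ex_intro2 _ _ a aV aBF)).
have AaV : A :\ a \subset V := subset_trans (subD1set _ _) AV.
have BbV : V :\: A :\ b \subset V := subset_trans (subD1set _ _) BV.
have h3 := IH (good_sub AaV gV) cAa (ltA _ AaV (ex_intro2 _ _ a aV _)).
have {}h3 := h3 ltac:(by rewrite !inE eqxx).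
have h4 := IH (good_sub BbV gV) cBb (ltA _ BbV (ex_intro2 _ _ b bV _)).
have {}h4 := h4 ltac:(by rewrite !inE eqxx).
have h0 (X Z : {set T}) : {in (set0 : {set T}), forall y, bonus (dg e X y) (dg e Z y)}.
  by move=> y; rewrite inE.
have w1 := wt_split se AV (sub0set _) (h0 _ _).
have crossA : 2 <= \sum_(x in A) dg e (V :\: A) x.
  rewrite (bigD1 a) //= (bigD1 c) /=; last by rewrite cA' eq_sym.
  have ga : 0 < dg e (V :\: A) a by apply/card_gt0P; exists b; rewrite in_nb bB.
  have gc : 0 < dg e (V :\: A) c by apply/card_gt0P; exists d; rewrite in_nb dB.
  by move: ga gc; clear; lia.
have ab : a != b by apply: contraTneq bB => <-.
have sE : 0 = size (Nil T) by [].
have w2 := @wt_removal T e V [:: a; b] [::] se _ isT _ _.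
have {}w2 := w2 ltac:(by rewrite /= inE ab) ltac:(by move=> x; rewrite !inE => /orP[]/eqP->) ltac:(by []).
move: w2; rewrite -/(rem V [:: a; b]) /= /deg_to !big_cons !big_nil eab (se b a) eab !(girr gV) => w2.
have subA' : A :\ a \subset rem V [:: a; b].
  apply/subsetP=> x; rewrite in_rem !inE => /andP[xa xA]; rewrite (negPf xa) (subsetP AV) //= andbT.
  by apply: contraTneq xA => ->; apply: nA.
have w3 := wt_split se subA' (sub0set _) (h0 _ _).
have E : rem V [:: a; b] :\: (A :\ a) = V :\: A :\ b.
  apply/setP=> x; rewrite !inE; have [->|xa] := eqVneq x a; first by rewrite aA /= andbF.
  by rewrite /= andbCA.
rewrite E in w3.
have cross' : 1 <= \sum_(x in A :\ a) dg e (V :\: A :\ b) x.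
  rewrite (bigD1 c) /=; last by rewrite !inE cA' eq_sym ac.
  have gc : 0 < dg e (V :\: A :\ b) c by apply/card_gt0P; exists d; rewrite in_nb !inE eq_sym bd -in_setD dB.
  by move: gc; clear; lia.
rewrite cards0 in w1 w3.
have := tau_2cut se (girr gV) AV aA bB br; move: h1 h2 h3 h4; rewrite /slack.
move: w1 w2 w3 hK K10 crossA cross' => /=; clear; lia.
Qed.

End Induction.
End Reductions.

Section Tools.
Variable T : finType.
Implicit Types (e : rel T) (A B C D S V W R : {set T}) (x y z : T) (s l ys : seq T).
Variable Pl : rel T -> {set T} -> Prop.
Hypothesis Pl_sub : forall e V W, W \subset V -> Pl e V -> Pl e W.
Hypothesis Pl_sup : forall e V x p q, symmetric e -> Pl e V ->
  x \in V -> p \in V -> q \in V -> p != x -> q != x -> e x p -> e x q ->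
  Pl (add_edge e p q) (V :\ x).
Notation good := (good Pl).

Lemma slackW e V K L : L <= K -> slack e V K -> slack e V L.
Proof. rewrite /slack; clear; lia. Qed.

Lemma slack0 e : slack e set0 10.
Proof. by rewrite /slack tau0 muln0 leq_addl. Qed.

Lemma tau_rem e V s ds :
  (forall A, A \subset V -> core e A -> (forall x, x \in ds -> x \notin A) ->
     forall x, x \in s -> x \notin A) -> tau e V <= size ds + tau e (rem V s).
Proof.
move=> hs; have := @tau_red T e V [set x in s] [set x in ds].
have : #|[set x in ds]| <= size ds by rewrite cardsE card_size.
rewrite -/(rem V s); move=> h1 h2.
have {}h2 : tau e V <= #|[set x in ds]| + tau e (rem V s).
  apply: h2 => A AV cA dA; rewrite -setI_eq0 -subset0; apply/subsetP=> x.
  rewrite !inE => /andP[xA xs]; have dA' y : y \in ds -> y \notin A.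
    by move=> yd; apply/negP=> yA; move/pred0P/(_ y): dA => /=; rewrite yA inE yd.
  by rewrite (negPf (hs A AV cA dA' x xs)) in xA.
by move: h1 h2; clear; lia.
Qed.

(** For a remainder that may fall apart: in use, [M] is ten times a bound on the number of its
    components. *)
Lemma removal_bound e V s ds ys i M L : good e V -> uniq s -> {subset s <= V} -> uniq ys ->
  {in ys, forall y, [&& y \in V, y \notin s & bonus (dg e V y) (deg_to e s y)]} ->
  (forall A, A \subset V -> core e A -> (forall x, x \in ds -> x \notin A) ->
     forall x, x \in s -> x \notin A) ->
  54 * tau e (rem V s) <= wt e (rem V s) + M -> \sum_(x <- s) deg_to e s x <= i ->
  L + 54 * size ds + 5 * i + M <=
    10 + \sum_(x <- s) (wgt (dg e V x) + 5 * dg e V x) + 3 * size ys ->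
  slack e V L.
Proof.
move=> gV us sV uy hy hs.
have := wt_removal (gsym gV) us uy sV hy; rewrite /slack.
have := tau_rem hs; rewrite -/(rem V s).
by clear; lia.
Qed.

(** The bookkeeping behind all reductions: [ds] is chosen, the rest of [s] is stripped, [ys] are
    vertices earning a bonus. A deleted vertex of degree 2, 3, 4 contributes 21, 34, 44, a bonus 3,
    and the remaining graph its surplus [K]; a chosen vertex costs 54 and an edge inside [s] costs
    10, as [i] bounds twice their number. *)
Lemma removal_slack e V s ds ys i K L : good e V -> uniq s -> {subset s <= V} -> uniq ys ->
  {in ys, forall y, [&& y \in V, y \notin s & bonus (dg e V y) (deg_to e s y)]} ->
  (forall A, A \subset V -> core e A -> (forall x, x \in ds -> x \notin A) ->
     forall x, x \in s -> x \notin A) ->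
  slack e (rem V s) K -> \sum_(x <- s) deg_to e s x <= i ->
  L + 54 * size ds + 5 * i <=
    K + \sum_(x <- s) (wgt (dg e V x) + 5 * dg e V x) + 3 * size ys ->
  slack e V L.
Proof.
move=> gV us sV uy hy hs; rewrite /slack.
have := wt_removal (gsym gV) us uy sV hy.
have := tau_rem hs; rewrite -/(rem V s).
by clear; lia.
Qed.

Lemma sum_deg_to e l B : symmetric e -> \sum_(x in B) deg_to e l x = \sum_(u <- l) dg e B u.
Proof.
move=> se; rewrite /deg_to exchange_big /=; apply: eq_bigr => u _.
by rewrite dg_sum; apply: eq_bigr => x _; rewrite se.
Qed.

Lemma cover e V x l : uniq l -> all (fun z => (z \in V) && e x z) l ->
  dg e V x <= size l -> forall z, z \in V -> e x z -> z \in l.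
Proof.
move=> ul /allP al sl z zV exz.
have sub : [set y in l] \subset nb e V x.
  by apply/subsetP=> y; rewrite inE in_nb => /al.
have E : [set y in l] = nb e V x.
  by apply/eqP; rewrite eqEcard sub [#|[set y in l]|]cardsE (card_uniqP ul).
have : z \in nb e V x by rewrite in_nb zV.
by rewrite -E inE.
Qed.

Lemma extend e V x l : size l < dg e V x -> exists z, [/\ z \in V, e x z & z \notin l].
Proof.
move=> sl; have [/subsetP sub|] := boolP (nb e V x \subset [set y in l]).
  move: sl; rewrite ltnNge; case/negP; apply: leq_trans (card_size l).
  by apply: subset_leq_card; apply/subsetP=> z /sub; rewrite inE.
by case/subsetPn=> z; rewrite in_nb inE => /andP[zV exz] zl; exists z.
Qed.

Lemma dg_ge e V x l : uniq l -> all (fun z => (z \in V) && e x z) l -> size l <= dg e V x.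
Proof.
move=> ul /allP al; rewrite -(card_uniqP ul); apply: subset_leq_card.
by apply/subsetP=> y; rewrite in_nb => /al.
Qed.

Lemma dg_rem e V s x : uniq s -> {subset s <= V} -> dg e (rem V s) x + deg_to e s x = dg e V x.
Proof.
move=> us sV; have WV : [set y in s] \subset V by apply/subsetP=> y; rewrite inE => /sV.
by rewrite (dgD e x WV) dg_set.
Qed.

Variable N : nat.
Hypothesis IH : forall e V, good e V -> conn e V -> #|V| < N -> slack e V 0.

Lemma suppress_slack e V x p q : good e V -> conn e V -> #|V| <= N -> x \in V -> p \in V -> q \in V ->
  p != q -> e x p -> e x q -> (forall z, z \in V -> e x z -> z = p \/ z = q) ->
  (forall z, z \in V -> z != x -> e p z -> e q z -> False) -> slack e V 11.
Proof.
move=> gV cV VN xV pV qV pq exp exq nbx cpq.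
have [g' c' E le] := suppress_spec Pl_sup gV cV xV pV qV pq exp exq nbx cpq.
have lt : #|V :\ x| < N by apply: leq_trans VN; rewrite [X in _ < X](cardsD1 x) xV.
by have := IH g' c' lt; move: E le; rewrite /slack; clear; lia.
Qed.

Lemma suppress_slackD e V x p q K : good e V -> conn e V -> x \in V -> p \in V -> q \in V ->
  p != q -> e x p -> e x q -> (forall z, z \in V -> e x z -> z = p \/ z = q) ->
  (forall z, z \in V -> z != x -> e p z -> e q z -> False) ->
  slack (add_edge e p q) (V :\ x) K -> slack e V (K + 11).
Proof.
move=> gV cV xV pV qV pq exp exq nbx cpq.
have [g' c' E le] := suppress_spec Pl_sup gV cV xV pV qV pq exp exq nbx cpq.
by move: E le; rewrite /slack; clear; lia.
Qed.

(** Once [x] is suppressed, [p] has the neighbours [p1] and [q] and can be suppressed as well, for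
    11 each. The last two hypotheses exclude the triangles that the first and the second step could
    create. *)
Lemma suppress_path_slack e V x p q p1 : good e V -> conn e V -> #|V| <= N ->
  x \in V -> p \in V -> q \in V -> p1 \in V ->
  p != q -> p1 != q -> p1 != x -> e x p -> e x q -> e p p1 ->
  (forall z, z \in V -> e x z -> z = p \/ z = q) ->
  (forall z, z \in V -> e p z -> z = x \/ z = p1) ->
  ~~ e q p1 ->
  (forall z, z \in V -> z != x -> z != p -> e p1 z -> e q z -> False) -> slack e V 22.
Proof.
move=> gV cV VN xV pV qV p1V pq p1q p1x exp exq epp1 nbx nbp nqp1 cpq.
have se := gsym gV; have ie := girr gV.
have exx a b : e a b -> b != a by move=> h; apply: contraTneq h => ->; rewrite ie.
have [px qx p1p] := And3 (exx _ _ exp) (exx _ _ exq) (exx _ _ epp1).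
have cpq0 z : z \in V -> z != x -> e p z -> e q z -> False.
  by move=> zV zx epz eqz; case: (nbp z zV epz) => E; subst z; rewrite ?eqxx // in zx; rewrite eqz in nqp1.
have [g' c' E le] := suppress_spec Pl_sup gV cV xV pV qV pq exp exq nbx cpq0.
have lt : #|V :\ x| <= N by apply: leq_trans VN; rewrite [X in _ <= X](cardsD1 x) xV ltnW.
have h : slack (add_edge e p q) (V :\ x) 11.
  apply: (@suppress_slack _ _ p p1 q) => //; rewrite ?inE ?px ?qx ?p1x // /add_edge ?epp1 ?eqxx ?orbT //.
    move=> z; rewrite !inE => /andP[zx zV]; rewrite ?eqxx (negPf pq) /= ?orbT ?orbF.
    case/orP=> [epz|/eqP->]; last by right.
    by case: (nbp z zV epz) => [E0|->]; [rewrite E0 eqxx in zx | left].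
  move=> z; rewrite !inE => /andP[zx zV] zp; rewrite (negPf p1p) (negPf p1q) ?eqxx /= ?orbF.
  rewrite (negPf zp) [_ == p]eq_sym (negPf pq) /= orbF => h1 h2.
  exact: cpq z zV zx zp h1 h2.
by move: h E le; rewrite /slack; clear; lia.
Qed.

(** Suppressing [u1] creates the edge from [a] to [b1]; an edge from [b1] to [b2] would then make
    [b1] a common neighbour of [a] and [b2] and block the suppression of [u2]. *)
Lemma suppress_two_slack e V a u1 b1 u2 b2 : good e V -> conn e V -> #|V| <= N ->
  a \in V -> u1 \in V -> b1 \in V -> u2 \in V -> b2 \in V ->
  a != b1 -> a != b2 -> b1 != b2 -> u1 != u2 -> u2 != b1 ->
  e u1 a -> e u1 b1 -> e u2 a -> e u2 b2 -> b2 != u1 ->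
  (forall z, z \in V -> e u1 z -> z = a \/ z = b1) ->
  (forall z, z \in V -> e u2 z -> z = a \/ z = b2) ->
  (forall z, z \in V -> z != u1 -> e a z -> e b1 z -> False) ->
  (forall z, z \in V -> z != u2 -> e a z -> e b2 z -> False) ->
  ~~ e b1 b2 -> slack e V 22.
Proof.
move=> gV cV VN aV u1V b1V u2V b2V ab1 ab2 b12 u12 u2b1 e1a e1b e2a e2b b2u1 nb1 nb2 c1 c2 nb12.
have se := gsym gV; have ie := girr gV.
have exx a' b : e a' b -> b != a' by move=> h; apply: contraTneq h => ->; rewrite ie.
have au1 := exx _ _ e1a; have b1u1 := exx _ _ e1b; have au2 := exx _ _ e2a; have b2u2 := exx _ _ e2b.
have [g' c' E le] := suppress_spec Pl_sup gV cV u1V aV b1V ab1 e1a e1b nb1 c1.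
have lt : #|V :\ u1| <= N by apply: leq_trans VN; rewrite [X in _ <= X](cardsD1 u1) u1V ltnW.
have h : slack (add_edge e a b1) (V :\ u1) 11.
  apply: (@suppress_slack _ _ u2 a b2) => //; rewrite ?inE ?au1 ?b2u1 ?(eq_sym u2) ?u12 // /add_edge ?e2a ?e2b //.
    move=> z; rewrite !inE => /andP[zx zV]; rewrite [u2 == a]eq_sym (negPf au2) (negPf u2b1) /= orbF.
    exact: nb2.
  move=> z; rewrite !inE => /andP[zx zV] zu; rewrite ?eqxx (negPf ab1) [b2 == a]eq_sym (negPf ab2).
  rewrite [b2 == b1]eq_sym (negPf b12) /= !orbF => /orP[eaz|/eqP->] h2; first exact: c2 z zV zu eaz h2.
  by rewrite se h2 in nb12.
by move: h E le; rewrite /slack; clear; lia.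
Qed.

End Tools.

(** * A minimal counterexample does not exist *)

Section Counterexample.
Variable T : finType.
Implicit Types (A B C D S W R : {set T}) (x y z : T) (s l ys : seq T).
Variable Pl : rel T -> {set T} -> Prop.
Hypothesis Pl_sub : forall (e : rel T) (V W : {set T}), W \subset V -> Pl e V -> Pl e W.
Hypothesis Pl_sup : forall (e : rel T) (V : {set T}) x p q, symmetric e -> Pl e V ->
  x \in V -> p \in V -> q \in V -> p != x -> q != x -> e x p -> e x q ->
  Pl (add_edge e p q) (V :\ x).
Notation good := (good Pl).
Variable N : nat.
Hypothesis IH : forall (e : rel T) (V : {set T}), good e V -> conn e V -> #|V| < N -> slack e V 0.
Variables (e : rel T) (V : {set T}).
Hypotheses (gV : good e V) (cV : conn e V) (VN : #|V| <= N) (ns : ~ slack e V 0).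
Let se : symmetric e := gsym gV.
Let ie : irreflexive e := girr gV.

Lemma triangle_freeF a c b : a \in V -> c \in V -> b \in V -> e a c -> e c b -> e a b = false.
Proof. by move=> aV cV' bV ac cb; apply/negP=> ab; apply: (gtf gV aV cV' bV ac cb); rewrite se. Qed.

Lemma bonus_deg3 s y w : dg e V y = 3 -> w \in s -> e y w -> bonus (dg e V y) (deg_to e s y).
Proof.
by move=> -> ws eyw; rewrite /bonus /deg_to (big_rem w) //= eyw.
Qed.

Lemma bonus_deg4 s y w1 w2 : dg e V y = 4 -> w1 \in s -> w2 \in s -> w1 != w2 -> e y w1 -> e y w2 ->
  bonus (dg e V y) (deg_to e s y).
Proof.
move=> -> ws1 ws2 w12 e1 e2; rewrite /bonus /deg_to (big_rem w1) //= e1 (big_rem w2) ?e2 //=.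
by have := perm_to_rem ws1 => /perm_mem/(_ w2); rewrite ws2 inE eq_sym (negPf w12) /= => <-.
Qed.

(* [sat] records that vertices at distance two are not adjacent. *)
Ltac neq := match goal with
  | H : is_true (?a != ?b) |- is_true (?a != ?b) => exact H
  | H : is_true (?b != ?a) |- is_true (?a != ?b) => rewrite eq_sym; exact H
  | H : is_true (e ?a ?b) |- is_true (?a != ?b) =>
      apply: contraTneq H => ->; rewrite ie; done
  | H : is_true (e ?b ?a) |- is_true (?a != ?b) =>
      apply: contraTneq H => ->; rewrite ie; done
  | H1 : is_true (e ?a ?c), H2 : e ?b ?c = false |- is_true (?a != ?b) =>
      apply: contraTneq H1 => ->; rewrite H2; done
  | H1 : is_true (e ?b ?c), H2 : e ?a ?c = false |- is_true (?a != ?b) =>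
      apply: contraTneq H1 => <-; rewrite H2; done
  | H1 : dg e V ?a = ?m, H2 : dg e V ?b = ?n |- is_true (?a != ?b) =>
      apply/eqP; let E := fresh in move=> E; rewrite E H2 in H1; discriminate H1
  end.
Ltac symm := repeat match goal with
  | H : is_true (e ?a ?b) |- _ =>
     lazymatch goal with _ : is_true (e b a) |- _ => fail | _ => idtac end;
     assert (is_true (e b a)) by (rewrite se; exact H)
  | H : e ?a ?b = false |- _ =>
     lazymatch goal with _ : e b a = false |- _ => fail | _ => idtac end;
     assert (e b a = false) by (rewrite se; exact H)
  end.
Ltac sat := symm; repeat match goal with
  | H1 : is_true (e ?a ?c), H2 : is_true (e ?c ?b) |- _ =>
     lazymatch a with b => fail | _ => idtac end;
     lazymatch goal with _ : e a b = false |- _ => fail | _ => idtac end;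
     assert (e a b = false) by (apply: (triangle_freeF _ _ _ H1 H2); assumption)
  end.
Ltac spl := repeat (first [apply/andP; split | done | neq | assumption]).
Ltac suniq := rewrite /= ?inE ?negb_or /=; spl.
Ltac smem := apply/allP; rewrite /=; spl.
Ltac facts := repeat match goal with
  | H : is_true (e ?a ?b) |- context [e ?a ?b] => rewrite H
  | H : e ?a ?b = false |- context [e ?a ?b] => rewrite H
  end.
Ltac inner := rewrite /deg_to ?big_cons ?big_nil ?ie; facts; done.
Ltac arith := rewrite ?big_cons ?big_nil; repeat match goal with
  | H : dg e V ?a = _ |- context [dg e V ?a] => rewrite H end; done.
Ltac sys := apply/allP; rewrite /= ?inE ?negb_or; spl.
Ltac inseq := rewrite ?inE ?eqxx ?orbT; done.

(** * Degrees between two and four, and no cut vertices *)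

Lemma two_le_card : 1 < #|V|.
Proof.
rewrite ltnNge; apply/negP=> V1; apply: ns.
have [x xV] : exists x, x \in V by apply/set0Pn; have /connP[] := cV.
have VE : V = [set x] by apply/esym/eqP; rewrite eqEcard sub1set xV cards1.
have nbx : nb e V x = set0.
  by apply/setP=> y; rewrite in_nb VE !inE; case: eqP => [->|//]; rewrite ie.
apply: (slackW (leq0n 10)); rewrite /slack.
have -> : tau e V = 0; last by rewrite muln0 leq_addl.
apply/eqP; rewrite -leqn0 -(cards0 T); apply/tau_le/fvsP=> A AV /coreP[A0 hA].
have AE : A = V.
  by apply/eqP; rewrite eqEsubset AV VE sub1set; case/set0Pn: A0 => y yA; have := subsetP AV y yA; rewrite VE inE => /eqP <-.
by have := hA x; rewrite AE xV /dg nbx cards0 => /(_ isT).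
Qed.

Lemma conn_rem_slack s x : x \in s -> x \in V -> conn e (rem V s) -> slack e (rem V s) 0.
Proof.
move=> xs xV c; apply: IH => //; first exact: good_rem.
exact: leq_trans (card_rem xs xV) VN.
Qed.

Lemma card_rem_le s x : x \in s -> x \in V -> #|rem V s| <= N.
Proof. by move=> xs xV; apply/ltnW/(leq_trans (card_rem xs xV) VN). Qed.

(** A vertex of degree at most one lies on no cycle and is stripped without choosing any vertex. *)
Lemma deg_ge2 x : x \in V -> 1 < dg e V x.
Proof.
move=> xV; rewrite ltnNge; apply/negP=> d1; apply: ns.
have [z hz] : exists z, forall y, y \in V -> e x y -> y = z.
  have [/existsP[z]|] := boolP [exists z, z \in nb e V x].
    move=> zx; exists z => y yV exy.
    have : #|[set y; z]| <= 1.
      apply: leq_trans d1; apply: subset_leq_card; apply/subsetP=> u; rewrite !inE.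
      by case/orP=> /eqP->; rewrite ?yV ?exy //; move: zx; rewrite inE.
    by rewrite cards2; case: eqP.
  rewrite negb_exists => /forallP h; exists x => y yV exy.
  by have := h y; rewrite in_nb yV exy.
have cR := conn_strip se cV xV two_le_card hz; rewrite -rem1 in cR.
apply: (removal_slack (s := [:: x]) (ds := [::]) (ys := [::]) (i := 0) (K := 0) gV) => //.
- by move=> y; rewrite inE => /eqP->.
- move=> A AV cA _ y; rewrite inE => /eqP->; apply: (leaf_notin (y := z) cA AV).
  by move=> u uV exu _; apply: hz.
- by apply: (conn_rem_slack _ xV cR); rewrite inE.
- by inner.
Qed.

Lemma rem1_n0 v : v \in V -> V :\ v != set0.
Proof. by move=> vV; rewrite -card_gt0; have := cardsD1 v V; rewrite vV; have := two_le_card; clear; lia. Qed.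

Lemma conn1 v : v \in V -> conn e (rem V [:: v]).
Proof.
move=> vV; apply: contraT => nc; exfalso; apply: ns.
rewrite rem1 in nc; have [A [pA A0 AV]] := nconn_part (rem1_n0 vV) nc.
exact: (cutv_slack Pl_sub IH gV cV VN vV pA).
Qed.

(** Degree five is the break-even point: [4 + 10 d] reaches 54 exactly there, and the rest stays
    connected as there is no cut vertex. *)
Lemma deg_le4 x : x \in V -> dg e V x <= 4.
Proof.
move=> xV; rewrite leqNgt; apply/negP=> d5; apply: ns.
apply: (removal_slack (s := [:: x]) (ds := [:: x]) (ys := [::]) (i := 0) (K := 0) gV) => //.
- by move=> y; rewrite inE => /eqP->.
- by apply: (conn_rem_slack _ xV (conn1 xV)); rewrite inE.
- by inner.
- rewrite big_cons big_nil wgt_lin; last by move: d5; clear; lia.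
  by move: d5; clear => /= *; lia.
Qed.

Lemma deg_cases x : x \in V -> [\/ dg e V x = 2, dg e V x = 3 | dg e V x = 4].
Proof.
move=> xV; have := deg_ge2 xV; have := deg_le4 xV.
case: (dg e V x) => [|[|[|[|[|d]]]]] // _ _; by [constructor 1|constructor 2|constructor 3].
Qed.

Lemma cov3 x a b c : dg e V x = 3 -> a \in V -> b \in V -> c \in V ->
  e x a -> e x b -> e x c -> a != b -> a != c -> b != c ->
  forall z, z \in V -> e x z -> [\/ z = a, z = b | z = c].
Proof.
move=> d aV bV cV' ea eb ec ab ac bc z zV ez.
have := @cover T e V x [:: a; b; c] _ _ _ z zV ez; rewrite d /= !inE !negb_or ab ac bc aV bV cV' ea eb ec.
by move=> /(_ isT isT isT)/or3P[]/eqP; [constructor 1|constructor 2|constructor 3].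
Qed.

Lemma cov4 x a b c d : dg e V x = 4 -> a \in V -> b \in V -> c \in V -> d \in V ->
  e x a -> e x b -> e x c -> e x d -> a != b -> a != c -> a != d -> b != c -> b != d -> c != d ->
  forall z, z \in V -> e x z -> [\/ z = a, z = b, z = c | z = d].
Proof.
move=> dx aV bV cV' dV ea eb ec ed ab ac ad bc bd cd z zV ez.
have := @cover T e V x [:: a; b; c; d] _ _ _ z zV ez.
rewrite dx /= !inE !negb_or ab ac ad bc bd cd aV bV cV' dV ea eb ec ed.
by move=> /(_ isT isT isT)/or4P[]/eqP; [constructor 1|constructor 2|constructor 3|constructor 4].
Qed.

Lemma nb2 x : dg e V x = 2 -> exists a b, [/\ a \in V, b \in V, e x a, e x b & a != b] /\
  forall z, z \in V -> e x z -> z = a \/ z = b.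
Proof.
move=> d; have [a [aV ea _]] : exists z, [/\ z \in V, e x z & z \notin [::]].
  by apply: extend; rewrite d.
have [b [bV eb]] : exists z, [/\ z \in V, e x z & z \notin [:: a]].
  by apply: extend; rewrite d.
rewrite inE eq_sym => ab; exists a, b; split=> // z zV ez.
have := @cover T e V x [:: a; b] _ _ _ z zV ez; rewrite d /= !inE ab aV bV ea eb.
by move=> /(_ isT isT isT)/orP[]/eqP; [left|right].
Qed.

Lemma nb3 x a b : dg e V x = 3 -> a \in V -> b \in V -> e x a -> e x b -> a != b ->
  exists c, [/\ c \in V, e x c, a != c & b != c] /\
    forall z, z \in V -> e x z -> [\/ z = a, z = b | z = c].
Proof.
move=> d aV bV ea eb ab; have [c [cV' ec]] : exists z, [/\ z \in V, e x z & z \notin [:: a; b]].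
  by apply: extend; rewrite d.
rewrite !inE negb_or ![c == _]eq_sym => /andP[ac bc]; exists c; split=> //.
exact: cov3.
Qed.

Lemma nb3a x a : dg e V x = 3 -> a \in V -> e x a ->
  exists b c, [/\ b \in V, c \in V, e x b & e x c] /\ [/\ a != b, a != c & b != c] /\
    forall z, z \in V -> e x z -> [\/ z = a, z = b | z = c].
Proof.
move=> d aV ea; have [b [bV eb]] : exists z, [/\ z \in V, e x z & z \notin [:: a]].
  by apply: extend; rewrite d.
rewrite inE eq_sym => ab; have [c [[cV' ec ac bc] h]] := nb3 d aV bV ea eb ab.
by exists b, c.
Qed.

Lemma nb4 x a b c : dg e V x = 4 -> a \in V -> b \in V -> c \in V ->
  e x a -> e x b -> e x c -> a != b -> a != c -> b != c ->
  exists d, [/\ d \in V, e x d & [/\ a != d, b != d & c != d]] /\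
    forall z, z \in V -> e x z -> [\/ z = a, z = b, z = c | z = d].
Proof.
move=> dx aV bV cV' ea eb ec ab ac bc.
have [d [dV ed]] : exists z, [/\ z \in V, e x z & z \notin [:: a; b; c]].
  by apply: extend; rewrite dx.
rewrite !inE !negb_or ![d == _]eq_sym => /and3P[ad bd cd]; exists d; split=> //.
exact: cov4.
Qed.

Lemma conn_rem_strip s x z u : conn e (rem V s) -> x \in rem V s -> u \in rem V s -> u != x ->
  (forall y, y \in rem V s -> e x y -> y = z) -> conn e (rem V (rcons s x)).
Proof.
move=> c xR uR ux h; rewrite -cats1 -rem_cat rem1; apply: (conn_strip se c xR _ h).
rewrite (cardsD1 x) xR add1n ltnS card_gt0; apply/set0Pn; exists u.
by rewrite !inE ux; rewrite in_rem in uR; case/andP: uR => -> ->.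
Qed.

(* The only obstruction to suppressing a vertex of degree 2 is a 4-cycle. *)
Lemma suppress_blocked x p q : x \in V -> p \in V -> q \in V -> p != q -> e x p -> e x q ->
  (forall z, z \in V -> e x z -> z = p \/ z = q) ->
  exists z, [/\ z \in V, z != x, e p z & e q z].
Proof.
move=> xV pV qV pq exp exq nbx.
have [/existsP[z /and4P[]]|] := boolP [exists z, [&& z \in V, z != x, e p z & e q z]].
  by move=> *; exists z.
rewrite negb_exists => /forallP h; case: ns; apply: (slackW (leq0n 11)).
apply: (suppress_slack Pl_sup IH gV cV VN xV pV qV pq exp exq nbx) => z zV zx epz eqz.
by have := h z; rewrite zV zx epz eqz.
Qed.

(** * Exclusion of vertices of degree two *)

Lemma deg2_not_deg4 w x : w \in V -> dg e V w = 2 -> x \in V -> e w x -> dg e V x = 4 -> False.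
Proof.
move=> wV dw xV ewx dx; apply: ns; have [a [b [[aV bV ea eb ab] nw]]] := nb2 dw.
have [y [yV ewy xy nw']] : exists y, [/\ y \in V, e w y, x != y &
    forall z, z \in V -> e w z -> z = x \/ z = y].
  case: (nw x xV ewx) => E; subst x; first by exists b.
  by exists a; split=> //; [rewrite eq_sym | move=> z zV ez; case: (nw z zV ez); [right|left]].
sat.
have c1 : conn e (rem V [:: x; w]).
  apply: (@conn_rem_strip [:: x] w y y) => //; rewrite ?in_rem ?inE; first exact: conn1.
  - by spl.
  - by spl.
  - by neq.
  - by move=> z; rewrite in_rem inE => /andP[/eqP zx zV] /(nw' z zV)[].
(* Choosing [x] and stripping [w] frees [44 + 21 - 10 = 55]. *)
apply: (removal_slack (s := [:: x; w]) (ds := [:: x]) (ys := [::]) (i := 2) (K := 0) gV) => //.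
- by suniq.
- by smem.
- move=> A AV cA hd z; rewrite !inE => /orP[]/eqP->; first by apply: hd; inseq.
  apply: (leaf_notin (y := y) cA AV) => u uV ewu uA; case: (nw' u uV ewu) => // E.
  by move: (hd x); rewrite E in uA; rewrite uA inE eqxx => /(_ isT).
- by apply: (@conn_rem_slack _ x) => //; inseq.
- by inner.
- by arith.
Qed.

(** This recognises the few small graphs that are settled outright: connectivity of [rem V s] leaves
    no room beyond a closed list [l]. *)
Lemma conn_all s (l : seq T) a : conn e (rem V s) -> a \in l -> {subset l <= rem V s} ->
  (forall x y, x \in l -> y \in V -> e x y -> y \in s ++ l) -> {subset s <= V} ->
  V = [set y in s ++ l].
Proof.
move=> /connP[_ c] al lR hl sV.
have E : [set y in l] = rem V s.
  apply: c; last by apply/set0Pn; exists a; rewrite inE.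
  apply/partP; split; first by apply/subsetP=> y; rewrite inE => /lR.
  move=> x y; rewrite in_rem !inE => xl /andP[ys yV] exy.
  by have := hl x y xl yV exy; rewrite mem_cat (negPf ys).
apply/setP=> y; rewrite inE mem_cat; have := in_rem V s y; rewrite -E inE => ->.
by case: (boolP (y \in s)) => // /sV.
Qed.

(** Otherwise [P] without [v] would be closed in [V] minus [v], which is connected and contains [u].
    The vertex [v] may lie in [P] itself, whence the separate case where [P] is only [{v}]. *)
Lemma part_two s (P : {set T}) u v : part e (rem V s) P -> P != set0 -> {subset s <= V} ->
  u \in s -> v \in V -> u != v -> exists w y, [/\ w \in s, w != v, y \in P & e y w].
Proof.
move=> pP P0 sV us vV uv; have [PR hP] := partP _ _ _ pP.
have [/existsP[w /existsP[y /and4P[? ? ? ?]]]|nh] := boolP [exists w, exists y, [&& w \in s, w != v, y \in P & e y w]].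
  by exists w, y.
have hh w y : w \in s -> w != v -> y \in P -> e y w -> False.
  move=> h1 h2 h3 h4; case/negP: nh; apply/existsP; exists w; apply/existsP; exists y.
  by rewrite h1 h2 h3 h4.
pose P' := P :\ v.
have [P0'|P0'] := eqVneq P' set0.
  have /connP[_ c] := cV.
  have PE : P = [set v].
    apply/eqP; rewrite eqEsubset -setD_eq0 -/(P') P0' eqxx sub1set.
    case/set0Pn: P0 => y yP; have : y \notin P' by rewrite P0' inE.
    by rewrite !inE yP andbT negbK => /eqP <-.
  have dv : dg e V v = 0.
    apply/eqP; rewrite cards_eq0; apply/eqP/setP=> y; rewrite in_nb in_set0; apply/andP=> -[yV evy].
    have yv : y != v by apply: contraTneq evy => ->; rewrite ie.
    have vP : v \in P by rewrite PE inE.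
    have [ys|ys] := boolP (y \in s); first exact: (hh y v).
    have : y \in P by apply: (hP v); rewrite ?in_rem ?ys.
    by rewrite PE inE (negPf yv).
  by have := deg_ge2 vV; rewrite dv.
have /connP[_ c] := conn1 vV; exfalso.
have E : P' = rem V [:: v].
  apply: c => //; apply/partP; split.
    apply/subsetP=> y; rewrite in_rem !inE => /andP[-> yP] /=.
    by have := subsetP PR y yP; rewrite in_rem => /andP[].
  move=> x y; rewrite in_rem !inE => /andP[xv xP] /andP[yv yV] exy; rewrite yv /=.
  have [ys|ys] := boolP (y \in s); first by case: (hh y x).
  by apply: (hP x); rewrite ?in_rem ?ys.
have : u \in P' by rewrite E in_rem inE uv sV.
rewrite !inE => /andP[_ uP].
by have := subsetP PR u uP; rewrite in_rem us.
Qed.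

(** The blocked suppression of [w] closes a 4-cycle [w x z y]. If [y] has degree two as well, this
    cycle is the whole graph and [54 = 4 * 11 + 10] is met exactly; if [y] has degree 3, choosing it
    and stripping [w] and [x] frees [34 + 21 + 21 - 20 = 56]. *)
Lemma deg2_not_deg2 w x : w \in V -> dg e V w = 2 -> x \in V -> e w x -> dg e V x = 2 -> False.
Proof.
move=> wV dw xV ewx dx.
have [y [[yV ewy _ xy] cw]] : exists y, [/\ y \in V, e w y, true & x != y] /\
    forall z, z \in V -> e w z -> z = x \/ z = y.
  have [a [b [[aV bV ea eb ab] nw]]] := nb2 dw.
  case: (nw x xV ewx) => E; subst x; first by exists b.
  by exists a; split; [rewrite eq_sym | move=> z zV ez; case: (nw z zV ez); [right|left]].
have exw : e x w by rewrite se.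
have [z [[zV exz _ wz] cx]] : exists z, [/\ z \in V, e x z, true & w != z] /\
    forall u, u \in V -> e x u -> u = w \/ u = z.
  have [a [b [[aV bV ea eb ab] nw]]] := nb2 dx.
  case: (nw w wV exw) => E; subst w; first by exists b.
  by exists a; split; [rewrite eq_sym | move=> u uV eu; case: (nw u uV eu); [right|left]].
have [t [tV tw ext eyt]] := suppress_blocked wV xV yV xy ewx ewy cw.
have E : t = z by case: (cx t tV ext) => // E; rewrite E eqxx in tw.
subst t; sat.
have c1 := conn1 zV.
case: (deg_cases yV) => dy; [| |exact: (deg2_not_deg4 wV dw yV ewy dy)].
  have cy : forall u, u \in V -> e y u -> u \in [:: w; z].
    by apply: cover; rewrite ?dy //; [suniq | rewrite /=; spl].
  have sV : {subset [:: z] <= V} by smem.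
  have VE : V = [set u in [:: z] ++ [:: w; x; y]].
    apply: (conn_all (a := w) c1) => //; rewrite ?inE ?eqxx //.
      by move=> u; rewrite in_rem !inE => /or3P[]/eqP->; spl.
    move=> u v; rewrite !inE => /or3P[]/eqP-> vV h.
    - by case: (cw v vV h) => ->; rewrite eqxx ?orbT.
    - by case: (cx v vV h) => ->; rewrite eqxx ?orbT.
    - by have := cy v vV h; rewrite !inE => /orP[]/eqP->; rewrite eqxx ?orbT.
  have dz : dg e V z = 2.
    by rewrite VE dg_set /deg_to ?big_cons ?big_nil /= ?ie; [facts | suniq].
  apply: ns; apply: (removal_slack (s := [:: z; w; x; y]) (ds := [:: w]) (ys := [::]) (i := 8) (K := 10) gV) => //.
  - by suniq.
  - by smem.
  - move=> A AV cA hA.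
    have wA : w \notin A by apply: hA; inseq.
    have xA : x \notin A.
      apply: (leaf_notin (y := z) cA AV) => u uV eu uA; case: (cx u uV eu) => // E.
      by rewrite -E uA in wA.
    have yA : y \notin A.
      apply: (leaf_notin (y := z) cA AV) => u uV eu uA.
      have := cy u uV eu; rewrite !inE => /orP[]/eqP// E.
      by rewrite -E uA in wA.
    have zA : z \notin A.
      apply: (leaf_notin (y := w) cA AV) => u uV eu uA; move: uV; rewrite VE !inE.
      by case/or4P=> /eqP E; rewrite E ?ie ?(negPf xA) ?(negPf yA) ?(negPf wA) // in eu uA.
    by move=> u; rewrite !inE => /or4P[]/eqP->.
  - have -> : rem V [:: z; w; x; y] = set0; last exact: slack0.
    by apply/setP=> u; rewrite in_rem VE /= !inE andNb.
  - by inner.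
  - by arith.
have c2 : conn e (rem V [:: y; w; x]).
  have c3 : conn e (rem V [:: y; w]).
    apply: (@conn_rem_strip [:: y] w x x) => //; rewrite ?in_rem ?inE; first exact: conn1.
    - by spl.
    - by spl.
    - by neq.
    - by move=> u; rewrite in_rem inE => /andP[/eqP uy uV] /(cw u uV)[].
  apply: (@conn_rem_strip [:: y; w] x z z) => //; rewrite ?in_rem ?inE ?negb_or.
  - by spl.
  - by spl.
  - by neq.
  - by move=> u; rewrite in_rem !inE negb_or => /andP[/andP[/eqP uy /eqP uw] uV] /(cx u uV)[].
apply: ns; apply: (removal_slack (s := [:: y; w; x]) (ds := [:: y]) (ys := [::]) (i := 4) (K := 0) gV) => //.
- by suniq.
- by smem.
- move=> A AV cA hA; have yA : y \notin A by apply: hA; inseq.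
  have wA : w \notin A.
    apply: (leaf_notin (y := x) cA AV) => u uV eu uA; case: (cw u uV eu) => // E.
    by rewrite -E uA in yA.
  have xA : x \notin A.
    apply: (leaf_notin (y := z) cA AV) => u uV eu uA; case: (cx u uV eu) => // E.
    by rewrite -E uA in wA.
  by move=> u; rewrite !inE => /or3P[]/eqP->.
- by apply: (@conn_rem_slack _ y) => //; inseq.
- by inner.
- by arith.
Qed.

Lemma deg2_deg3 w x : w \in V -> dg e V w = 2 -> x \in V -> e w x -> dg e V x = 3.
Proof.
move=> wV dw xV ewx; case: (deg_cases xV) => // dx.
  by case: (deg2_not_deg2 wV dw xV ewx dx).
by case: (deg2_not_deg4 wV dw xV ewx dx).
Qed.

(** Choosing [x] and stripping [w] frees 45, and [y] drops to degree two with neighbours [z] and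
    [y'], a bonus of 3. Suppressing [y] would bring 11 more and exceed 54, so a 4-cycle must block
    it. *)
Lemma deg2_block w x y z y' : w \in V -> x \in V -> y \in V -> z \in V -> y' \in V ->
  dg e V w = 2 -> x != y -> z != y' -> e w x -> e w y -> e x z -> e y z -> e y y' -> y' != w -> z != w ->
  exists t, [/\ t \in V, e z t, e y' t & t \notin [:: x; w; y]].
Proof.
move=> wV xV yV zV y'V dw xy zy' ewx ewy exz eyz eyy' y'w zw.
have dx := deg2_deg3 wV dw xV ewx; have dy := deg2_deg3 wV dw yV ewy.
have cw : forall u, u \in V -> e w u -> u \in [:: x; y].
  by apply: cover; rewrite ?dw //; [suniq | rewrite /=; spl].
symm; have cy := cov3 dy wV zV y'V ltac:(done) ltac:(done) ltac:(done) ltac:(neq) ltac:(neq) ltac:(done).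
have [/existsP[t /and4P[? ? ? ?]]|nt] := boolP [exists t, [&& t \in V, e z t, e y' t & t \notin [:: x; w; y]]].
  by exists t.
exfalso; apply: ns; sat.
have xy' : y' != x by neq.
have cR : conn e (rem V [:: x; w]).
  apply: (@conn_rem_strip [:: x] w y y) => //; rewrite ?in_rem ?inE; first exact: conn1.
  - by spl.
  - by spl.
  - by neq.
  - by move=> u; rewrite in_rem !inE => /andP[ux uV] /(cw u uV); rewrite !inE (negPf ux) /= => /eqP.
apply: (removal_slack (s := [:: x; w]) (ds := [:: x]) (ys := [:: y]) (i := 2) (K := 11) gV) => //.
- by suniq.
- by smem.
- move=> u; rewrite inE => /eqP->; rewrite yV !inE negb_or; spl.
  by apply: (@bonus_deg3 _ _ w) => //; inseq.
- move=> A AV cA hA; have xA : x \notin A by apply: hA; inseq.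
  have wA : w \notin A.
    apply: (leaf_notin (y := y) cA AV) => u uV eu uA; have := cw u uV eu; rewrite !inE => /orP[]/eqP// E.
    by rewrite -E uA in xA.
  by move=> u; rewrite !inE => /orP[]/eqP->.
- apply: (@suppress_slack _ _ Pl_sup _ IH _ _ y z y') => //; rewrite ?in_rem ?inE ?negb_or.
  + exact: good_rem.
  + by apply: (@card_rem_le _ x) => //; inseq.
  + by spl.
  + by spl.
  + by spl.
  + move=> u; rewrite in_rem !inE negb_or => /andP[/andP[ux uw] uV] /(cy u uV)[E|E|E]; auto.
    by rewrite E eqxx in uw.
  + move=> u; rewrite in_rem inE => /andP[us uV] uy zu yu; case/negP: nt; apply/existsP; exists u.
    by rewrite uV zu yu /= !inE in us uy *; rewrite orbA negb_or us uy.
- by inner.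
- by arith.
Qed.

(** Here [x] and [y] have the same three neighbours [w], [z], [p]. If [p] has degree 3, so does [z],
    and the graph is [K_{3,3}] minus an edge, where the bound is an equality. If [p] has degree 4,
    the vertices [z] and [p] are chosen and [x], [y], [w] are stripped. *)
Lemma deg2_same w x y z p : w \in V -> x \in V -> y \in V -> z \in V -> p \in V ->
  dg e V w = 2 -> x != y -> z != p -> e w x -> e w y -> e x z -> e y z -> e x p -> e y p ->
  p != w -> z != w -> dg e V z <= dg e V p -> False.
Proof.
move=> wV xV yV zV pV dw xy zp ewx ewy exz eyz exp eyp pw zw dzp.
have dx := deg2_deg3 wV dw xV ewx; have dy := deg2_deg3 wV dw yV ewy.
have cw : forall u, u \in V -> e w u -> u \in [:: x; y].
  by apply: cover; rewrite ?dw //; [suniq | rewrite /=; spl].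
symm.
have cx := cov3 dx wV zV pV ltac:(done) ltac:(done) ltac:(done) ltac:(neq) ltac:(neq) ltac:(done).
have cy := cov3 dy wV zV pV ltac:(done) ltac:(done) ltac:(done) ltac:(neq) ltac:(neq) ltac:(done).
have [t [tV ezt ept]] := deg2_block wV xV yV zV pV dw xy zp ewx ewy exz eyz eyp pw zw.
rewrite !inE !negb_or => /and3P[tx tw ty].
have ewz : e w z = false by sat.
have ewp : e w p = false by sat.
have ewt : e w t = false.
  by apply/negP=> h; have := cw t tV h; rewrite !inE (negPf tx) (negPf ty).
have nxt : e x t = false by sat.
have nyt : e y t = false by sat.
have sat1 : e z p = false by sat.
have dz3 : 2 < dg e V z.
  by apply: (@dg_ge _ e V z [:: x; y; t]); [suniq | symm; rewrite /=; spl].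
have [dp|dp] : dg e V p = 3 \/ dg e V p = 4.
- by case: (deg_cases pV) => h; rewrite h in dzp; [move: dz3 dzp; clear; lia | left | right].
- have dz : dg e V z = 3 by move: dz3 dzp; rewrite dp; clear; lia.
  sat; have cz := cov3 dz xV yV tV ltac:(done) ltac:(done) ltac:(done) ltac:(done) ltac:(neq) ltac:(neq).
  have cp := cov3 dp xV yV tV ltac:(done) ltac:(done) ltac:(done) ltac:(done) ltac:(neq) ltac:(neq).
  have VE : V = [set u in [:: t] ++ [:: w; x; y; z; p]].
    apply: (conn_all (a := w) (conn1 tV)); rewrite ?inE ?eqxx //; last by smem.
      by move=> u; rewrite in_rem !inE => /or4P[|||/orP[]]/eqP->; spl.
    move=> u v; rewrite !inE => /or4P[|||/orP[]]/eqP-> vV h.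
    - by have := cw v vV h; rewrite !inE => /orP[]->; rewrite ?orbT.
    - by case: (cx v vV h) => ->; rewrite eqxx ?orbT.
    - by case: (cy v vV h) => ->; rewrite eqxx ?orbT.
    - by case: (cz v vV h) => ->; rewrite eqxx ?orbT.
    - by case: (cp v vV h) => ->; rewrite eqxx ?orbT.
  have dt : dg e V t = 2.
    rewrite VE dg_set; first by sat; rewrite /deg_to ?big_cons ?big_nil /= ?ie; facts.
    by suniq.
  apply: ns; apply: (removal_slack (s := [:: t; w; x; y; z; p]) (ds := [:: x; y]) (ys := [::]) (i := 16) (K := 10) gV) => //.
  + by suniq.
  + by smem.
  + move=> A AV cA hA.
    have xA : x \notin A by apply: hA; inseq.
    have yA : y \notin A by apply: hA; inseq.
    have wA : w \notin A.
      apply: (leaf_notin (y := y) cA AV) => u uV eu uA.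
      by have := cw u uV eu; rewrite !inE => /orP[]/eqP E; rewrite E ?(negPf xA) // in uA *.
    have zA : z \notin A.
      apply: (leaf_notin (y := t) cA AV) => u uV eu uA.
      by case: (cz u uV eu) => // E; rewrite E ?(negPf xA) ?(negPf yA) // in uA.
    have pA : p \notin A.
      apply: (leaf_notin (y := t) cA AV) => u uV eu uA.
      by case: (cp u uV eu) => // E; rewrite E ?(negPf xA) ?(negPf yA) // in uA.
    have tA : t \notin A.
      apply: (leaf_notin (y := w) cA AV) => u uV eu uA; move: uV; rewrite VE !inE.
      by case/or4P=> [|||/or3P[]] /eqP E; rewrite E ?ie ?(negPf xA) ?(negPf yA) ?(negPf wA) ?(negPf zA) ?(negPf pA) // in eu uA.
    by move=> u; rewrite !inE => /or4P[|||/or3P[]]/eqP->.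
  + have -> : rem V [:: t; w; x; y; z; p] = set0; last exact: slack0.
    by apply/setP=> u; rewrite in_rem VE /= !inE andNb.
  + by inner.
  + by arith.
have dt : dg e V t != 2.
  by apply/eqP=> dt; apply: (deg2_not_deg4 tV dt pV _ dp); rewrite se.
pose s := [:: z; p; x; y; w].
have sV : {subset s <= V} by smem.
have us : uniq s by rewrite /s; suniq.
have bt : bonus (dg e V t) (deg_to e s t).
  have [zs ps] : z \in s /\ p \in s by rewrite !inE !eqxx ?orbT.
  have [etz etp] : e t z /\ e t p by split; rewrite se.
  case: (deg_cases tV) => d; first by rewrite d in dt.
    exact: bonus_deg3 zs etz.
  exact: bonus_deg4 zs ps zp etz etp.
have inr : \sum_(u <- s) deg_to e s u <= 12 by rewrite /s; sat; inner.
have hA (A : {set T}) : A \subset V -> core e A -> (forall x, x \in [:: z; p] -> x \notin A) ->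
     forall x, x \in s -> x \notin A.
  move=> AV cA hA.
  have zA : z \notin A by apply: hA; inseq.
  have pA : p \notin A by apply: hA; inseq.
  have xA : x \notin A.
    apply: (leaf_notin (y := w) cA AV) => u uV eu uA.
    by case: (cx u uV eu) => // E; rewrite E ?(negPf pA) ?(negPf zA) // in uA.
  have yA : y \notin A.
    apply: (leaf_notin (y := w) cA AV) => u uV eu uA.
    by case: (cy u uV eu) => // E; rewrite E ?(negPf pA) ?(negPf zA) // in uA.
  have wA : w \notin A.
    apply: (leaf_notin (y := y) cA AV) => u uV eu uA.
    by have := cw u uV eu; rewrite !inE => /orP[]/eqP E; rewrite E ?(negPf xA) // in uA *.
  by move=> u; rewrite !inE => /or4P[|||/orP[]]/eqP->.
sat.
have hu : \sum_(x in rem V s) deg_to e [:: z; p] x = dg e V z - 2 + (dg e V p - 2).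
  rewrite sum_deg_to // !big_cons big_nil addn0.
  have -> : dg e V z = dg e (rem V s) z + 2.
    by rewrite -(dg_rem _ _ us sV); congr (_ + _); rewrite /s /deg_to !big_cons big_nil ie; facts.
  have -> : dg e V p = dg e (rem V s) p + 2.
    by rewrite -(dg_rem _ _ us sV); congr (_ + _); rewrite /s /deg_to !big_cons big_nil ie; facts.
  by rewrite !addnK.
(* Every component left is joined to both [z] and [p], by [part_two], so it uses two of the
   remaining edges at these vertices, of which there are at most four. *)
have pb : 54 * tau e (rem V s) <= wt e (rem V s) + 10 * ((dg e V z - 2 + (dg e V p - 2)) %/ 2).
  rewrite -hu; apply: (parts_bound Pl_sub IH) => //; first exact: good_rem.
    by apply: leq_trans (card_rem (x := z) _ zV) VN; inseq.
  move=> P pP P0; have [PR _] := partP _ _ _ pP.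
  rewrite sum_deg_to // !big_cons big_nil addn0.
  have touch u v : u \in [:: z; p] -> v \in [:: z; p] -> u != v -> 0 < dg e P v.
    move=> hu' hv uv.
    have [r [q [rs ru qP eqr]]] := part_two (u := v) (v := u) pP P0 sV ltac:(rewrite /s; move: hv; rewrite !inE => /orP[]->; rewrite ?orbT //) ltac:(move: hu'; rewrite !inE => /orP[]/eqP-> //) ltac:(by rewrite eq_sym).
    have := subsetP PR q qP; rewrite in_rem !inE !negb_or => /andP[/and5P[qz qp qx qy qw] qV].
    have Er : r = v.
      move: rs; rewrite se in eqr; rewrite !inE => /or4P[/eqP E|/eqP E|/eqP E|/orP[]/eqP E].
      - by move: ru hu' hv uv; rewrite !inE E => h1 /orP[]/eqP E1 /orP[]/eqP E2; rewrite ?E1 ?E2 ?eqxx // in h1 *.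
      - by move: ru hu' hv uv; rewrite !inE E => h1 /orP[]/eqP E1 /orP[]/eqP E2; rewrite ?E1 ?E2 ?eqxx // in h1 *.
      - by rewrite E in eqr; case: (cx q qV eqr) => E2; rewrite E2 eqxx in qz qp qw.
      - by rewrite E in eqr; case: (cy q qV eqr) => E2; rewrite E2 eqxx in qz qp qw.
      - by rewrite E in eqr; have := cw q qV eqr; rewrite !inE (negPf qx) (negPf qy).
    by apply/card_gt0P; exists q; rewrite in_nb qP -Er se.
  have h1 := touch p z ltac:(inseq) ltac:(inseq) ltac:(by rewrite eq_sym).
  have h2 := touch z p ltac:(inseq) ltac:(inseq) ltac:(done).
  by move: h1 h2; clear; lia.
apply: ns; apply: (removal_bound (s := s) (ds := [:: z; p]) (ys := [:: t]) (i := 12) gV _ _ _ _ _ pb) => //.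
- move=> u; rewrite inE => /eqP->; rewrite tV bt andbT; rewrite !inE !negb_or; spl.
rewrite /s ?big_cons ?big_nil dp dx dy dw.
by case: (deg_cases zV) => d; rewrite d in dz3 *.
Qed.

(** The blocking vertex [z] is chosen, which brings [x] and [y] down to degree two. If it has degree
    4, suppressing [w] suffices: [44 + 6 + 11]. If it has degree 3, two uses of [deg2_block] make
    its third neighbour adjacent to [x'] and [y']; these are then not adjacent, so [x] can be
    suppressed after [w], and [34 + 6 + 22 = 62]. *)
Lemma deg_gt2 w : w \in V -> 2 < dg e V w.
Proof.
move=> wV; case: (deg_cases wV) => [dw|->|->] //; exfalso.
have [x [y [[xV yV ewx ewy xy] cw]]] := nb2 dw.
have dx := deg2_deg3 wV dw xV ewx; have dy := deg2_deg3 wV dw yV ewy.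
have [z [zV zw exz eyz]] := suppress_blocked wV xV yV xy ewx ewy cw.
symm; have [x' [[x'V exx' wx' zx'] cx]] := nb3 dx wV zV ltac:(done) ltac:(done) ltac:(by rewrite eq_sym).
have [y' [[y'V eyy' wy' zy'] cy]] := nb3 dy wV zV ltac:(done) ltac:(done) ltac:(by rewrite eq_sym).
have [E|xy'] := eqVneq x' y'.
  subst y'; have [l|l] := leqP (dg e V z) (dg e V x').
    exact: (@deg2_same w x y z x' wV xV yV zV x'V dw xy zx' ewx ewy exz eyz exx' eyy' ltac:(neq) zw l).
  exact: (@deg2_same w x y x' z wV xV yV x'V zV dw xy ltac:(neq) ewx ewy exx' eyy' exz eyz zw ltac:(neq) (ltnW l)).
have [t [tV ezt ey't tN]] := deg2_block wV xV yV zV y'V dw xy zy' ewx ewy exz eyz eyy' ltac:(neq) zw.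
have [t' [t'V ezt' ex't' t'N]] := deg2_block wV yV xV zV x'V dw ltac:(neq) zx' ewy ewx eyz exz exx' ltac:(neq) zw.
rewrite !inE !negb_or in tN t'N; have /and3P[tx tw ty] := tN; have /and3P[tx' tw' ty'] := t'N.
have dz3 : 2 < dg e V z.
  by apply: (@dg_ge _ e V z [:: x; y; t]); [suniq | symm; rewrite /=; spl].
have bx : bonus (dg e V x) (deg_to e [:: z] x) by apply: (bonus_deg3 (w := z)) => //; inseq.
have bY : bonus (dg e V y) (deg_to e [:: z] y) by apply: (bonus_deg3 (w := z)) => //; inseq.
case: (deg_cases zV) => dz; first by rewrite dz in dz3.
  have [z' [[z'V ezz' xz' yz'] cz]] := nb3 dz xV yV ltac:(done) ltac:(done) xy.
  have Et : t = z' by case: (cz t tV ezt) => // E; rewrite E eqxx in tx ty.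
  have Et' : t' = z' by case: (cz t' t'V ezt') => // E; rewrite E eqxx in tx' ty'.
  subst t t'; sat; apply: ns.
  apply: (removal_slack (s := [:: z]) (ds := [:: z]) (ys := [:: x; y]) (i := 0) (K := 22) gV) => //.
  - by smem.
  - by suniq.
  - by sys.
  - apply: (@suppress_path_slack _ _ Pl_sup _ IH _ _ w x y x') => //; rewrite ?in_rem ?inE.
    + exact: good_rem.
    + exact: conn1.
    + by apply: (@card_rem_le _ z) => //; inseq.
    + by spl.
    + by spl.
    + by spl.
    + by spl.
    + by neq.
    + by neq.
    + by move=> u; rewrite in_rem => /andP[_ uV]; apply: cw.
    + move=> u; rewrite in_rem inE => /andP[uz uV] /(cx u uV)[E|E|E]; auto.
      by rewrite E eqxx in uz.
    + apply/negP=> /(cy _ x'V)[]E; first by rewrite E eqxx in wx'.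
        by rewrite E eqxx in zx'.
      by rewrite E eqxx in xy'.
    + move=> u; rewrite in_rem inE => /andP[uz uV] uw ux h1 /(cy u uV)[E|E|E].
      * by rewrite E eqxx in uw.
      * by rewrite E eqxx in uz.
      * by rewrite E in h1; have : e x' y' = false by [sat]; rewrite h1.
  - by inner.
  - by arith.
apply: ns.
apply: (removal_slack (s := [:: z]) (ds := [:: z]) (ys := [:: x; y]) (i := 0) (K := 11) gV) => //.
- by smem.
- by suniq.
- by sys.
- apply: (@suppress_slack _ _ Pl_sup _ IH _ _ w x y) => //; rewrite ?in_rem ?inE.
  + exact: good_rem.
  + exact: conn1.
  + by apply: (@card_rem_le _ z) => //; inseq.
  + by spl.
  + by spl.
  + by spl.
  + by move=> u; rewrite in_rem => /andP[_ uV]; apply: cw.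
  + move=> u; rewrite in_rem inE => /andP[uz uV] uw /(cx u uV)[E|E|E] /(cy u uV)[E'|E'|E'];
      by rewrite ?E ?E' ?eqxx // -?E -?E' ?E ?E' ?eqxx in uz uw xy' *; rewrite ?E ?E' in xy' zx' zy' wx' wy'; rewrite ?eqxx in xy' zx' zy' wx' wy'.
- by inner.
- by arith.
Qed.

Lemma deg34 x : x \in V -> dg e V x = 3 \/ dg e V x = 4.
Proof. by move=> xV; have := deg_gt2 xV; case: (deg_cases xV) => ->; auto. Qed.


(** * Edge cuts: three-edge-connectivity *)

Definition cut A := [set u : T * T | [&& u.1 \in A, u.2 \in V :\: A & e u.1 u.2]].

Lemma in_cut A x y : ((x, y) \in cut A) = [&& x \in A, y \in V :\: A & e x y].
Proof. by rewrite inE. Qed.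

Lemma card_cut A : #|cut A| = \sum_(x in A) dg e (V :\: A) x.
Proof.
under eq_bigr do rewrite dg_sum.
rewrite pair_big_dep /= -sum1_card [LHS]big_mkcond [RHS]big_mkcond /=.
apply: eq_bigr => -[x y] _; rewrite in_cut /=.
by case: (x \in A); case: (y \in _); case: (e x y).
Qed.

Lemma cut_gt0 A : A \subset V -> A != set0 -> A != V -> 0 < #|cut A|.
Proof.
move=> AV A0 AnV; rewrite lt0n; apply: contra AnV => /eqP/cards0_eq c0.
have /connP[_ c] := cV; apply/eqP/c => //; apply/partP; split=> // x y xA yV exy.
apply: contraT => yA; have := in_cut A x y; by rewrite c0 inE xA inE yA yV exy.
Qed.

Lemma cut_gt1 A : A \subset V -> A != set0 -> A != V -> 1 < #|cut A|.
Proof.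
move=> AV A0 AnV; rewrite ltn_neqAle cut_gt0 // andbT eq_sym; apply/negP=> /cards1P[[c d] E].
have : (c, d) \in cut A by rewrite E inE.
rewrite in_cut => /and3P[cA dA ecd]; apply: ns; apply: (slackW (leq0n (3 * (dg e V c == 3)))).
apply: (bridge_slack Pl_sub IH gV cV VN AV cA dA ecd) => x y xA yA exy.
have : (x, y) \in cut A by rewrite in_cut xA yA.
by rewrite E inE => /eqP[-> ->].
Qed.

(** If the two edges shared an end, that end would be alone on its side, as there is no cut vertex,
    and have degree two. Otherwise [twocut_slack] applies: two vertices of degree at least 3
    contribute at least 68, and 64 is required. *)
Lemma cut_gt2 A : A \subset V -> A != set0 -> A != V -> 2 < #|cut A|.
Proof.
move=> AV A0 AnV; rewrite ltn_neqAle cut_gt1 // andbT eq_sym.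
apply/negP=> /cards2P[[a b] [[c d] [ne E]]].
have : (a, b) \in cut A by rewrite E !inE eqxx.
rewrite in_cut => /and3P[aA bA eab].
have : (c, d) \in cut A by rewrite E !inE eqxx orbT.
rewrite in_cut => /and3P[cA dA ecd].
have br x y : x \in A -> y \in V :\: A -> e x y -> x = a /\ y = b \/ x = c /\ y = d.
  move=> xA yA exy; have : (x, y) \in cut A by rewrite in_cut xA yA.
  by rewrite E !inE => /orP[]/eqP[-> ->]; [left|right].
have sV x : x \in A -> x \in V by move/(subsetP AV).
have nV x : x \in V :\: A -> x \in V by rewrite inE => /andP[].
have nA x : x \in V :\: A -> x \notin A by rewrite inE => /andP[].
(* If the cut edges share an endpoint [u], the rest of that side is a component of [V :\ u]. *)
have side (B : {set T}) u : B \subset V -> u \in B -> (exists2 y, y \in V & y \notin B) ->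
    (forall x y, x \in B -> y \in V -> y \notin B -> e x y -> x = u) -> B = [set u].
  move=> BV uB [y yV yB] hB; apply/eqP; rewrite eqEsubset sub1set uB andbT -setD_eq0.
  apply: contraT => B0; have /connP[_ h] := conn1 (subsetP BV u uB).
  have EB : B :\ u = rem V [:: u].
    apply: h => //; apply/partP; split; first by rewrite rem1 setSD.
    move=> x z; rewrite in_rem !inE => /andP[xu xB] /andP[zu zV] exz; rewrite zu /=.
    by apply: contraT => zB; rewrite (hB x z) ?eqxx // in xu.
  by have := in_rem V [:: u] y; rewrite -EB !inE (negPf yB) andbF yV andbT => /esym/negbT; rewrite negbK => /eqP E2; rewrite E2 uB in yB.
have dg2 u (f : T -> T * T) : injective f -> u \in V ->
    (forall y, y \in V -> e u y -> f y \in [set (a, b); (c, d)]) -> False.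
  move=> fi uV h; have := deg_gt2 uV; rewrite ltnNge => /negP; apply.
  apply: leq_trans (_ : #|[set (a, b); (c, d)]| <= 2); last by rewrite cards2; case: eqP.
  rewrite /dg -(card_imset _ fi); apply/subset_leq_card/subsetP=> _ /imsetP[y hy ->].
  by rewrite in_nb in hy; case/andP: hy => yV euy; apply: h.
have ac : a != c.
  apply/eqP=> ac; have AE : A = [set a].
    apply: side => //; first by exists b; [exact: nV | exact: nA].
    by move=> x y xA yV yA exy; case: (br x y xA) => //; [rewrite inE yA | case | case=> ->].
  apply: (dg2 a (fun y => (a, y))); [by move=> ? ? [] | exact: sV | move=> y yV eay].
  by rewrite -E in_cut aA inE yV eay AE inE !andbT; apply: contraTneq eay => ->; rewrite ie.
have bd : b != d.
  apply/eqP=> bd; have AE : V :\: A = [set b].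
    apply: side => //; first exact: subsetDl.
      by exists a; [exact: sV | rewrite inE aA].
    move=> x y xA yV yA exy; have yA' : y \in A by move: yA; rewrite inE yV andbT negbK.
    by case: (br y x yA' xA) => //; [rewrite se | case | case=> _ ->].
  apply: (dg2 b (fun y => (y, b))); [by move=> ? ? [] | exact: nV | move=> y yV eby].
  have yA : y \in A.
    apply: contraT => yA; have : y \in [set b] by rewrite -AE inE yA.
    by rewrite inE => /eqP E'; rewrite E' ie in eby.
  by rewrite -E in_cut yA bA se.
have VDD : V :\: (V :\: A) = A by rewrite setDDr setDv set0U (setIidPr AV).
(* Both cut edges leave every part of [B], because no cut has fewer than two edges, and
   complementary parts cannot both contain [a']. A part of [B] minus [a'] that misses [c'] would be
   closed in [V] minus [a']. *)
have conA (B : {set T}) (a' b' c' d' : T) : B \subset V -> a' != c' ->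
    a' \in B -> c' \in B -> b' \in V :\: B -> d' \in V :\: B -> e a' b' -> e c' d' ->
    (forall x y, x \in B -> y \in V :\: B -> e x y -> x = a' /\ y = b' \/ x = c' /\ y = d') ->
    conn e B /\ conn e (B :\ a').
  move=> BV ac' aB cB bB dB ea ec brB.
  have bV : b' \notin B by move: bB; rewrite inE => /andP[].
  split; apply/connP; split; try by apply/set0Pn; exists c'; rewrite ?inE ?(eq_sym c') ?ac'.
    move=> P /partP[PB hP] P0; apply/eqP; rewrite eqEsubset PB -setD_eq0; apply: contraT => Q0.
    have PV := subset_trans PB BV.
    have one (Q : {set T}) : Q \subset B -> Q != set0 -> (forall x y, x \in Q -> y \in B -> e x y -> y \in Q) ->
        a' \in Q /\ c' \in Q.
      move=> QB Q0' hQ; have QV := subset_trans QB BV.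
      have QnV : Q != V.
        by apply: contraNneq bV => E'; apply: (subsetP QB); rewrite E'; move: bB; rewrite inE => /andP[].
      have two x y : (x, y) \in cut Q -> (x, y) = (a', b') \/ (x, y) = (c', d').
        rewrite in_cut => /and3P[xQ]; rewrite inE => /andP[yQ yV] exy.
        have yB : y \notin B by apply: contra yQ => yB; apply: (hQ x).
        by case: (brB x y (subsetP QB x xQ) _ exy) => [|[-> ->]|[-> ->]]; [rewrite inE yB | left | right].
      have /card_gt1P[[x y] [[x' y'] [h1 h2]]] := cut_gt1 QV Q0' QnV.
      have [q1 q2] : x \in Q /\ x' \in Q by move: h1 h2; rewrite !in_cut => /and3P[-> _ _] /and3P[-> _ _].
      by case: (two _ _ h1) => -[E1 E2]; case: (two _ _ h2) => -[E3 E4]; subst; rewrite ?eqxx.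
    have [aP _] := one P PB P0 hP.
    have [|aQ _] := one (B :\: P) (subsetDl _ _) Q0; last by rewrite inE aP in aQ.
    move=> x y; rewrite !inE => /andP[xP xB] yB exy; rewrite yB andbT; apply: contra xP => yP.
    by apply: (hP y) => //; rewrite se.
  move=> P /partP[PB hP] P0; have /connP[_ h] := conn1 (subsetP BV a' aB).
  have nc (Q : {set T}) : Q \subset B :\ a' -> Q != set0 -> c' \notin Q ->
      (forall x y, x \in Q -> y \in B :\ a' -> e x y -> y \in Q) -> False.
    move=> QB Q0 cQ hQ; have EQ : Q = rem V [:: a'].
      apply: h => //; apply/partP; split; first by rewrite rem1; apply: subset_trans QB (setSD _ BV).
      move=> x y xQ; rewrite in_rem inE => /andP[ya yV] exy.
      have := subsetP QB x xQ; rewrite !inE => /andP[xa xB].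
      have [yB|yB] := boolP (y \in B); first by apply: (hQ x) => //; rewrite !inE ya.
      have [|[E' _]|[E' _]] := brB x y xB _ exy; first by rewrite inE yB.
        by rewrite E' eqxx in xa.
      by rewrite E' (negPf cQ) in xQ.
    have : b' \in Q.
      rewrite EQ in_rem inE; move: (bB); rewrite inE => /andP[_ ->]; rewrite andbT.
      by apply: contraNneq bV => ->.
    by move/(subsetP QB); rewrite !inE (negPf bV) andbF.
  have [cP|cP] := boolP (c' \in P); last by case: (nc P PB P0 cP).
  apply/eqP; rewrite eqEsubset PB -setD_eq0; apply: contraT => Q0; case: (nc (B :\ a' :\: P)) => //.
  - exact: subsetDl.
  - by rewrite inE cP.
  - move=> x y; rewrite !inE => /and3P[xP xa xB] /andP[ya yB] exy; rewrite ya yB !andbT.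
    by apply: contra xP => yP; apply: (hP y) => //; rewrite ?inE ?xa // se.
have [c1 c3] := conA A a b c d AV ac aA cA bA dA eab ecd br.
have [c2 c4] : conn e (V :\: A) /\ conn e (V :\: A :\ b).
  apply: (conA (V :\: A) b a d c) => //; rewrite ?VDD ?subsetDl // 1?se //.
  by move=> x y xA yA exy; case: (br y x yA xA) => [|[-> ->]|[-> ->]]; rewrite 1?se //; [left|right].
apply: ns; apply: (twocut_slack Pl_sub IH gV VN AV c1 c2 c3 c4 aA cA bA dA ac bd eab ecd br) => //.
by case: (deg34 (sV a aA)) => ->; case: (deg34 (nV b bA)) => ->.
Qed.

Lemma part_cut s (P : {set T}) : uniq s -> {subset s <= V} -> s != [::] -> part e (rem V s) P ->
  P != set0 -> 2 < \sum_(w <- s) dg e P w.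
Proof.
move=> us sV s0 pP P0; have [PR hP] := partP _ _ _ pP.
have PV : P \subset V := subset_trans PR (rem_sub _ _).
have PnV : P != V.
  case: s s0 sV PR {us pP hP} => // u s _ sV PR; apply: contraTneq (sV u (mem_head _ _)) => <-.
  by apply/negP=> /(subsetP PR); rewrite in_rem mem_head.
rewrite -(sum_deg_to s P se); apply: leq_trans (cut_gt2 PV P0 PnV) _.
rewrite card_cut; apply: leq_sum => x xP; rewrite -dg_set //.
apply/subset_leq_card/subsetP=> y; rewrite !in_nb !inE => /andP[/andP[yP yV] exy].
by rewrite exy andbT; apply: contraR yP => ys; apply: (hP x); rewrite ?in_rem ?ys.
Qed.

(** Each component left takes three of the edges leaving [s]; with at most five of them there is at
    most one component, so nothing is lost to connectivity. *)
Lemma rem_slack s : uniq s -> {subset s <= V} -> s != [::] ->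
  \sum_(w <- s) dg e V w <= 5 + \sum_(w <- s) deg_to e s w -> slack e (rem V s) 0.
Proof.
move=> us sV s0 hs; have [w ws] : exists w, w \in s.
  by case: s s0 {us sV hs} => // w s _; exists w; rewrite mem_head.
have := @parts_bound T Pl Pl_sub N IH e (rem V s) (deg_to e s) 3 (good_rem Pl_sub s gV) (leq_trans (card_rem ws (sV w ws)) VN) isT.
have h5 : \sum_(x in rem V s) deg_to e s x <= 5.
  rewrite sum_deg_to // -(leq_add2r (\sum_(w <- s) deg_to e s w)) -big_split /=.
  by under eq_bigr do rewrite (dg_rem _ _ us sV).
have {}h5 : (\sum_(x in rem V s) deg_to e s x) %/ 3 <= 1 by rewrite -ltnS ltn_divLR // ltnS.
rewrite /slack => h; rewrite addn0; apply: leq_trans (h _) _.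
  by move=> A pA A0; rewrite sum_deg_to //; apply: part_cut.
by rewrite leq_add2l -[X in _ <= X]muln1 leq_mul2l.
Qed.

(** With [c1] and [c2] chosen, [a], [b] and then [c3] are stripped. Five vertices and six inner
    edges free at least [5 * 34 - 60 = 110], against 108, and at most four edges leave the set. *)
Lemma no_K23 a b c1 c2 c3 : a \in V -> b \in V -> c1 \in V -> c2 \in V -> c3 \in V ->
  dg e V a = 3 -> dg e V b = 3 -> dg e V c2 = 3 -> dg e V c3 = 3 ->
  e a c1 -> e a c2 -> e a c3 -> e b c1 -> e b c2 -> e b c3 ->
  a != b -> c1 != c2 -> c1 != c3 -> c2 != c3 -> False.
Proof.
move=> aV bV c1V c2V c3V da db d2 d3 a1 a2 a3 b1 b2 b3 ab c12 c13 c23; sat.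
have ca := cov3 da c1V c2V c3V a1 a2 a3 c12 c13 c23.
have cb := cov3 db c1V c2V c3V b1 b2 b3 c12 c13 c23.
have [v [[vV c3v av bv] cc]] := nb3 d3 aV bV ltac:(done) ltac:(done) ab.
have us : uniq [:: c1; c2; a; b; c3] by suniq.
have sV : {subset [:: c1; c2; a; b; c3] <= V} by smem.
have E : \sum_(u <- [:: c1; c2; a; b; c3]) deg_to e [:: c1; c2; a; b; c3] u = 12.
  by inner.
apply: ns.
apply: (removal_slack (s := [:: c1; c2; a; b; c3]) (ds := [:: c1; c2]) (ys := [::]) (i := 12) (K := 0) gV) => //.
- move=> A AV cA hA.
  have h1 : c1 \notin A by apply: hA; inseq.
  have h2 : c2 \notin A by apply: hA; inseq.
  have h3 : a \notin A.
    apply: (leaf_notin (y := c3) cA AV) => u uV eu uA.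
    by case: (ca u uV eu) => // E'; rewrite E' ?(negPf h1) ?(negPf h2) in uA.
  have h4 : b \notin A.
    apply: (leaf_notin (y := c3) cA AV) => u uV eu uA.
    by case: (cb u uV eu) => // E'; rewrite E' ?(negPf h1) ?(negPf h2) in uA.
  have h5 : c3 \notin A.
    apply: (leaf_notin (y := v) cA AV) => u uV eu uA.
    by case: (cc u uV eu) => // E'; rewrite E' ?(negPf h3) ?(negPf h4) in uA.
  by move=> u; rewrite !inE => /or4P[|||/orP[]]/eqP->.
- apply: rem_slack => //; rewrite E !big_cons big_nil da db d2 d3.
  by case: (deg34 c1V) => ->.
- by rewrite E.
- by rewrite !big_cons big_nil da db d2 d3; case: (deg34 c1V) => ->.
Qed.

(** * Vertices of degree 3 with a neighbour of degree 4 *)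

Lemma dg_sub2 x (A B C : {set T}) : A \subset C -> B \subset C -> [disjoint A & B] ->
  dg e A x + dg e B x <= dg e C x.
Proof.
move=> AC BC dAB; rewrite /dg -cardsUI (_ : nb e A x :&: nb e B x = set0) ?cards0 ?addn0.
  by apply: subset_leq_card; rewrite subUset !nbS.
apply/setP=> y; rewrite !inE; apply/negP=> /andP[/andP[yA _] /andP[yB _]].
by move/pred0P/(_ y): dAB => /=; rewrite yA yB.
Qed.

Lemma part_touch s (P : {set T}) u v : part e (rem V s) P -> P != set0 -> s =i [:: u; v] ->
  u \in V -> v \in V -> u != v -> 0 < dg e P u.
Proof.
move=> pP P0 sE uV vV uv; have sV : {subset s <= V}.
  by move=> y; rewrite sE !inE => /orP[]/eqP->.
have us : u \in s by rewrite sE inE eqxx.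
have [w [y [ws wv yP eyw]]] := part_two pP P0 sV us vV uv.
apply/card_gt0P; exists y; rewrite in_nb yP; rewrite sE !inE in ws.
by case/orP: ws wv eyw => /eqP->; rewrite ?eqxx // se.
Qed.

(* If one part had a single edge to [p] and another a single edge to [v], these two edges would form a cut. *)
Lemma conn_del2 v p : v \in V -> p \in V -> dg e V v = 4 -> dg e V p = 4 -> v != p ->
  e v p = false -> conn e (rem V [:: v; p]).
Proof.
move=> vV pV dv dp vp evp; apply: contraT => nc; exfalso.
have sV : {subset [:: v; p] <= V} by smem.
have us : uniq [:: v; p] by suniq.
have epv : e p v = false by rewrite se.
(* Deleting a vertex of degree 4 falls short of 54 by exactly 10, the surplus that [del_conn]
   provides when every component sends two edges to the other vertex [w]. So some component sends at
   most one; the argument is used in both orders. *)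
have main u w : u \in V -> w \in V -> dg e V u = 4 -> dg e V w = 4 -> u != w -> e u w = false ->
    [:: u; w] =i [:: v; p] ->
    exists P : {set T}, [/\ part e (rem V [:: u; w]) P, P != set0 & dg e P w <= 1].
  move=> uV wV du dw uw euw E.
  have RE : rem V [:: u; w] = rem V [:: v; p] by apply/setP=> y; rewrite !in_rem E.
  pose H := rem V [:: u].
  have HE : H :\ w = rem V [:: u; w] by rewrite -rem1 /H rem_cat.
  have [/existsP[P /and3P[? ? ?]]|h] := boolP [exists P : {set T}, [&& part e (rem V [:: u; w]) P, P != set0 & dg e P w <= 1]].
    by exists P.
  exfalso; have wH : w \in H by rewrite in_rem inE eq_sym uw.
  case: (@del_conn _ _ Pl_sub _ IH e H w (good_rem Pl_sub _ gV) (conn1 uV)) => //.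
  - by apply: (@card_rem_le _ u) => //; inseq.
  - rewrite (cardsD1 w) wH HE ltnS card_gt0; apply/set0Pn.
    have [y [yV _ ys]] : exists y, [/\ y \in V, e w y & y \notin [:: u; w]] by apply: extend; rewrite dw.
    by exists y; rewrite in_rem ys.
  - move=> P; rewrite HE => pP P0; rewrite ltnNge; apply/negP=> l.
    by case/negP: h; apply/existsP; exists P; rewrite pP P0.
  - by rewrite HE RE (negPf nc).
  move=> sl; apply: ns.
  apply: (removal_slack (s := [:: u]) (ds := [:: u]) (ys := [::]) (i := 0) (K := 10) gV) => //.
  - by smem.
  - by inner.
  - by arith.
have [P [pP P0 dP]] := main v p vV pV dv dp vp evp (fun _ => erefl).
have Esw : [:: p; v] =i [:: v; p] by move=> y; rewrite !inE orbC.
have [Q [pQ Q0 dQ]] := main p v pV vV dp dv ltac:(neq) epv Esw.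
have RE : rem V [:: p; v] = rem V [:: v; p] by apply/setP=> y; rewrite !in_rem Esw.
rewrite RE in pQ; have [PR hP] := partP _ _ _ pP; have [QR hQ] := partP _ _ _ pQ.
have c2 (X : {set T}) : part e (rem V [:: v; p]) X -> X != set0 ->
    [/\ 0 < dg e X v, 0 < dg e X p & 2 < dg e X v + dg e X p].
  move=> pX X0; split.
  - exact: (part_touch pX X0 (fun _ => erefl)).
  - by apply: (part_touch pX X0 (fun y => esym (Esw y))) => //; neq.
  - by have := part_cut us sV isT pX X0; rewrite !big_cons big_nil addn0.
have dPQ : [disjoint P & Q].
  rewrite -setI_eq0; apply: contraT => I0.
  have [_ _] := c2 _ (partI pP pQ) I0; rewrite ltnNge => /negP[].
  by rewrite -[2]/(1 + 1) leq_add // ?(leq_trans (dgS _ _ (subsetIl _ _)) dP) ?(leq_trans (dgS _ _ (subsetIr _ _)) dQ).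
have [P1 P2 P3] := c2 P pP P0; have [Q1 Q2 Q3] := c2 Q pQ Q0.
have Rv : dg e (rem V [:: v; p]) v = dg e V v.
  by rewrite -(dg_rem e v us sV) /deg_to !big_cons big_nil ie evp !addn0.
have Rp : dg e (rem V [:: v; p]) p = dg e V p.
  by rewrite -(dg_rem e p us sV) /deg_to !big_cons big_nil ie epv !addn0.
(* A third component would bring the number of edges at [v] and [p] to nine, but these vertices have
   only eight. *)
have UR : P :|: Q = rem V [:: v; p].
  apply/eqP; rewrite eqEsubset subUset PR QR -setD_eq0; apply: contraT => X0.
  have pX : part e (rem V [:: v; p]) (rem V [:: v; p] :\: (P :|: Q)).
    rewrite setDUr; apply: partI; exact: partD.
  have [X1 X2 X3] := c2 _ pX X0.
  have l w : dg e P w + dg e Q w + dg e (rem V [:: v; p] :\: (P :|: Q)) w <= dg e (rem V [:: v; p]) w.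
    apply: leq_trans (_ : dg e (P :|: Q) w + dg e (rem V [:: v; p] :\: (P :|: Q)) w <= _).
      by rewrite leq_add2r; apply: dg_sub2; rewrite ?subsetUl ?subsetUr.
    apply: dg_sub2; rewrite ?subUset ?PR ?subsetDl //.
    by rewrite -setI_eq0 setIDA setIC -setIDA setDv setI0.
  move: (l v) (l p) X1 X2 X3 P1 P2 P3 Q1 Q2 Q3 dP dQ; rewrite Rv Rp dv dp; clear; lia.
have PV : P \subset V := subset_trans PR (rem_sub _ _).
have vP : v \notin P by apply/negP=> /(subsetP PR); rewrite in_rem inE eqxx.
have pP' : p \notin P by apply/negP=> /(subsetP PR); rewrite in_rem !inE eqxx orbT.
have AV : v |: P \subset V by rewrite subUset sub1set vV.
have := cut_gt2 AV; rewrite card_cut big_setU1 //=.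
have -> : v |: P != set0 by apply/set0Pn; exists v; rewrite !inE eqxx.
have -> : v |: P != V by apply: contraNneq pP' => E; have := pV; rewrite -E !inE eq_sym (negPf vp).
have s1 : \sum_(x in P) dg e (V :\: (v |: P)) x <= dg e P p.
  rewrite [X in _ <= X]dg_sum; apply: leq_sum => x xP; rewrite se.
  have [exp|nexp] := boolP (e x p).
    change (nat_of_bool true) with 1; rewrite -(cards1 p); apply/subset_leq_card/subsetP=> y; rewrite in_nb !inE negb_or => /andP[/andP[/andP[yv yP] yV] exy].
    apply: contraR yP => yp; apply: (hP x) => //; by rewrite in_rem !inE negb_or yv yp.
  change (nat_of_bool false) with 0; rewrite leqn0 cards_eq0 -subset0; apply/subsetP=> y; rewrite !inE negb_or => /andP[/andP[/andP[yv yP] yV] exy].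
  case/negP: yP; apply: (hP x) => //; rewrite in_rem !inE negb_or yv yV andbT /=.
  by apply: contraNneq nexp => <-.
have s2 : dg e P v + dg e (V :\: (v |: P)) v <= 4.
  rewrite -dv; apply: dg_sub2 => //; first exact: subsetDl.
  by rewrite -setI_eq0; apply/eqP/setP=> y; rewrite !inE negb_or; case: (y \in P); rewrite ?andbF.
have s3 : dg e V v <= dg e P v + dg e Q v.
  by rewrite -Rv -UR /dg -cardsUI; apply: leq_trans (leq_addr _ _); apply/subset_leq_card/subsetP=> y; rewrite !inE => /andP[/orP[]-> ->]; rewrite ?orbT.
by move=> /(_ isT isT); move: s1 s2 s3 P1 P3 Q1 dP dQ; rewrite dv; clear; lia.
Qed.

(** Choosing [v] frees 44 and leaves [x] with just [p] and [q]. Suppressing [x] would add 11, and 55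
    exceeds 54, so a 4-cycle through [x] blocks it. *)
Lemma common_nb x v p q : x \in V -> v \in V -> p \in V -> q \in V -> dg e V x = 3 -> dg e V v = 4 ->
  e x v -> e x p -> e x q -> v != p -> v != q -> p != q ->
  exists r, [/\ r \in V, r != x, e p r & e q r].
Proof.
move=> xV vV pV qV dx dv exv exp exq vp vq pq.
have cx := cov3 dx vV pV qV exv exp exq vp vq pq.
have [/existsP[r /and4P[]]|nh] := boolP [exists r, [&& r \in V, r != x, e p r & e q r]].
  by move=> *; exists r.
exfalso; apply: ns; symm.
apply: (removal_slack (s := [:: v]) (ds := [:: v]) (ys := [::]) (i := 0) (K := 11) gV) => //.
- by smem.
- apply: (@suppress_slack _ _ Pl_sup _ IH _ _ x p q) => //; rewrite ?in_rem ?inE.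
  + exact: good_rem.
  + exact: conn1.
  + by apply: (@card_rem_le _ v) => //; inseq.
  + by spl.
  + by spl.
  + by spl.
  + move=> u; rewrite in_rem inE => /andP[uv uV] /(cx u uV)[E|E|E]; auto.
    by rewrite E eqxx in uv.
  + move=> u; rewrite in_rem inE => /andP[uv uV] ux pu qu; case/negP: nh; apply/existsP; exists u.
    by rewrite uV ux pu.
- by inner.
- by arith.
Qed.

Lemma conn_del3 x v p q : x \in V -> v \in V -> p \in V -> q \in V -> dg e V x = 3 ->
  dg e V v = 4 -> dg e V p = 4 ->
  e x v -> e x p -> e x q -> v != p -> v != q -> p != q -> conn e (rem V [:: v; p; x]).
Proof.
move=> xV vV pV qV dx dv dp exv exp exq vp vq pq; sat.
have cx := cov3 dx vV pV qV exv exp exq vp vq pq.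
apply: (@conn_rem_strip [:: v; p] x q q) => //; rewrite ?in_rem ?inE ?negb_or.
- exact: conn_del2.
- by spl.
- by spl.
- by neq.
move=> u; rewrite in_rem !inE negb_or => /andP[/andP[uv up] uV] /(cx u uV)[E|E|//].
  by rewrite E eqxx in uv.
by rewrite E eqxx in up.
Qed.

Lemma core_avoids_del3 x v p q (A : {set T}) : (forall z, z \in V -> e x z -> [\/ z = v, z = p | z = q]) ->
  A \subset V -> core e A -> (forall y, y \in [:: v; p] -> y \notin A) ->
  forall y, y \in [:: v; p; x] -> y \notin A.
Proof.
move=> cx AV cA hA.
have h1 : v \notin A by apply: hA; inseq.
have h2 : p \notin A by apply: hA; inseq.
have h3 : x \notin A.
  apply: (leaf_notin (y := q) cA AV) => u uV eu uA.
  by case: (cx u uV eu) => // E'; rewrite E' ?(negPf h1) ?(negPf h2) in uA.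
by move=> u; rewrite !inE => /or3P[]/eqP->.
Qed.

(** Choosing [v] and [p] and stripping [x] frees [44 + 44 + 34 - 20 = 102], six short of 108, and
    two bonuses make exactly six. So at most one vertex around such a configuration earns a
    bonus. *)
Lemma two_bonuses x v p q y1 y2 : x \in V -> v \in V -> p \in V -> q \in V -> dg e V x = 3 ->
  dg e V v = 4 -> dg e V p = 4 ->
  e x v -> e x p -> e x q -> v != p -> v != q -> p != q -> y1 \in V -> y2 \in V -> y1 != y2 ->
  y1 \notin [:: v; p; x] -> y2 \notin [:: v; p; x] ->
  bonus (dg e V y1) (deg_to e [:: v; p; x] y1) ->
  bonus (dg e V y2) (deg_to e [:: v; p; x] y2) -> False.
Proof.
move=> xV vV pV qV dx dv dp exv exp exq vp vq pq y1V y2V y12 n1 n2 b1 b2.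
have cx := cov3 dx vV pV qV exv exp exq vp vq pq.
have cR := conn_del3 xV vV pV qV dx dv dp exv exp exq vp vq pq.
apply: ns; sat.
apply: (removal_slack (s := [:: v; p; x]) (ds := [:: v; p]) (ys := [:: y1; y2]) (i := 4) (K := 0) gV) => //.
- by suniq.
- by smem.
- by suniq.
- by apply/allP; rewrite /= y1V n1 b1 y2V n2 b2.
- by move=> A; apply: core_avoids_del3 cx.
- by apply: (@conn_rem_slack _ v) => //; inseq.
- by inner.
- by arith.
Qed.

(** If [q] had degree 3, it would be the one bonus vertex that [two_bonuses] allows. This forces its
    other neighbours [r] and [t] to be distinct and of degree 4. Suppressing [q] then gives
    [102 + 3 + 11]; if that is blocked, the same argument around [q], with [x] and the blocking
    vertex as bonuses, gives the contradiction. *)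
Lemma three_deg4 x v p q : x \in V -> v \in V -> p \in V -> q \in V -> dg e V x = 3 ->
  dg e V v = 4 -> dg e V p = 4 ->
  e x v -> e x p -> e x q -> v != p -> v != q -> p != q -> dg e V q = 4.
Proof.
move=> xV vV pV qV dx dv dp exv exp exq vp vq pq; case: (deg34 qV) => // dq; exfalso.
have cx := cov3 dx vV pV qV exv exp exq vp vq pq.
have cR := conn_del3 xV vV pV qV dx dv dp exv exp exq vp vq pq.
have [r [rV rx epr eqr]] := common_nb xV vV pV qV dx dv exv exp exq vp vq pq.
have [t [tV tx evt eqt]] := common_nb xV pV vV qV dx dp exp exv exq ltac:(neq) ltac:(neq) vq.
sat.
have bq : bonus (dg e V q) (deg_to e [:: v; p; x] q) by apply: (bonus_deg3 (w := x)) => //; inseq.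
have nb y : y \in V -> y != q -> y \notin [:: v; p; x] -> bonus (dg e V y) (deg_to e [:: v; p; x] y) -> False.
  move=> yV yq ny by'; apply: (two_bonuses xV vV pV qV dx dv dp exv exp exq vp vq pq yV qV yq ny _ by' bq).
  by rewrite !inE !negb_or; spl.
have nrv : r \notin [:: v; p; x] by rewrite !inE !negb_or; spl.
have ntv : t \notin [:: v; p; x] by rewrite !inE !negb_or; spl.
have rt : r != t.
  apply/eqP=> E; subst t; apply: (nb r rV ltac:(neq) nrv); case: (deg34 rV) => dr.
    by apply: (bonus_deg3 (w := v)) => //; inseq.
  by apply: (bonus_deg4 (w1 := v) (w2 := p)) => //; inseq.
have dr : dg e V r = 4.
  case: (deg34 rV) => // dr; case: (nb r rV ltac:(neq) nrv).
  by apply: (bonus_deg3 (w := p)) => //; inseq.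
have dt : dg e V t = 4.
  case: (deg34 tV) => // dt; case: (nb t tV ltac:(neq) ntv).
  by apply: (bonus_deg3 (w := v)) => //; inseq.
have cq := cov3 dq xV rV tV ltac:(done) ltac:(done) ltac:(done) ltac:(by rewrite eq_sym) ltac:(by rewrite eq_sym) rt.
have bx : bonus (dg e V x) (deg_to e [:: r; t; q] x) by apply: (bonus_deg3 (w := q)) => //; inseq.
apply: ns.
apply: (removal_slack (s := [:: v; p; x]) (ds := [:: v; p]) (ys := [:: q]) (i := 4) (K := 11) gV) => //.
- by suniq.
- by smem.
- by sys.
- by move=> A; apply: core_avoids_del3 cx.
- apply: (@suppress_slack _ _ Pl_sup _ IH _ _ q r t) => //; rewrite ?in_rem ?nrv ?ntv ?inE ?negb_or.
  + exact: good_rem.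
  + by apply: (@card_rem_le _ v) => //; inseq.
  + by spl.
  + by [].
  + by [].
  + move=> u; rewrite in_rem !inE !negb_or => /andP[/and3P[_ _ ux] uV] /(cq u uV)[E|E|E]; auto.
    by rewrite E eqxx in ux.
  + move=> u; rewrite in_rem !inE !negb_or => /andP[/and3P[_ _ ux] uV] uq ru tu; sat.
    apply: (two_bonuses qV rV tV xV dq dr dt _ _ _ rt _ _ uV xV ux _ _ _ bx); rewrite ?inE ?negb_or; try neq; try done.
    * by spl.
    * by spl.
    * case: (deg34 uV) => du.
        by apply: (bonus_deg3 (w := r)) => //; inseq.
      by apply: (bonus_deg4 (w1 := r) (w2 := t)) => //; inseq.
- by inner.
- by arith.
Qed.

Lemma nconn_avoid R q : R != set0 -> ~~ conn e R -> exists C : {set T}, [/\ part e R C, C != set0 & q \notin C].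
Proof.
move=> R0 /(nconn_part R0)[A [pA A0 AR]]; have [qA|qA] := boolP (q \in A); last by exists A.
exists (R :\: A); split; first exact: partD.
  by apply: contra AR; rewrite setD_eq0 => h; rewrite eqEsubset h andbT; case/partP: pA.
by rewrite inE qA.
Qed.

Lemma suppress_path x v r p q p1 q1 : x \in V -> v \in V -> r \in V -> p \in V -> q \in V ->
  p1 \in V -> q1 \in V -> v != p -> v != q -> v != p1 ->
  (forall z, z \in V -> e x z -> [\/ z = v, z = p | z = q]) ->
  (forall z, z \in V -> e p z -> [\/ z = x, z = r | z = p1]) ->
  (forall z, z \in V -> e q z -> [\/ z = x, z = r | z = q1]) ->
  e x v -> e x p -> e x q -> e p r -> e q r -> e p p1 -> e q q1 -> e p1 q1 = false ->
  p1 != q1 -> x != r -> r != p1 -> x != p1 -> p != q -> conn e (rem V [:: v; r]) ->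
  slack e (rem V [:: v; r]) 22.
Proof.
move=> xV vV rV pV qV p1V q1V vp vq vp1 cx cp cq exv exp exq epr eqr epp1 eqq1 np1q1 pq1 xr rp1 xp1 pq cR; sat.
apply: (@suppress_path_slack _ _ Pl_sup _ IH _ _ x p q p1) => //; rewrite ?in_rem ?inE ?negb_or.
- exact: good_rem.
- by apply: (@card_rem_le _ v) => //; inseq.
- by spl.
- by spl.
- by spl.
- by spl.
- by neq.
- by neq.
- move=> u; rewrite in_rem !inE !negb_or => /andP[/andP[uv ur] uV] /(cx u uV)[E|E|E]; auto.
  by rewrite E eqxx in uv.
- move=> u; rewrite in_rem !inE !negb_or => /andP[/andP[uv ur] uV] /(cp u uV)[E|E|E]; auto.
  by rewrite E eqxx in ur.
- apply/negP=> /(cq _ p1V)[]E; first by rewrite E eqxx in xp1.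
    by rewrite E eqxx in rp1.
  by rewrite E eqxx in pq1.
- move=> u; rewrite in_rem !inE !negb_or => /andP[/andP[uv ur] uV] ux up h1 /(cq u uV)[E|E|E].
  + by rewrite E eqxx in ux.
  + by rewrite E eqxx in ur.
  + by rewrite E np1q1 in h1.
Qed.

(** The vertices [p] and [q] share the neighbours [x] and [r]. A component avoiding [q] misses [r]
    as well, so it has no edge to [x] and at most the one from [p1] to [p]; three-edge-connectivity
    then demands two edges to [v], and [part_two] demands the edge at [p1]. *)
Lemma avoid_twin x v p q r p1 : x \in V -> v \in V -> p \in V -> q \in V -> r \in V -> p1 \in V ->
  (forall z, z \in V -> e x z -> [\/ z = v, z = p | z = q]) ->
  (forall z, z \in V -> e p z -> [\/ z = x, z = r | z = p1]) ->
  e x v -> e x p -> e x q -> e q r -> v != p -> v != q -> p != q -> v != r -> x != r -> e p r ->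
  ~~ conn e (rem V [:: v; p; x]) ->
  exists C : {set T}, [/\ part e (rem V [:: v; p; x]) C, C != set0, q \notin C,
    1 < dg e C v & p1 \in C].
Proof.
move=> xV vV pV qV rV p1V cx cp exv exp exq eqr vp vq pq vr xr epr nc.
have qR : q \in rem V [:: v; p; x] by sat; rewrite in_rem !inE !negb_or; spl.
have R0 : rem V [:: v; p; x] != set0 by apply/set0Pn; exists q.
have [C [pC C0 qC]] := nconn_avoid q R0 nc; have [CR hC] := partP _ _ _ pC.
have rC : r \notin C.
  by apply: contra qC => rC; apply: (hC r) => //; rewrite se.
have us : uniq [:: v; p; x] by sat; suniq.
have sV : {subset [:: v; p; x] <= V} by smem.
have inC y : y \in C -> [/\ y \in V, y != v, y != p & y != x].
  by move/(subsetP CR); rewrite in_rem !inE !negb_or => /andP[/and3P[]].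
have dx : dg e C x = 0.
  apply/eqP; rewrite cards_eq0 -subset0; apply/subsetP=> y; rewrite in_nb => /andP[yC exy].
  have [yV yv yp yx] := inC y yC.
  by case: (cx y yV exy) => E; rewrite E ?eqxx // in yv yp; rewrite -E yC in qC.
have Np : nb e C p \subset [set p1].
  apply/subsetP=> y; rewrite in_nb inE => /andP[yC epy].
  have [yV yv yp yx] := inC y yC.
  by case: (cp y yV epy) => E; rewrite E ?eqxx // in yx *; rewrite -E yC in rC.
have dp : dg e C p <= 1 by rewrite -(cards1 p1); exact: subset_leq_card.
have := part_cut us sV isT pC C0; rewrite !big_cons big_nil dx => h3.
exists C; split=> //; first by move: h3 dp; clear; lia.
have [w [y [ws wv yC eyw]]] := part_two (u := p) pC C0 sV ltac:(inseq) vV ltac:(by rewrite eq_sym).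
have : y \in [set p1].
  apply: (subsetP Np); rewrite in_nb yC se; move: ws wv eyw; rewrite !inE.
  case/or3P=> /eqP->; rewrite ?eqxx // => _ eyx.
  by have := in_nb e C x y; rewrite yC se eyx; move/eqP: dx; rewrite cards_eq0 => /eqP->; rewrite inE.
by rewrite inE => /eqP<-.
Qed.

(** If both deletions failed, two disjoint components would each take two edges of [v], which has
    only three apart from the one to [x]. *)
Lemma conn_twin x v p q r p1 q1 : x \in V -> v \in V -> p \in V -> q \in V -> r \in V -> p1 \in V ->
  q1 \in V -> dg e V v = 4 ->
  (forall z, z \in V -> e x z -> [\/ z = v, z = p | z = q]) ->
  (forall z, z \in V -> e p z -> [\/ z = x, z = r | z = p1]) ->
  (forall z, z \in V -> e q z -> [\/ z = x, z = r | z = q1]) ->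
  e x v -> e x p -> e x q -> e q r -> v != p -> v != q -> p != q -> v != r -> x != r -> e p r ->
  conn e (rem V [:: v; p; x]) \/ conn e (rem V [:: v; q; x]).
Proof.
move=> xV vV pV qV rV p1V q1V dv cx cp cq exv exp exq eqr vp vq pq vr xr epr.
have [|nc] := boolP (conn e (rem V [:: v; p; x])); first by left.
have [|nc'] := boolP (conn e (rem V [:: v; q; x])); first by right.
have cx' z : z \in V -> e x z -> [\/ z = v, z = q | z = p].
  by move=> zV /(cx z zV)[]; [constructor 1|constructor 3|constructor 2].
have [C [pC C0 qC Cv _]] := avoid_twin xV vV pV qV rV p1V cx cp exv exp exq eqr vp vq pq vr xr epr nc.
have [C' [pC' C0' pNC' Cv' _]] := avoid_twin xV vV qV pV rV q1V cx' cq exv exq exp epr vq vp ltac:(neq) vr xr eqr nc'.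
exfalso; have [CR hC] := partP _ _ _ pC; have [CR' hC'] := partP _ _ _ pC'.
have dCC : [disjoint C & C'].
  rewrite -setI_eq0; apply: contraT => I0.
  have inI y : y \in C :&: C' -> [/\ y \in V, y != v, y != p, y != q & y != x].
    rewrite inE => /andP[/(subsetP CR) h /(subsetP CR') h'].
    by move: h h'; rewrite !in_rem !inE !negb_or => /andP[/and3P[-> -> ->] ->] /andP[/and3P[_ -> _] _].
  have pI : part e (rem V [:: v; p; q; x]) (C :&: C').
    apply/partP; split.
      by apply/subsetP=> y /inI[h1 h2 h3 h4 h5]; rewrite in_rem !inE !negb_or h1 h2 h3 h4 h5.
    move=> y z; rewrite inE => /andP[yC yC']; rewrite in_rem !inE !negb_or => /andP[/and4P[h2 h3 h4 h5] h1] eyz.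
    by rewrite (hC y z) ?(hC' y z) // in_rem !inE !negb_or ?h1 ?h2 ?h3 ?h4 ?h5.
  have sV : {subset [:: v; p; q; x] <= V} by smem.
  have [w [y [ws wv yI eyw]]] := part_two (u := p) pI I0 sV ltac:(inseq) vV ltac:(by rewrite eq_sym).
  have [yV yv yp yq yx] := inI y yI; move: yI; rewrite inE => /andP[yC yC'].
  move: ws wv eyw; rewrite !inE; case/or4P=> /eqP->; rewrite ?eqxx // => _ eyw.
  - case/negP: pNC'; apply: (hC' y) => //; sat; rewrite in_rem !inE !negb_or; spl.
  - case/negP: qC; apply: (hC y) => //; sat; rewrite in_rem !inE !negb_or; spl.
  - by rewrite se in eyw; case: (cx y yV eyw) => E; rewrite E eqxx in yv yp yq.
have := dg_rem e v (s := [:: x]) isT (V := V) ltac:(smem).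
rewrite /deg_to big_cons big_nil se exv dv => h.
have l : dg e C v + dg e C' v <= dg e (rem V [:: x]) v.
  apply: dg_sub2 => //.
    by apply/subsetP=> y /(subsetP CR); rewrite !in_rem !inE !negb_or => /andP[/and3P[_ _ ->] ->].
  by apply/subsetP=> y /(subsetP CR'); rewrite !in_rem !inE !negb_or => /andP[/and3P[_ _ ->] ->].
by move: l h Cv Cv'; clear => /=; lia.
Qed.

(** Choosing [v] and [p] and stripping [x] frees [44 + 34 + 34 - 20 = 92]. Both [q] and [r] drop to
    degree two, for 6, and suppressing [r] adds 11: one more than the 108 needed. *)
Lemma no_twin_sup x v p q r q1 r1 : x \in V -> v \in V -> p \in V -> q \in V -> r \in V ->
  q1 \in V -> r1 \in V -> dg e V x = 3 -> dg e V v = 4 -> dg e V p = 3 -> dg e V q = 3 -> dg e V r = 3 ->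
  (forall z, z \in V -> e x z -> [\/ z = v, z = p | z = q]) ->
  (forall z, z \in V -> e q z -> [\/ z = x, z = r | z = q1]) ->
  (forall z, z \in V -> e r z -> [\/ z = p, z = q | z = r1]) ->
  e x v -> e x p -> e x q -> e p r -> e q r -> e r r1 -> r1 != v -> r1 != p -> r1 != q -> p != q -> x != r ->
  v != r -> e q1 r1 = false -> conn e (rem V [:: v; p; x]) -> False.
Proof.
move=> xV vV pV qV rV q1V r1V dx dv dp dq dr cx cq cr exv exp exq epr eqr err1 r1v r1p r1q pq xr vr nqr cR.
apply: ns; sat.
have bq : bonus (dg e V q) (deg_to e [:: v; p; x] q) by apply: (bonus_deg3 (w := x)) => //; inseq.
have br : bonus (dg e V r) (deg_to e [:: v; p; x] r) by apply: (bonus_deg3 (w := p)) => //; inseq.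
apply: (removal_slack (s := [:: v; p; x]) (ds := [:: v; p]) (ys := [:: q; r]) (i := 4) (K := 11) gV) => //.
- by suniq.
- by smem.
- by suniq.
- by sys.
- by move=> A; apply: core_avoids_del3 cx.
- apply: (@suppress_slack _ _ Pl_sup _ IH _ _ r q r1) => //; rewrite ?in_rem ?inE ?negb_or.
  + exact: good_rem.
  + by apply: (@card_rem_le _ v) => //; inseq.
  + by spl.
  + by spl.
  + by spl.
  + by neq.
  + move=> u; rewrite in_rem !inE !negb_or => /andP[/and3P[_ up ux] uV] /(cr u uV)[E|E|E]; auto.
    by rewrite E eqxx in up.
  + move=> u; rewrite in_rem !inE !negb_or => /andP[/and3P[_ up ux] uV] ur /(cq u uV)[E|E|E] h.
    * by rewrite E eqxx in ux.
    * by rewrite E eqxx in ur.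
    * by rewrite se E nqr in h.
- by inner.
- by arith.
Qed.

(** Choosing [v] and [r] leaves [x] and [p] with degree two, and they are suppressed in turn. With
    bonuses at [p], [q] and [p1] this frees [88 + 9 + 22], or 10 less if [v] and [r] are adjacent,
    which is still 109. *)
Lemma no_one_deg4_r4 x v p q r p1 q1 : x \in V -> v \in V -> p \in V -> q \in V -> r \in V ->
  p1 \in V -> q1 \in V -> dg e V x = 3 -> dg e V v = 4 -> dg e V p = 3 -> dg e V q = 3 -> dg e V r = 4 ->
  (forall z, z \in V -> e x z -> [\/ z = v, z = p | z = q]) ->
  (forall z, z \in V -> e p z -> [\/ z = x, z = r | z = p1]) ->
  (forall z, z \in V -> e q z -> [\/ z = x, z = r | z = q1]) ->
  e x v -> e x p -> e x q -> e p r -> e q r -> e p p1 -> e q q1 -> p != q -> x != r ->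
  x != p1 -> r != p1 -> x != q1 -> r != q1 -> False.
Proof.
move=> xV vV pV qV rV p1V q1V dx dv dp dq dr cx cp cq exv exp exq epr eqr epp1 eqq1 pq xr xp1 rp1 xq1 rq1.
symm.
have d3 y y1 : y \in V -> y1 \in V -> dg e V y = 3 -> e y x -> e y r -> e y y1 -> x != y1 -> r != y1 -> dg e V y1 = 3.
  move=> yV y1V dy eyx eyr eyy1 xy1 ry1; case: (deg34 y1V) => // d4.
  by have := three_deg4 yV rV y1V xV dy dr d4 eyr eyy1 eyx ry1 ltac:(neq) ltac:(neq); rewrite dx.
have dp1 := d3 p p1 pV p1V dp ltac:(done) epr epp1 xp1 rp1.
have dq1 := d3 q q1 qV q1V dq ltac:(done) eqr eqq1 xq1 rq1.
have [E|pq1] := eqVneq p1 q1.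
  subst q1; by apply: (@no_K23 p q r x p1) => //; neq.
(* Applying [common_nb] at [p] and at [q], with [r] as the neighbour of degree 4, puts [p1] and [q1]
   next to [v], unless they coincide, which [no_K23] has just excluded. *)
have alt : (e v p1 \/ p1 = q1) /\ (e v q1 \/ q1 = p1).
  split.
    have [z [zV zp exz ep1z]] := common_nb pV rV xV p1V dp dr epr ltac:(done) epp1 ltac:(neq) rp1 xp1.
    case: (cx z zV exz) => E; subst z; [by left; rewrite se | by rewrite eqxx in zp |].
    have h : e q p1 by rewrite se.
    by case: (cq p1 p1V h) => E; [rewrite E eqxx in xp1 | rewrite E eqxx in rp1 | right].
  have [z [zV zq exz eq1z]] := common_nb qV rV xV q1V dq dr eqr ltac:(done) eqq1 ltac:(neq) rq1 xq1.
  case: (cx z zV exz) => E; subst z; [by left; rewrite se | | by rewrite eqxx in zq].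
  have h : e p q1 by rewrite se.
  by case: (cp q1 q1V h) => E; [rewrite E eqxx in xq1 | rewrite E eqxx in rq1 | right].
have evp1 : e v p1 by case: alt => -[|E] //; rewrite E eqxx in pq1.
have evq1 : e v q1 by case: alt => _ [|E] //; rewrite E eqxx in pq1.
have vr : v != r.
  by apply/eqP=> E; subst r; apply: (gtf gV xV vV pV exv).
sat.
have bp : bonus (dg e V p) (deg_to e [:: v; r] p) by apply: (bonus_deg3 (w := r)) => //; inseq.
have bq : bonus (dg e V q) (deg_to e [:: v; r] q) by apply: (bonus_deg3 (w := r)) => //; inseq.
have bp1 : bonus (dg e V p1) (deg_to e [:: v; r] p1) by apply: (bonus_deg3 (w := v)) => //; inseq.
have cR : conn e (rem V [:: v; r]).
  have [evr|nevr] := boolP (e v r); last by apply: conn_del2 => //; exact: negPf.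
  have [//|nc] := boolP (conn e (rem V [:: v; r])); exfalso.
  have xR : x \in rem V [:: v; r] by rewrite in_rem !inE negb_or; spl.
  have [C [pC C0 xC]] := nconn_avoid x (ltac:(by apply/set0Pn; exists x) : rem V [:: v; r] != set0) nc.
  have [CR hC] := partP _ _ _ pC.
  have pr y z : y \notin C -> y \in rem V [:: v; r] -> e y z -> z \notin C.
    by move=> yC yR eyz; apply: contra yC => zC; apply: (hC z) => //; rewrite se.
  have pC' := pr x p xC xR exp; have qC' := pr x q xC xR exq.
  have p1C : p1 \notin C by apply: (pr p) => //; rewrite in_rem !inE negb_or; spl.
  have q1C : q1 \notin C by apply: (pr q) => //; rewrite in_rem !inE negb_or; spl.
  have cv := cov4 dv xV p1V q1V rV ltac:(done) evp1 evq1 evr xp1 xq1 xr pq1 ltac:(neq) ltac:(neq).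
  have := part_touch pC C0 (fun _ => erefl) vV rV vr; rewrite lt0n cards_eq0 => /negP; apply.
  rewrite -subset0; apply/subsetP=> y; rewrite in_nb => /andP[yC evy].
  have := subsetP CR y yC; rewrite in_rem !inE negb_or => /andP[/andP[yv yr] yV].
  by case: (cv y yV evy) => E; subst y; rewrite ?yC ?eqxx // in xC p1C q1C yr.
have S := suppress_path xV vV rV pV qV p1V q1V ltac:(neq) ltac:(neq) ltac:(neq) cx cp cq exv exp exq epr eqr epp1 eqq1 ltac:(assumption) pq1 xr rp1 xp1 pq cR.
apply: ns.
apply: (removal_slack (s := [:: v; r]) (ds := [:: v; r]) (ys := [:: p; q; p1]) (i := 2) (K := 22) gV) => //.
- by suniq.
- by smem.
- by suniq.
- by sys.
- by rewrite /deg_to ?big_cons ?big_nil ?ie (se r v); case: (e v r).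
- by arith.
Qed.

(** If [r1] is not adjacent to one of [p1] and [q1], then [r] can be suppressed as in [no_twin_sup].
    If it is adjacent to both, these two are not adjacent, and choosing [v] and [r] frees [44 + 34],
    with three bonuses and two suppressions 109 in all. *)
Lemma no_one_deg4_r3 x v p q r p1 q1 r1 : x \in V -> v \in V -> p \in V -> q \in V -> r \in V ->
  p1 \in V -> q1 \in V -> r1 \in V -> dg e V x = 3 -> dg e V v = 4 -> dg e V p = 3 -> dg e V q = 3 -> dg e V r = 3 ->
  (forall z, z \in V -> e x z -> [\/ z = v, z = p | z = q]) ->
  (forall z, z \in V -> e p z -> [\/ z = x, z = r | z = p1]) ->
  (forall z, z \in V -> e q z -> [\/ z = x, z = r | z = q1]) ->
  (forall z, z \in V -> e r z -> [\/ z = p, z = q | z = r1]) ->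
  e x v -> e x p -> e x q -> e p r -> e q r -> e p p1 -> e q q1 -> e r r1 -> p != q -> x != r ->
  x != p1 -> r != p1 -> x != q1 -> r != q1 -> p != r1 -> q != r1 -> False.
Proof.
move=> xV vV pV qV rV p1V q1V r1V dx dv dp dq dr cx cp cq cr exv exp exq epr eqr epp1 eqq1 err1 pq xr xp1 rp1 xq1 rq1 pr1 qr1.
have vp : v != p by neq.
have vq : v != q by neq.
have vr : v != r by neq.
have qp : q != p by neq.
have [E|r1v] := eqVneq r1 v.
  subst r1; apply: (@no_K23 x r v p q) => //; by rewrite se.
have cx' z : z \in V -> e x z -> [\/ z = v, z = q | z = p].
  by move=> zV /(cx z zV)[]; [constructor 1|constructor 3|constructor 2].
have cr' z : z \in V -> e r z -> [\/ z = q, z = p | z = r1].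
  by move=> zV /(cr z zV)[]; [constructor 2|constructor 1|constructor 3].
have ct := conn_twin xV vV pV qV rV p1V q1V dv cx cp cq exv exp exq eqr vp vq pq vr xr epr.
have r1p : r1 != p by neq.
have r1q : r1 != q by neq.
have L1 : e q1 r1 = false -> conn e (rem V [:: v; p; x]) -> False.
  by move=> h c; by apply: (@no_twin_sup x v p q r q1 r1) => //; neq.
have L2 : e p1 r1 = false -> conn e (rem V [:: v; q; x]) -> False.
  by move=> h c; by apply: (@no_twin_sup x v q p r p1 r1) => //; neq.
(* If the part avoiding the twin contained [p1], it would reach the twin through [r1] and [r]. *)
have R u w u1 : u \in V -> w \in V -> u1 \in V ->
    (forall z, z \in V -> e x z -> [\/ z = v, z = u | z = w]) ->
    (forall z, z \in V -> e u z -> [\/ z = x, z = r | z = u1]) ->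
    e x u -> e x w -> e w r -> v != u -> v != w -> u != w -> e u r -> r1 != u -> e u1 r1 ->
    conn e (rem V [:: v; u; x]).
  move=> uV wV u1V cx0 cu exu exw ewr vu vw uw eur r1u e1; apply: contraT => nc; exfalso.
  have [C [pC C0 wC _ u1C]] := avoid_twin xV vV uV wV rV u1V cx0 cu exv exu exw ewr vu vw uw vr xr eur nc.
  have [CR hC] := partP _ _ _ pC; case/negP: wC; sat.
  have r1C : r1 \in C by apply: (hC u1) => //; rewrite in_rem !inE !negb_or; spl.
  have rC : r \in C by apply: (hC r1) => //; rewrite in_rem !inE !negb_or; spl.
  by apply: (hC r) => //; rewrite in_rem !inE !negb_or; spl.
have [ep|np] := boolP (e p1 r1); have [eq|nq] := boolP (e q1 r1).
- have [E|pq1] := eqVneq p1 q1.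
    by subst q1; apply: (@no_K23 p q p1 x r) => //; (rewrite se; done) || neq.
  sat; have vp1 : v != p1 by neq.
  have cR : conn e (rem V [:: v; r]).
    have [//|nc] := boolP (conn e (rem V [:: v; r])); exfalso.
    have xR : x \in rem V [:: v; r] by rewrite in_rem !inE negb_or; spl.
    have [C [pC C0 xC]] := nconn_avoid x (ltac:(by apply/set0Pn; exists x) : rem V [:: v; r] != set0) nc.
    have [CR hC] := partP _ _ _ pC.
    have pr y z : y \notin C -> y \in rem V [:: v; r] -> e y z -> z \notin C.
      by move=> yC yR eyz; apply: contra yC => zC; apply: (hC z) => //; rewrite se.
    have pC' := pr x p xC xR exp; have qC' := pr x q xC xR exq.
    have p1C : p1 \notin C by apply: (pr p) => //; rewrite in_rem !inE negb_or; spl.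
    have r1C : r1 \notin C by apply: (pr p1) => //; rewrite in_rem !inE negb_or; spl.
    have Er : [:: v; r] =i [:: r; v] by move=> y; rewrite !inE orbC.
    have := part_touch pC C0 Er rV vV ltac:(by rewrite eq_sym); rewrite lt0n cards_eq0 => /negP; apply.
    rewrite -subset0; apply/subsetP=> y; rewrite in_nb => /andP[yC ery].
    have := subsetP CR y yC; rewrite in_rem => /andP[_ yV].
    by case: (cr y yV ery) => E; subst y; rewrite ?yC // in pC' qC' r1C.
  have S := suppress_path xV vV rV pV qV p1V q1V vp vq vp1 cx cp cq exv exp exq epr eqr epp1 eqq1 ltac:(assumption) pq1 xr rp1 xp1 pq cR.
  have bp : bonus (dg e V p) (deg_to e [:: v; r] p) by apply: (bonus_deg3 (w := r)) => //; inseq.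
  have bq : bonus (dg e V q) (deg_to e [:: v; r] q) by apply: (bonus_deg3 (w := r)) => //; inseq.
  have bx : bonus (dg e V x) (deg_to e [:: v; r] x) by apply: (bonus_deg3 (w := v)) => //; inseq.
  have evr : e v r = false.
    apply/negP=> h; have h' : e r v by rewrite se.
    by case: (cr v vV h') => E; [rewrite E eqxx in vp | rewrite E eqxx in vq | rewrite E eqxx in r1v].
  symm; apply: ns.
  apply: (removal_slack (s := [:: v; r]) (ds := [:: v; r]) (ys := [:: p; q; x]) (i := 0) (K := 22) gV) => //.
  + by suniq.
  + by smem.
  + by suniq.
  + by sys.
  + by inner.
  + by arith.
- by apply: L1; [exact: negPf | apply: (R p q p1)].
- by apply: L2; [exact: negPf | apply: (R q p q1)].
- by case: ct; [apply: L1 | apply: L2]; exact: negPf.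
Qed.

Lemma no_one_deg4 x v p q : x \in V -> v \in V -> p \in V -> q \in V -> dg e V x = 3 ->
  dg e V v = 4 -> dg e V p = 3 -> dg e V q = 3 ->
  e x v -> e x p -> e x q -> p != q -> False.
Proof.
move=> xV vV pV qV dx dv dp dq exv exp exq pq.
have vp : v != p by neq.
have vq : v != q by neq.
have cx := cov3 dx vV pV qV exv exp exq vp vq pq.
have [r [rV rx epr eqr]] := common_nb xV vV pV qV dx dv exv exp exq vp vq pq.
have xr : x != r by neq.
symm; have [p1 [[p1V epp1 xp1 rp1] cp]] := nb3 dp xV rV ltac:(done) epr xr.
have [q1 [[q1V eqq1 xq1 rq1] cq]] := nb3 dq xV rV ltac:(done) eqr xr.
case: (deg34 rV) => dr; last by apply: (@no_one_deg4_r4 x v p q r p1 q1) => //; neq.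
have [r1 [[r1V err1 pr1 qr1] cr]] := nb3 dr pV qV ltac:(done) ltac:(done) pq.
by apply: (@no_one_deg4_r3 x v p q r p1 q1 r1) => //; neq.
Qed.

Lemma nbrs_deg4 x v y : x \in V -> v \in V -> y \in V -> dg e V x = 3 -> dg e V v = 4 ->
  e x v -> e x y -> dg e V y = 4.
Proof.
move=> xV vV yV dx dv exv exy.
have [p [q [[pV qV exp exq] [[vp vq pq] cx]]]] := nb3a dx vV exv.
case: (deg34 pV) => dp; case: (deg34 qV) => dq.
- by case: (no_one_deg4 xV vV pV qV dx dv dp dq exv exp exq pq).
- by have := three_deg4 xV vV qV pV dx dv dq exv exq exp vq vp ltac:(neq); rewrite dp.
- by have := three_deg4 xV vV pV qV dx dv dp exv exp exq vp vq pq; rewrite dq.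
by case: (cx y yV exy) => ->.
Qed.

(** * Vertices of degree 3 all of whose neighbours have degree 4 *)

Definition hub x v p q := [/\ [/\ x \in V, v \in V, p \in V & q \in V],
  [/\ dg e V x = 3, dg e V v = 4, dg e V p = 4 & dg e V q = 4],
  [/\ e x v, e x p & e x q], [/\ v != p, v != q & p != q] &
  forall z, z \in V -> e x z -> [\/ z = v, z = p | z = q]].

Lemma hub_of x v : x \in V -> v \in V -> dg e V x = 3 -> dg e V v = 4 -> e x v ->
  exists p q, hub x v p q.
Proof.
move=> xV vV dx dv exv.
have [p [q [[pV qV exp exq] [[vp vq pq] cx]]]] := nb3a dx vV exv.
by exists p, q; split=> //; split=> //; apply: (nbrs_deg4 xV vV).
Qed.

Lemma hub_swap x v p q : hub x v p q -> hub x p v q.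
Proof.
case=> -[xV vV pV qV] [dx dv dp dq] [exv exp exq] [vp vq pq] cx; split; try by split=> //; neq.
by move=> z zV /(cx z zV)[]; [constructor 2|constructor 1|constructor 3].
Qed.

Lemma hub_rot x v p q : hub x v p q -> hub x p q v.
Proof.
case=> -[xV vV pV qV] [dx dv dp dq] [exv exp exq] [vp vq pq] cx; split; try by split=> //; neq.
by move=> z zV /(cx z zV)[]; [constructor 3|constructor 1|constructor 2].
Qed.

(** The vertex [s] given by [common_nb] loses both [v] and [p], so it earns a bonus whatever its
    degree, and [two_bonuses] allows no other. A neighbour of [v] of degree 3, or a second common
    neighbour, would be one. If [s] itself had degree 3, it could be stripped too:
    [102 + 34 - 20 = 116]. *)
Lemma hub_common x v p q : hub x v p q -> exists s : T, [/\ s \in V, s != x, e v s & e p s] /\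
  forall z, z \in V -> z != x -> e v z -> dg e V z = 4 /\ (e p z -> z = s).
Proof.
move=> hu; have [[xV vV pV qV] [dx dv dp dq] [exv exp exq] [vp vq pq] cx] := hu.
have [s [sV sx evs eps]] := common_nb xV qV vV pV dx dq exq exv exp ltac:(neq) ltac:(neq) vp.
exists s; split=> //; sat.
have sN : s \notin [:: v; p; x] by rewrite !inE !negb_or; spl.
have bs : bonus (dg e V s) (deg_to e [:: v; p; x] s).
  case: (deg34 sV) => d; first by apply: (bonus_deg3 (w := v)) => //; inseq.
  by apply: (bonus_deg4 (w1 := v) (w2 := p)) => //; inseq.
have uniq_s z : z \in V -> z != x -> e v z -> bonus (dg e V z) (deg_to e [:: v; p; x] z) -> z = s.
  move=> zV zx evz bz; apply/eqP; apply: contraT => zs; sat.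
  case: (two_bonuses xV vV pV qV dx dv dp exv exp exq vp vq pq zV sV zs _ sN bz bs).
  by rewrite !inE !negb_or; spl.
have ds : dg e V s = 4.
  case: (deg34 sV) => // ds; exfalso; apply: ns.
  have [s1 [[s1V ess1 vs1 ps1] cs]] := nb3 ds vV pV ltac:(done) ltac:(done) vp.
  have cR := conn_del3 xV vV pV qV dx dv dp exv exp exq vp vq pq.
  have cR2 : conn e (rem V [:: v; p; x; s]).
    apply: (@conn_rem_strip [:: v; p; x] s s1 q) => //; rewrite ?in_rem ?sN // ?inE ?negb_or; try by spl.
    move=> u; rewrite in_rem !inE !negb_or => /andP[/and3P[uv up ux] uV] /(cs u uV)[E|E|//].
      by rewrite E eqxx in uv.
    by rewrite E eqxx in up.
  apply: (removal_slack (s := [:: v; p; x; s]) (ds := [:: v; p]) (ys := [::]) (i := 8) (K := 0) gV) => //.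
  - by suniq.
  - by smem.
  - move=> A AV cA hA.
    have h1 : v \notin A by apply: hA; inseq.
    have h2 : p \notin A by apply: hA; inseq.
    have h3 : x \notin A.
      apply: (leaf_notin (y := q) cA AV) => u uV eu uA.
      by case: (cx u uV eu) => // E'; rewrite E' ?(negPf h1) ?(negPf h2) in uA.
    have h4 : s \notin A.
      apply: (leaf_notin (y := s1) cA AV) => u uV eu uA.
      by case: (cs u uV eu) => // E'; rewrite E' ?(negPf h1) ?(negPf h2) in uA.
    by move=> u; rewrite !inE => /or4P[]/eqP->.
  - by apply: (@conn_rem_slack _ v) => //; inseq.
  - by inner.
  - by arith.
move=> z zV zx evz.
have dz : dg e V z = 4.
  case: (deg34 zV) => // dz; suff E : z = s by rewrite E ds in dz.
  by apply: uniq_s => //; apply: (bonus_deg3 (w := v)) => //; [inseq | rewrite se].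
split=> // epz; apply: uniq_s => //; apply: (bonus_deg4 (w1 := v) (w2 := p)) => //; by [inseq | rewrite se].
Qed.

(** With [v] and [p] chosen and [x] stripped, [s] keeps the neighbours [q] and [s1]. Suppressing it
    would give [102 + 3 + 11], more than 108. *)
Lemma hub_K24_block x v p q (s s1 : T) : hub x v p q -> s \in V -> s != x -> e v s -> e p s -> e q s ->
  s1 \in V -> e s s1 -> s1 \notin [:: v; p; q] ->
  exists z, [/\ z \in V, e q z, e s1 z & z \notin [:: v; p; x; s]].
Proof.
move=> hu sV sx evs eps eqs s1V ess1 s1N.
have [[xV vV pV qV] [dx dv dp dq] [exv exp exq] [vp vq pq] cx] := hu; sat.
have cR := conn_del3 xV vV pV qV dx dv dp exv exp exq vp vq pq.
have ds : dg e V s = 4.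
  by have [s' [_ h]] := hub_common hu; case: (h s sV sx evs).
rewrite !inE !negb_or in s1N; have /and3P[s1v s1p s1q] := s1N.
have cs := cov4 ds vV pV qV s1V ltac:(done) ltac:(done) ltac:(done) ess1 vp vq ltac:(neq) pq ltac:(neq) ltac:(neq).
have bs : bonus (dg e V s) (deg_to e [:: v; p; x] s).
  by apply: (bonus_deg4 (w1 := v) (w2 := p)) => //; inseq.
have sN : s \notin [:: v; p; x] by rewrite !inE !negb_or; spl.
have [/existsP[z /and4P[? ? ? ?]]|nh] := boolP [exists z, [&& z \in V, e q z, e s1 z & z \notin [:: v; p; x; s]]].
  by exists z.
exfalso; apply: ns.
apply: (removal_slack (s := [:: v; p; x]) (ds := [:: v; p]) (ys := [:: s]) (i := 4) (K := 11) gV) => //.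
- by suniq.
- by smem.
- by sys.
- by move=> A; apply: core_avoids_del3 cx.
- apply: (@suppress_slack _ _ Pl_sup _ IH _ _ s q s1) => //; rewrite ?in_rem ?sN // ?inE ?negb_or.
  + exact: good_rem.
  + by apply: (@card_rem_le _ v) => //; inseq.
  + by spl.
  + by spl.
  + by neq.
  + move=> u; rewrite in_rem !inE !negb_or => /andP[/and3P[uv up ux] uV] /(cs u uV)[E|E|E|E]; auto.
      by rewrite E eqxx in uv.
    by rewrite E eqxx in up.
  + move=> u; rewrite in_rem => /andP[uN uV] us h1 h2; case/negP: nh; apply/existsP; exists u.
    by rewrite uV h1 h2 /=; move: uN; rewrite !inE (negPf us) orbF.
- by inner.
- by arith.
Qed.

(** Three uses of [hub_K24_block] surround the fourth neighbour [s1] of [s] by [s] and three further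
    vertices, one next to each of [v], [p], [q]. Choosing [v], [p] and [s1] suffices when the rest
    is connected; when it is not, the graph without [v], [p], [x] already has the surplus of 3 that
    is missing. *)
Lemma hub_no_K24 x v p q (s : T) : hub x v p q -> s \in V -> s != x -> e v s -> e p s -> e q s -> False.
Proof.
move=> hu sV sx evs eps eqs.
have [[xV vV pV qV] [dx dv dp dq] [exv exp exq] [vp vq pq] cx] := hu.
have [s' [_ h1]] := hub_common hu; have [ds /(_ eps) E] := h1 s sV sx evs; subst s'.
have [s' [_ h2]] := hub_common (hub_rot hu); have [_ /(_ eqs) E] := h2 s sV sx eps; subst s'.
have [s' [_ h3]] := hub_common (hub_rot (hub_rot hu)); have [_ /(_ evs) E] := h3 s sV sx eqs; subst s'.
symm; have [s1 [[s1V ess1 [vs1 ps1 qs1]] cs]] := nb4 ds vV pV qV ltac:(done) ltac:(done) ltac:(done) vp vq pq.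
have exs1 : e x s1 = false.
  by apply/negP=> /(cx _ s1V)[]E; [rewrite E eqxx in vs1 | rewrite E eqxx in ps1 | rewrite E eqxx in qs1].
have nz y a b : y \in V -> y \notin [:: x; s] -> (e a y -> dg e V y = 4 /\ (e b y -> y = s)) -> e a y -> dg e V y = 4 /\ e b y = false.
  move=> yV; rewrite !inE negb_or => /andP[yx ys] h ay; have [d hb] := h ay; split=> //.
  by apply/negP=> /hb E; rewrite E eqxx in ys.
have [zq [zqV eqz es1zq]] := hub_K24_block hu sV sx evs eps eqs s1V ess1 ltac:(rewrite !inE !negb_or; spl).
rewrite !inE !negb_or => /and4P[_ _ zqx zqs].
have [zv [zvV evz es1zv]] := hub_K24_block (hub_rot hu) sV sx eps eqs evs s1V ess1 ltac:(rewrite !inE !negb_or; spl).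
rewrite !inE !negb_or => /and4P[_ _ zvx zvs].
have [zp [zpV epz es1zp]] := hub_K24_block (hub_rot (hub_rot hu)) sV sx eqs evs eps s1V ess1 ltac:(rewrite !inE !negb_or; spl).
rewrite !inE !negb_or => /and4P[_ _ zpx zps].
have [dzv npzv] := nz zv v p zvV ltac:(rewrite !inE negb_or; spl) (h1 zv zvV zvx) evz.
have [dzp nqzp] := nz zp p q zpV ltac:(rewrite !inE negb_or; spl) (h2 zp zpV zpx) epz.
have [dzq nvzq] := nz zq q v zqV ltac:(rewrite !inE negb_or; spl) (h3 zq zqV zqx) eqz.
have nqzv : e q zv = false.
  by apply/negP=> h; have [_ /(_ evz) E] := h3 zv zvV zvx h; rewrite E eqxx in zvs.
have nvzp : e v zp = false.
  by apply/negP=> h; have [_ /(_ epz) E] := h1 zp zpV zpx h; rewrite E eqxx in zps.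
sat; have ds1 : dg e V s1 = 4.
  case: (deg34 s1V) => // d3.
  by have := @dg_ge _ e V s1 [:: s; zv; zp; zq] ltac:(suniq) ltac:(rewrite /=; spl); rewrite d3.
have cs1 := cov4 ds1 sV zvV zpV zqV ltac:(done) es1zv es1zp es1zq ltac:(neq) ltac:(neq) ltac:(neq) ltac:(neq) ltac:(neq) ltac:(neq).
pose Hx := rem V [:: v; p; x].
have cH : conn e Hx := conn_del3 xV vV pV qV dx dv dp exv exp exq vp vq pq.
have s1H : s1 \in Hx by rewrite in_rem !inE !negb_or; spl.
have sH : s \in Hx by rewrite in_rem !inE !negb_or; spl.
have qH : q \in Hx by rewrite in_rem !inE !negb_or; spl.
have zqH : zq \in Hx by rewrite in_rem !inE !negb_or; spl.
have gH : good e Hx := good_rem Pl_sub _ gV.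
have HN : #|Hx| <= N by apply: (@card_rem_le _ v) => //; inseq.
have bs : bonus (dg e V s) (deg_to e [:: v; p; x] s).
  by apply: (bonus_deg4 (w1 := v) (w2 := p)) => //; inseq.
(* Choosing [v] and [p] and stripping [x], with the bonus at [s], frees 105 of the 108 needed. *)
have fin3 : slack e Hx 3 -> False.
  move=> sl; apply: ns.
  apply: (removal_slack (s := [:: v; p; x]) (ds := [:: v; p]) (ys := [:: s]) (i := 4) (K := 3) gV) => //.
  - by suniq.
  - by smem.
  - by sys.
  - by move=> A; apply: core_avoids_del3 cx.
  - by inner.
  - by arith.
(* Stripping [x] and [s] besides the three chosen vertices frees [4 * 44 + 34 - 50 = 160] of the 162
   needed, and the bonuses at [zv] and [zp] exceed the difference. *)
have fin : conn e (rem V [:: v; p; x; s1]) -> False.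
  move=> c; apply: ns.
  have cR2 : conn e (rem V [:: v; p; x; s1; s]).
    apply: (@conn_rem_strip [:: v; p; x; s1] s q q) => //; rewrite ?in_rem ?inE ?negb_or; try by spl.
    move=> u; rewrite in_rem !inE !negb_or => /andP[/and4P[uv up ux us] uV] /(cs u uV)[E|E|//|E];
      by rewrite E eqxx in uv up us.
  have bzv : bonus (dg e V zv) (deg_to e [:: v; p; x; s1; s] zv).
    by apply: (bonus_deg4 (w1 := v) (w2 := s1)) => //; inseq.
  have bzp : bonus (dg e V zp) (deg_to e [:: v; p; x; s1; s] zp).
    by apply: (bonus_deg4 (w1 := p) (w2 := s1)) => //; inseq.
  apply: (removal_slack (s := [:: v; p; x; s1; s]) (ds := [:: v; p; s1]) (ys := [:: zv; zp]) (i := 10) (K := 0) gV) => //.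
  - by suniq.
  - by smem.
  - by suniq.
  - by sys.
  - move=> A AV cA hA.
    have a1 : v \notin A by apply: hA; inseq.
    have a2 : p \notin A by apply: hA; inseq.
    have a3 : s1 \notin A by apply: hA; inseq.
    have a4 : x \notin A.
      apply: (leaf_notin (y := q) cA AV) => u uV eu uA.
      by case: (cx u uV eu) => // E'; rewrite E' ?(negPf a1) ?(negPf a2) in uA.
    have a5 : s \notin A.
      apply: (leaf_notin (y := q) cA AV) => u uV eu uA.
      by case: (cs u uV eu) => // E'; rewrite E' ?(negPf a1) ?(negPf a2) ?(negPf a3) in uA.
    by move=> u; rewrite !inE => /or4P[|||/orP[]]/eqP->.
  - by apply: (@conn_rem_slack _ v) => //; inseq.
  - by inner.
  - by arith.
have HE : Hx :\ s1 = rem V [:: v; p; x; s1] by rewrite -rem1 rem_cat.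
(* If every component sends two edges to [s1], [del_conn] gives connectivity or a surplus of 10.
   Otherwise some component hangs on [s1] by a bridge whose other end is [zv] or [zp]; having lost
   [v] or [p], this end has degree 3, so [bridge_slack] yields the surplus of 3. *)
have [/existsP[P /and3P[pP P0 Ps1]]|nh] := boolP [exists P : {set T}, [&& part e (Hx :\ s1) P, P != set0 & dg e P s1 <= 1]]; last first.
  case: (@del_conn _ _ Pl_sub _ IH e Hx s1 gH cH HN s1H) => [||c|sl].
  - rewrite (cardsD1 s1) s1H ltnS card_gt0; apply/set0Pn; exists s; rewrite in_setD1 sH andbT; neq.
  - move=> P pP P0; rewrite ltnNge; apply/negP=> l; case/negP: nh.
    by apply/existsP; exists P; rewrite pP P0.
  - by apply: fin; rewrite -HE.
  - exact: fin3 (slackW (isT : 3 <= 10) sl).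
have [PH hP] := partP _ _ _ pP.
have PsH : P \subset Hx := subset_trans PH (subD1set _ _).
have s1P : s1 \notin P by apply/negP=> /(subsetP PH); rewrite !inE eqxx.
have sP : s \notin P.
  apply: contraL Ps1 => sP; rewrite -ltnNge.
  have qP : q \in P by apply: (hP s) => //; rewrite in_setD1 qH andbT; neq.
  have zqP : zq \in P by apply: (hP q) => //; rewrite in_setD1 zqH andbT; neq.
  by apply: (@dg_ge _ e P s1 [:: s; zq]); [suniq | rewrite /=; spl].
have zqP : zq \notin P.
  apply: contra sP => zqP.
  have qP : q \in P by apply: (hP zq) => //; rewrite in_setD1 qH andbT; neq.
  by apply: (hP q) => //; rewrite in_setD1 sH andbT; neq.
have [c [cP ecs1]] : exists c, c \in P /\ e c s1.
  have [/existsP[c /andP[]]|nc] := boolP [exists c, (c \in P) && e c s1]; first by exists c.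
  have /connP[_ hH] := cH; have E : P = Hx; last by rewrite E s1H in s1P.
  apply: hH => //; apply/partP; split=> // y z yP zH eyz; apply: (hP y) => //.
  rewrite in_setD1 zH andbT; apply: contraNneq nc => E; apply/existsP; exists y.
  by rewrite yP -E.
have one y : y \in P -> e y s1 -> y = c.
  move=> yP eys1; apply/eqP; apply: contraLR Ps1 => yc; rewrite -ltnNge.
  by apply: (@dg_ge _ e P s1 [:: y; c]); [rewrite /= inE yc | rewrite /= yP cP !(se s1) eys1 ecs1].
have cPV := subsetP PsH c cP.
have dc : dg e Hx c = 3.
  have := @dg_rem _ e V [:: v; p; x] c ltac:(suniq) ltac:(smem).
  have cV' : c \in V by move: cPV; rewrite in_rem => /andP[].
  have [] := cs1 c cV' ltac:(by rewrite se) => E; subst c; rewrite ?cP // in sP zqP.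
    have -> : deg_to e [:: v; p; x] zv = 1 by [rewrite /deg_to !big_cons big_nil; facts].
    by rewrite dzv -[4]/(3 + 1) => /addIn.
  have -> : deg_to e [:: v; p; x] zp = 1 by [rewrite /deg_to !big_cons big_nil; facts].
    by rewrite dzp -[4]/(3 + 1) => /addIn.
apply: fin3; have := @bridge_slack _ _ Pl_sub _ IH e Hx P c s1 gH cH HN PsH cP.
rewrite dc; apply=> //; first by rewrite inE s1P.
move=> y z yP; rewrite inE => /andP[zP zH] eyz.
have E : z = s1 by apply/eqP; apply: contraR zP => zs1; apply: (hP y) => //; rewrite in_setD1 zs1.
by subst z; rewrite (one y).
Qed.

(** The cube with one vertex missing: around [x] runs the hexagon [v c p a q b], in which [a] is
    opposite to [v], [b] to [p] and [c] to [q]. The missing antipode of [x] would be adjacent to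
    [a], [b] and [c]. *)
Definition hex x v p q (a b c : T) := [/\ hub x v p q, [/\ a \in V, b \in V & c \in V],
  [/\ a != x, b != x & c != x], [/\ e p a, e q a & e v b] & [/\ e q b, e v c & e p c]].

Lemma hex_rot x v p q a b c : hex x v p q a b c -> hex x p q v b c a.
Proof. by case=> hu [? ? ?] [? ? ?] [? ? ?] [? ? ?]; split=> //; apply: hub_rot. Qed.

Lemma hex_swap x v p q a b c : hex x v p q a b c -> hex x v q p a c b.
Proof.
case=> hu [? ? ?] [? ? ?] [? ? ?] [? ? ?]; split=> //.
by apply: hub_rot; apply: hub_swap.
Qed.


(** * Deleting the vertices [a], [b], [c] of a hexagonal configuration *)

Lemma hex_facts x v p q a b c : hex x v p q a b c ->
  [/\ dg e V a = 4, e v a = false, [/\ a != b, e a b = false & a != v] &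
   forall z, z \in V -> z != x -> e p z -> e q z -> z = a].
Proof.
case=> hu [aV bV cV'] [ax bx cx] [epa eqa evb] [eqb evc epc].
have [[xV vV pV qV] [dx dv dp dq] [exv exp exq] [vp vq pq] Nx] := hu.
have eva : e v a = false by apply/negP=> eva; apply: (hub_no_K24 hu aV ax eva epa eqa).
have [s' [_ h]] := hub_common (hub_rot hu).
have [da /(_ eqa) Ea] := h a aV ax epa; subst s'; symm.
split=> //; first by sat; split=> //; neq.
by move=> z zV zx epz eqz; case: (h z zV zx epz) => _; apply.
Qed.

Lemma in_hex x v p q a b c : hex x v p q a b c ->
  [/\ x \in rem V [:: a; b; c], v \in rem V [:: a; b; c], p \in rem V [:: a; b; c] & q \in rem V [:: a; b; c]].
Proof.
move=> hh; have [hu [aV bV cV'] [ax bx cx] [epa eqa evb] [eqb evc epc]] := hh.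
have [[xV vV pV qV] _ _ _ _] := hu.
have [_ _ [_ _ av] _] := hex_facts hh; have [_ _ [_ _ bp] _] := hex_facts (hex_rot hh).
have [_ _ [_ _ cq] _] := hex_facts (hex_rot (hex_rot hh)).
by split; rewrite in_rem !inE !negb_or; spl.
Qed.

Lemma rem_eq (s1 s2 : seq T) : s1 =i s2 -> rem V s1 = rem V s2.
Proof. by move=> h; apply/setP=> y; rewrite !in_rem h. Qed.

(** Since [v], [p], [q] hang on [x], they are outside [B], and the edges from [a] to [p] and [q] go
    elsewhere. If [a] had no edge to [B], then [b] and [c] alone would separate [B], against
    [conn_del2]. *)
Lemma hex_coord x v p q a b c (B : {set T}) : hex x v p q a b c -> part e (rem V [:: a; b; c]) B ->
  B != set0 -> x \notin B -> [/\ v \notin B, 0 < dg e B a & dg e B a + #|[set p; q]| <= 4].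
Proof.
move=> hh pB B0 xB; have [hu [aV bV cV'] [ax bx cx] [epa eqa evb] [eqb evc epc]] := hh.
have [[xV vV pV qV] [dx dv dp dq] [exv exp exq] [vp vq pq] Nx] := hu.
have [da _ _ _] := hex_facts hh; have [BR hB] := partP _ _ _ pB.
have [xR vR pR qR] := in_hex hh.
have nB y : y \in rem V [:: a; b; c] -> e x y -> y \notin B.
  by move=> yR exy; apply: contra xB => yB; apply: (hB y) => //; rewrite se.
split; first exact: nB.
  rewrite lt0n cards_eq0; apply/negP=> /eqP E.
  have [db _ [bc nbc _] _] := hex_facts (hex_rot hh).
  have [dc _ _ _] := hex_facts (hex_rot (hex_rot hh)).
  have /connP[_ h] := conn_del2 bV cV' db dc bc nbc.
  have BE : B = rem V [:: b; c]; last first.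
    by move: xB; rewrite BE in_rem !inE negb_or; move: xR; rewrite in_rem !inE !negb_or => /andP[/and3P[_ -> ->] ->].
  apply: h => //; apply/partP; split.
    by apply/subsetP=> y /(subsetP BR); rewrite !in_rem !inE !negb_or => /andP[/and3P[_ -> ->] ->].
  move=> y z yB; rewrite in_rem !inE negb_or => /andP[/andP[zb zc] zV] eyz; apply: (hB y) => //.
  rewrite in_rem !inE !negb_or zb zc zV !andbT; apply/eqP=> za; subst z.
  by have := in_nb e B a y; rewrite E inE yB se eyz.
have -> : #|[set p; q]| = dg e [set p; q] a.
  by apply: eq_card => y; rewrite in_nb !inE; case: eqVneq => [->|_]; [rewrite se epa | case: eqVneq => // ->; rewrite se eqa].
rewrite -da; apply: dg_sub2.
- exact: subset_trans BR (rem_sub _ _).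
- by apply/subsetP=> y; rewrite !inE => /orP[]/eqP->.
- rewrite -setI_eq0; apply/eqP/setP=> y; rewrite !inE; apply/andP=> -[yB /orP[]/eqP E]; subst y.
    by rewrite (negPf (nB p pR exp)) in yB.
  by rewrite (negPf (nB q qR exq)) in yB.
Qed.

Lemma hex_coords x v p q a b c (B : {set T}) : hex x v p q a b c -> part e (rem V [:: a; b; c]) B ->
  B != set0 -> x \notin B ->
  [/\ [/\ v \notin B, p \notin B & q \notin B], [/\ 0 < dg e B a, 0 < dg e B b & 0 < dg e B c] &
      [/\ dg e B a <= 2, dg e B b <= 2 & dg e B c <= 2]].
Proof.
move=> hh pB B0 xB; have [hu _ _ _ _] := hh; have [_ _ _ [vp vq pq] _] := hu.
have E1 : [:: b; c; a] =i [:: a; b; c] by move=> y; rewrite !inE orbA orbC.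
have E2 : [:: c; a; b] =i [:: a; b; c] by move=> y; rewrite !inE orbC orbA.
have pB1 := pB; rewrite -(rem_eq E1) in pB1; have pB2 := pB; rewrite -(rem_eq E2) in pB2.
have [vB a0 a2] := hex_coord hh pB B0 xB.
have [pB' b0 b2] := hex_coord (hex_rot hh) pB1 B0 xB.
have [qB c0 c2] := hex_coord (hex_rot (hex_rot hh)) pB2 B0 xB.
move: a2 b2 c2; rewrite !cards2 pq (eq_sym q v) vq vp.
by split=> //; split; move: a2 b2 c2; clear; lia.
Qed.

(** Once [a] is deleted, the edges from [b] to [b1] and from [c] to [c1] form a 2-edge cut around
    [B]. Its surplus of 10 is exactly what deleting a vertex of degree 4 lacks: [b] keeps degree 4
    and [b1] degree at least 3, so [44 + 34] covers [10 + 64]. *)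
Lemma hex_cut x v p q a b c b1 c1 (B : {set T}) : hex x v p q a b c -> part e (rem V [:: a; b; c]) B ->
  B != set0 -> x \notin B -> nb e B b = [set b1] -> nb e B c = [set c1] -> b1 != c1 ->
  2 < dg e (rem V [:: a]) b1 -> False.
Proof.
move=> hh pB B0 xB nbb nbc b1c1 d1; have [BR hB] := partP _ _ _ pB.
have [hu [aV bV cV'] [ax bx cx] [epa eqa evb] [eqb evc epc]] := hh.
have [[xV vV pV qV] [dx dv dp dq] [exv exp exq] [vp vq pq] Nx] := hu.
have [da eva [ab nab av] _] := hex_facts hh.
have [db epb [bc nbc' bp] _] := hex_facts (hex_rot hh).
have [dc eqc [ca nca cq] _] := hex_facts (hex_rot (hex_rot hh)).
have [[vB pB' qB] _ [a2 _ _]] := hex_coords hh pB B0 xB.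
have [xR vR pR qR] := in_hex hh.
have inB y : y \in B -> [/\ y \in V, y != a, y != b & y != c].
  by move/(subsetP BR); rewrite in_rem !inE !negb_or => /andP[/and3P[]].
have [b1B eb1] : b1 \in B /\ e b b1.
  by have : b1 \in nb e B b by [rewrite nbb inE]; rewrite in_nb => /andP.
have [c1B ec1] : c1 \in B /\ e c c1.
  by have : c1 \in nb e B c by [rewrite nbc inE]; rewrite in_nb => /andP.
have isb y : y \in B -> e b y -> y = b1.
  by move=> yB eby; apply/eqP; rewrite -in_set1 -nbb in_nb yB.
have isc y : y \in B -> e c y -> y = c1.
  by move=> yB eby; apply/eqP; rewrite -in_set1 -nbc in_nb yB.
have [b1V b1a b1b b1c] := inB b1 b1B; have [c1V c1a c1b c1c] := inB c1 c1B.
pose H1 := rem V [:: a].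
have BH : B \subset H1 by apply/subsetP=> y /inB[h1 h2 h3 h4]; rewrite in_rem inE h2.
have cH : conn e H1 := conn1 aV.
have bH : b \in H1 :\: B.
  by rewrite inE in_rem inE eq_sym ab bV !andbT; apply/negP=> /inB[_ _]; rewrite eqxx.
have cHB : c \in H1 :\: B.
  by rewrite inE in_rem inE ca cV' !andbT; apply/negP=> /inB[_ _ _]; rewrite eqxx.
have vHB : v \in H1 :\: B.
  by rewrite inE in_rem inE (eq_sym v) av vV vB.
have xHB : x \in H1 :\: B.
  by rewrite inE in_rem inE (eq_sym x) ax xV xB.
have out y z : y \in B -> z \in V -> z \notin B -> e y z -> z \in [:: a; b; c].
  by move=> yB zV zB eyz; apply: contraR zB => zN; apply: (hB y) => //; rewrite in_rem zN.
have br y z : y \in B -> z \in H1 :\: B -> e y z -> y = b1 /\ z = b \/ y = c1 /\ z = c.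
  move=> yB; rewrite inE in_rem inE => /and3P[zB za zV] eyz.
  have := out y z yB zV zB eyz; rewrite !inE (negPf za) /= => /orP[]/eqP E; subst z.
    by left; rewrite (isb y yB) // se.
  by right; rewrite (isc y yB) // se.
have cB : conn e B.
  apply/connP; split=> // P pP P0; have [PB _] := partP _ _ _ pP.
  have b1P (Q : {set T}) : part e B Q -> Q != set0 -> b1 \in Q.
    move=> pQ Q0; have [QB _] := partP _ _ _ pQ.
    have xQ : x \notin Q by apply: contra xB; apply: (subsetP QB).
    have [_ [_ /card_gt0P[y]]] := hex_coords hh (part_sub pB pQ) Q0 xQ.
    by rewrite in_nb => /andP[yQ eby] _ _; rewrite -(isb y (subsetP QB y yQ) eby).
  apply/eqP; rewrite eqEsubset PB -setD_eq0; apply: contraT => Q0.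
  by have := b1P _ (partD se pP) Q0; rewrite inE (b1P P pP P0).
have cHD : conn e (H1 :\: B).
  apply/connP; split; first by apply/set0Pn; exists x.
  move=> P pP P0; have [PB _] := partP _ _ _ pP.
  have bP (Q : {set T}) : part e (H1 :\: B) Q -> Q != set0 -> b \in Q.
    move=> pQ Q0; have [QB hQ] := partP _ _ _ pQ.
    apply: contraT => bQ; have cQ : c \notin Q.
      apply: contra bQ => cQ; apply: (hQ v) => //.
      by apply: (hQ c) => //; rewrite se.
    have /connP[_ h] := cH; have E : Q = H1.
      apply: h => //; apply/partP; split; first exact: subset_trans QB (subsetDl _ _).
      move=> y z yQ zH eyz; have [zB|zB] := boolP (z \in B); last by apply: (hQ y); rewrite // inE zB.
      have := subsetP QB y yQ => yH; have ezy : e z y by rewrite se.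
      by case: (br z y zB yH ezy) => -[_ E]; rewrite E ?(negPf bQ) ?(negPf cQ) in yQ.
    by have := subsetP BH b1 b1B; rewrite -E => /(subsetP QB); rewrite inE b1B.
  apply/eqP; rewrite eqEsubset PB -setD_eq0; apply: contraT => Q0.
  by have := bP _ (partD se pP) Q0; rewrite inE (bP P pP P0).
have cHDb : conn e (H1 :\: B :\ b).
  apply/connP; split; first by apply/set0Pn; exists c; rewrite in_setD1 cHB eq_sym bc.
  move=> P pP P0; have [PB _] := partP _ _ _ pP.
  have bP (Q : {set T}) : part e (H1 :\: B :\ b) Q -> Q != set0 -> c \in Q.
    move=> pQ Q0; have [QB hQ] := partP _ _ _ pQ.
    apply: contraT => cQ; have /connP[_ h] := conn_del2 aV bV da db ab nab.
    have E : Q = rem V [:: a; b].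
      apply: h => //; apply/partP; split.
        apply/subsetP=> y /(subsetP QB); rewrite in_setD1 in_setD !in_rem !inE negb_or.
        by case/and3P=> -> _ /andP[-> ->].
      move=> y z yQ; rewrite in_rem !inE negb_or => /andP[/andP[za zb] zV] eyz.
      have zH : z \in H1 by rewrite in_rem inE za.
      have := subsetP QB y yQ; rewrite in_setD1 => /andP[yb yH].
      have [zB|zB] := boolP (z \in B); last by apply: (hQ y); rewrite // in_setD1 zb in_setD zB.
      have ezy : e z y by rewrite se.
      by case: (br z y zB yH ezy) => -[_ E]; rewrite E ?(negPf cQ) ?eqxx in yQ yb.
    by have : c \in Q by [rewrite E in_rem !inE negb_or ca eq_sym bc cV']; rewrite (negPf cQ).
  apply/eqP; rewrite eqEsubset PB -setD_eq0; apply: contraT => Q0.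
  by have := bP _ (partD se pP) Q0; rewrite inE (bP P pP P0).
have cBb : conn e (B :\ b1).
  apply/connP; split; first by apply/set0Pn; exists c1; rewrite in_setD1 c1B eq_sym b1c1.
  move=> P pP P0; have [PB hP] := partP _ _ _ pP.
  apply/eqP; rewrite eqEsubset PB -setD_eq0; apply: contraT => Q0; exfalso.
  set Q := B :\ b1 :\: P in Q0; have pQ : part e (B :\ b1) Q := partD se pP.
  have usc : uniq [:: b1; a; c] by suniq.
  have sVc : {subset [:: b1; a; c] <= V} by smem.
  have p3 (X : {set T}) : part e (B :\ b1) X -> part e (rem V [:: b1; a; c]) X.
    move=> /partP[XB hX]; apply/partP; split.
      apply/subsetP=> y /(subsetP XB); rewrite in_setD1 in_rem !inE !negb_or => /andP[yb yB].
      by have [-> -> _ ->] := inB y yB; rewrite yb.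
    move=> y z yX; rewrite in_rem !inE !negb_or => /andP[/and3P[zb1 za zc] zV] eyz.
    have := subsetP XB y yX; rewrite in_setD1 => /andP[yb yB].
    have [zB|zB] := boolP (z \in B); first by apply: (hX y); rewrite // in_setD1 zb1.
    have := out y z yB zV zB eyz; rewrite !inE (negPf za) (negPf zc) orbF /= => /eqP E; subst z.
    by rewrite (isb y yB) ?eqxx // se in yb.
  have dXc (X : {set T}) : X \subset B :\ b1 -> c1 \notin X -> dg e X c = 0.
    move=> XB cX; apply/eqP; rewrite cards_eq0 -subset0; apply/subsetP=> y; rewrite in_nb => /andP[yX ecy].
    have := subsetP XB y yX; rewrite in_setD1 => /andP[yb yB].
    by rewrite -(isc y yB ecy) yX in cX.
  have dXc1 (X : {set T}) : X \subset B :\ b1 -> dg e X c <= 1.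
    move=> XB; rewrite -(cards1 c1) -nbc; apply/subset_leq_card/nbS.
    exact: subset_trans XB (subD1set _ _).
  have QB : Q \subset B :\ b1 := subsetDl _ _.
  have cP := part_cut usc sVc isT (p3 P pP) P0; have cQ := part_cut usc sVc isT (p3 Q pQ) Q0.
  rewrite !big_cons !big_nil in cP cQ.
  have s1 w : dg e P w + dg e Q w <= dg e (B :\ b1) w.
    by apply: dg_sub2 => //; rewrite -setI_eq0 setIDA setIC -setIDA setDv setI0.
  have b1D : dg e (B :\ b1) b1 + (1 + e a b1) <= dg e V b1.
    have := @dg_rem _ e V [:: a; b] b1 ltac:(suniq) ltac:(smem).
    rewrite /deg_to !big_cons big_nil (se b1 a) (se b1 b) eb1 => <-.
    rewrite addn0 [X in _ <= _ + X]addnC leq_add2r; apply: dgS; apply/subsetP=> y.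
    by rewrite in_setD1 => /andP[_ /inB[h1 h2 h3 h4]]; rewrite in_rem !inE negb_or h2 h3.
  have aD : dg e (B :\ b1) a + (e a b1) <= 2.
    apply: leq_trans a2; rewrite /dg [in X in _ <= X](cardsD1 b1) in_nb b1B /= addnC leq_add2l.
    by apply: subset_leq_card; apply/subsetP=> y; rewrite !inE => /andP[/andP[-> ->] ->].
  have cc : (dg e P c = 0 /\ dg e Q c <= 1) \/ (dg e Q c = 0 /\ dg e P c <= 1).
    have [c1P|c1P] := boolP (c1 \in P); last by left; rewrite dXc // dXc1.
    by right; rewrite dXc1 // dXc // inE c1P.
  (* Two complementary parts of [B] minus [b1] need six edges to [b1], [a] and [c]. These offer at
     most three, two and one, and fewer if [b1] has degree 3 or is adjacent to [a]. In the tight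
     case the part without [c1] has no edge to [c], so [b1] and [a] alone would separate it, against
     [conn_del2]. *)
  have [E|[d4 nba]] : (e a b1 \/ dg e V b1 = 3) \/ (dg e V b1 = 4 /\ e a b1 = false).
      by case: (deg34 b1V) => ->; [left; right | case: (e a b1); [left; left | right]].
    have d34 : dg e V b1 <= 4 by case: (deg34 b1V) => ->.
    move: (s1 b1) (s1 a) cP cQ b1D aD cc d34.
    by case: E => ->; clear; (try case: (e a b1)) => /=; lia.
  have nba' : e b1 a = false by rewrite se.
  have /connP[_ h] := conn_del2 b1V aV d4 da b1a nba'.
  have whole (X : {set T}) : part e (B :\ b1) X -> X != set0 -> c1 \notin X -> False.
    move=> pX X0 cX; have [XB hX] := partP _ _ _ pX; have [XB3 hX3] := partP _ _ _ (p3 X pX).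
    have E : X = rem V [:: b1; a].
      apply: h => //; apply/partP; split.
        by apply/subsetP=> y /(subsetP XB3); rewrite !in_rem !inE !negb_or => /andP[/and3P[-> -> _] ->].
      move=> y z yX; rewrite in_rem !inE !negb_or => /andP[/andP[zb1 za] zV] eyz.
      apply: (hX3 y) => //; rewrite in_rem !inE !negb_or zb1 za zV andbT /=; apply/eqP=> zc; subst z.
      by have := dXc X XB cX => /eqP; rewrite cards_eq0 => /eqP/setP/(_ y); rewrite in_nb yX se eyz inE.
    have : x \in X by rewrite E in_rem !inE negb_or (eq_sym x a) ax xV !andbT; apply: contraNneq xB => ->.
    by move/(subsetP XB); rewrite in_setD1 (negPf xB) andbF.
  have [c1P|c1P] := boolP (c1 \in P); last exact: whole P pP P0 c1P.
  by apply: (whole Q pQ Q0); rewrite inE c1P.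
have gH : good e H1 := good_rem Pl_sub _ gV.
have dHb : dg e H1 b = 4.
  have := @dg_rem _ e V [:: a] b isT ltac:(smem).
  by rewrite /deg_to big_cons big_nil se nab db /= !addn0.
have dHb1 : dg e H1 b1 <= 4.
  by apply: leq_trans (dgS e b1 (rem_sub V [:: a])) _; case: (deg34 b1V) => ->.
have sl : slack e H1 10.
  apply: (@twocut_slack _ _ Pl_sub _ IH e H1 B b1 b c1 c 10 gH _ BH cB cHD cBb cHDb) => //.
  - by apply: (@card_rem_le _ a) => //; inseq.
  - by rewrite se.
  - by rewrite se.
  - rewrite dHb; move: d1 dHb1; rewrite -/H1; case: (dg e H1 b1) => [|[|[|[|[|n]]]]] //.
apply: ns; apply: (removal_slack (s := [:: a]) (ds := [:: a]) (ys := [::]) (i := 0) (K := 10) gV) => //.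
- by smem.
- by inner.
- by arith.
Qed.

(** If [b] and [c] meet [B] in the same vertex [u], the rest of [B] hangs on [u] and [a] alone;
    three-edge-connectivity, [conn_del2] and [common_nb] show that it is empty. If they meet it in
    different vertices, [hex_cut] forces both to have degree 3 and to be the neighbours of [a] in
    [B]. Too few edges remain for anything else in [B], and then [b1] has only two neighbours. *)
Lemma hex_single x v p q a b c (B : {set T}) : hex x v p q a b c -> part e (rem V [:: a; b; c]) B ->
  B != set0 -> x \notin B -> dg e B b <= 1 -> dg e B c <= 1 ->
  exists u, [/\ B = [set u], e u a, e u b, e u c & dg e V u = 3].
Proof.
move=> hh pB B0 xB lb lc; have [BR hB] := partP _ _ _ pB.
have [hu [aV bV cV'] [ax bx cx] [epa eqa evb] [eqb evc epc]] := hh.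
have [[xV vV pV qV] [dx dv dp dq] [exv exp exq] [vp vq pq] Nx] := hu.
have [da eva [ab nab av] _] := hex_facts hh.
have [db epb [bc nbc' bp] _] := hex_facts (hex_rot hh).
have [dc eqc [ca nca cq] _] := hex_facts (hex_rot (hex_rot hh)).
have [_ [a0 b0 c0] [a2 _ _]] := hex_coords hh pB B0 xB.
have inB y : y \in B -> [/\ y \in V, y != a, y != b & y != c].
  by move/(subsetP BR); rewrite in_rem !inE !negb_or => /andP[/and3P[]].
have one w : dg e B w <= 1 -> 0 < dg e B w -> exists w1, nb e B w = [set w1].
  by move=> l1 l2; apply/cards1P; rewrite eqn_leq l1.
have [b1 nbb] := one b lb b0; have [c1 nbc] := one c lc c0.
have [b1B eb1] : b1 \in B /\ e b b1.
  by have : b1 \in nb e B b by [rewrite nbb inE]; rewrite in_nb => /andP.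
have [c1B ec1] : c1 \in B /\ e c c1.
  by have : c1 \in nb e B c by [rewrite nbc inE]; rewrite in_nb => /andP.
have isb y : y \in B -> e b y -> y = b1.
  by move=> yB eby; apply/eqP; rewrite -in_set1 -nbb in_nb yB.
have isc y : y \in B -> e c y -> y = c1.
  by move=> yB eby; apply/eqP; rewrite -in_set1 -nbc in_nb yB.
have [b1V b1a b1b b1c] := inB b1 b1B; have [c1V c1a c1b c1c] := inB c1 c1B.
have out y z : y \in B -> z \in V -> z \notin B -> e y z -> z \in [:: a; b; c].
  by move=> yB zV zB eyz; apply: contraR zB => zN; apply: (hB y) => //; rewrite in_rem zN.
have [E|b1c1] := eqVneq b1 c1.
  subst c1; rename b1 into u; exists u; have [E|Bu] := eqVneq (B :\ u) set0.
    have BE : B = [set u] by apply/eqP; rewrite eqEsubset -setD_eq0 E eqxx sub1set.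
    have Nu : nb e V u \subset [set y in [:: a; b; c]].
      apply/subsetP=> y; rewrite in_nb inE => /andP[yV euy]; apply: (out u) => //.
      by rewrite BE inE; apply: contraTneq euy => ->; rewrite ie.
    have Eu : nb e V u = [set y in [:: a; b; c]].
      apply/eqP; rewrite eqEcard Nu; apply: leq_trans (deg_gt2 b1V).
      by rewrite cardsE; apply: card_size.
    have h y : y \in [:: a; b; c] -> e u y.
      by move=> yl; have : y \in nb e V u by [rewrite Eu inE]; rewrite in_nb => /andP[].
    split=> //; try by apply: h; inseq.
    case: (deg34 b1V) => // d4; have := card_size [:: a; b; c].
    by rewrite -cardsE -Eu -/(dg e V u) d4.
  exfalso; have usu : uniq [:: u; a] by rewrite /= inE b1a.
  have sVu : {subset [:: u; a] <= V} by smem.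
  have pBu : part e (rem V [:: u; a]) (B :\ u).
    apply/partP; split.
      apply/subsetP=> y; rewrite in_setD1 in_rem !inE negb_or => /andP[yu yB].
      by have [-> -> _ _] := inB y yB; rewrite yu.
    move=> y z; rewrite in_setD1 in_rem !inE negb_or => /andP[yu yB] /andP[/andP[zu za] zV] eyz.
    rewrite zu; apply: contraT => zB; have := out y z yB zV zB eyz; rewrite !inE (negPf za) /=.
    have ezy : e z y by rewrite se.
    by case/orP=> /eqP E; subst z; [rewrite (isb y yB ezy) eqxx in yu | rewrite (isc y yB ezy) eqxx in yu].
  have := part_cut usu sVu isT pBu Bu; rewrite !big_cons big_nil addn0 => c3.
  have aD : dg e (B :\ u) a + (e a u) <= 2.
    apply: leq_trans a2; rewrite /dg [in X in _ <= X](cardsD1 u) in_nb b1B /= addnC leq_add2l.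
    by apply: subset_leq_card; apply/subsetP=> y; rewrite !inE => /andP[/andP[-> ->] ->].
  have uD : dg e (B :\ u) u + (2 + e a u) <= dg e V u.
    have := @dg_rem _ e V [:: a; b; c] u ltac:(rewrite /= !inE negb_or ab (eq_sym a) ca bc //) ltac:(smem).
    rewrite /deg_to !big_cons big_nil !(se u) eb1 ec1 => <-; rewrite addn0 /= addnA [X in _ <= X]addnA.
    rewrite -!addnA [_ + (1 + 1)]addnC leq_add2r; apply: dgS; apply/subsetP=> y.
    by rewrite in_setD1 => /andP[_ /(subsetP BR)].
  have d34 : dg e V u <= 4 by case: (deg34 b1V) => ->.
  have nau : e a u = false.
    by apply/negP=> h; move: aD uD c3 d34; rewrite h; clear => /=; lia.
  have nua : e u a = false by rewrite se.
  case: (deg34 b1V) => du; last first.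
    have /connP[_ h] := conn_del2 b1V aV du da b1a nua.
    have : x \in B :\ u by rewrite (h _ pBu Bu) in_rem !inE negb_or (eq_sym x a) ax xV !andbT; apply: contraNneq xB => ->.
    by rewrite in_setD1 (negPf xB) andbF.
  have /card_gt0P[d] : 0 < dg e (B :\ u) u by move: c3 aD; clear; lia.
  rewrite in_nb in_setD1 => /andP[/andP[du' dB] eud]; have [dV da' db' dc'] := inB d dB.
  have euc : e u c by rewrite se.
  have eub : e u b by rewrite se.
  have [z [zV zu ebz edz]] := common_nb b1V cV' bV dV du dc euc eub eud ltac:(by rewrite eq_sym) ltac:(by rewrite eq_sym) ltac:(by rewrite eq_sym).
  have [zB|zB] := boolP (z \in B); first by rewrite (isb z zB ebz) eqxx in zu.
  have := out d z dB zV zB edz; rewrite !inE => /or3P[]/eqP E; subst z.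
  - by rewrite se nab in ebz.
  - by rewrite ie in ebz.
  - by rewrite nbc' in ebz.
exfalso.
have Esw : [:: a; c; b] =i [:: a; b; c] by move=> y; rewrite !inE [(y == c) || _]orbC.
have low w w' w1 : w1 \in B -> w \in V -> w' \in V -> w != a -> w != w' -> w' != a -> e w w1 ->
    (dg e (rem V [:: a]) w1 <= 2) -> e w1 a /\ dg e V w1 = 3.
  move=> w1B wV w'V wa ww' w'a ew l; have [w1V _ _ _] := inB w1 w1B.
  have := @dg_rem _ e V [:: a] w1 isT ltac:(smem); rewrite /deg_to big_cons big_nil addn0.
  move: l; case: (deg34 w1V) => ->; case: (e w1 a) => //=; clear => *; lia.
have [l1|l1] := ltnP 2 (dg e (rem V [:: a]) b1).
  exact: (hex_cut hh pB B0 xB nbb nbc b1c1 l1).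
have [l2|l2] := ltnP 2 (dg e (rem V [:: a]) c1).
  have pB' := pB; rewrite -(rem_eq Esw) in pB'.
  by apply: (hex_cut (hex_swap hh) pB' B0 xB nbc nbb _ l2); rewrite eq_sym.
have [eb1a d1] := low b c b1 b1B bV cV' ltac:(by rewrite eq_sym) bc ca eb1 l1.
have [ec1a d2] := low c b c1 c1B cV' bV ca ltac:(by rewrite eq_sym) ltac:(by rewrite eq_sym) ec1 l2.
have NB : nb e B a = [set b1; c1].
  apply/esym/eqP; rewrite eqEcard cards2 b1c1; apply/andP; split=> //.
  by apply/subsetP=> y; rewrite in_nb !inE => /orP[]/eqP->; rewrite ?b1B ?c1B se.
have [nbc1 nbb1] : e b1 c1 = false /\ True by split=> //; apply: (@triangle_freeF _ a) => //; rewrite se.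
pose B2 := B :\: [set b1; c1].
have [B20|B20] := eqVneq B2 set0.
  have := deg_gt2 b1V; rewrite ltnNge => /negP; apply; apply: (@leq_trans #|[set a; b]|); last by rewrite cards2; case: eqP.
  apply/subset_leq_card/subsetP=> y; rewrite in_nb !inE => /andP[yV ey].
  have [yB|yB] := boolP (y \in B).
    have : y \notin B2 by rewrite B20 inE.
    by rewrite !inE yB andbT negbK => /orP[]/eqP E; subst y; rewrite ?ie ?nbc1 in ey.
  have := out b1 y b1B yV yB ey; rewrite !inE => /or3P[-> //|->|/eqP E]; first by rewrite orbT.
  by subst y; rewrite (isc b1 b1B ltac:(by rewrite se)) eqxx in b1c1.
have us2 : uniq [:: b1; c1] by rewrite /= inE b1c1.
have sV2 : {subset [:: b1; c1] <= V} by smem.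
have inB2 y : y \in B2 -> [/\ y \in B, y != b1 & y != c1].
  by rewrite !inE negb_or => /andP[/andP[-> ->] ->].
have pB2 : part e (rem V [:: b1; c1]) B2.
  apply/partP; split.
    apply/subsetP=> y /inB2[yB h1 h2]; rewrite in_rem !inE negb_or h1 h2.
    by have [-> _ _ _] := inB y yB.
  move=> y z /inB2[yB yb1 yc1]; rewrite in_rem !inE negb_or => /andP[/andP[zb1 zc1] zV] eyz.
  rewrite zb1 zc1 /=; apply: contraT => zB; have ezy : e z y by rewrite se.
  have := out y z yB zV zB eyz; rewrite !inE => /or3P[]/eqP E; subst z.
  - have : y \in nb e B a by rewrite in_nb yB.
    by rewrite NB !inE (negPf yb1) (negPf yc1).
  - by rewrite (isb y yB ezy) eqxx in yb1.
  - by rewrite (isc y yB ezy) eqxx in yc1.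
have := part_cut us2 sV2 isT pB2 B20; rewrite !big_cons big_nil addn0.
have low2 w w1 : w1 \in B -> w \in V -> w != a -> e w w1 -> e w1 a -> dg e V w1 = 3 ->
    w \notin B -> dg e B2 w1 <= 1.
  move=> w1B wV wa ew ewa d wB; have [w1V _ _ _] := inB w1 w1B.
  have := @dg_rem _ e V [:: a; w] w1 ltac:(by rewrite /= inE eq_sym wa) ltac:(smem).
  rewrite /deg_to !big_cons big_nil ewa se ew d.
  have : dg e B2 w1 <= dg e (rem V [:: a; w]) w1.
    apply: dgS; apply/subsetP=> y /inB2[yB _ _]; have [yV ya _ _] := inB y yB.
    rewrite in_rem !inE negb_or ya yV andbT; by apply: contraTneq yB => ->.
  by clear => /=; lia.
have h1 := low2 b b1 b1B bV ltac:(by rewrite eq_sym) eb1 eb1a d1 ltac:(by apply/negP=> /inB[_ _]; rewrite eqxx).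
have h2 := low2 c c1 c1B cV' ca ec1 ec1a d2 ltac:(by apply/negP=> /inB[_ _ _]; rewrite eqxx).
by move: h1 h2; clear; lia.
Qed.

(** With [a], [b], [c] deleted, [v] and [p] keep only [x] and one outer neighbour each, so both can
    be suppressed towards [x]. Uniqueness of [a], [b], [c] as common neighbours rules out the
    blocking 4-cycles, apart from an edge between [v'] and [p']. *)
Lemma hex_sup22 x v p q a b c v' p' (s : seq T) : hex x v p q a b c -> a \in s -> b \in s -> c \in s ->
  v \notin s -> p \notin s -> q \notin s -> x \notin s -> v' \notin s -> p' \notin s ->
  v' \in V -> p' \in V -> e v v' -> e p p' -> v' != x -> p' != x -> e v' p' = false ->
  conn e (rem V s) -> slack e (rem V s) 22.
Proof.
move=> hh sa sb sc sv sp sq sx sv' sp' v'V p'V evv' epp' v'x p'x nv'p' cR.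
have [hu [aV bV cV'] [ax bx cx] [epa eqa evb] [eqb evc epc]] := hh.
have [[xV vV pV qV] [dx dv dp dq] [exv exp exq] [vp vq pq] Nx] := hu.
have [da eva [ab nab av] Ua] := hex_facts hh.
have [db epb [bc nbc' bp] Ub] := hex_facts (hex_rot hh).
have [dc eqc [ca nca cq] Uc] := hex_facts (hex_rot (hex_rot hh)).
have nin y w : y \notin s -> w \in s -> w != y by move=> ys ws; apply: contraNneq ys => <-.
symm.
have Nv := cov4 dv xV bV cV' v'V ltac:(done) evb evc evv' ltac:(neq) ltac:(neq) ltac:(neq) bc (nin _ _ sv' sb) (nin _ _ sv' sc).
have Np := cov4 dp xV aV cV' p'V ltac:(done) epa epc epp' ltac:(neq) ltac:(neq) ltac:(neq) ltac:(neq) (nin _ _ sp' sa) (nin _ _ sp' sc).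
have nvp' : e v p' = false.
  by apply/negP=> h; move: sp'; rewrite (Uc p' p'V p'x h epp') sc.
have npv' : e p v' = false.
  by apply/negP=> h; move: sv'; rewrite (Uc v' v'V v'x evv' h) sc.
have nqv' : e q v' = false.
  by apply/negP=> h; move: sv'; rewrite (Ub v' v'V v'x h evv') sb.
have nqp' : e q p' = false.
  by apply/negP=> h; move: sp'; rewrite (Ua p' p'V p'x epp' h) sa.
symm.
apply: (@suppress_two_slack _ _ Pl_sup _ IH _ _ x v v' p p') => //; rewrite ?in_rem ?sv ?sp ?sx ?sv' ?sp' //; try neq.
- exact: good_rem.
- exact: (@card_rem_le _ a).
- move=> u; rewrite in_rem => /andP[us uV] /(Nv u uV)[E|E|E|E]; auto; by rewrite E ?sb ?sc in us.
- move=> u; rewrite in_rem => /andP[us uV] /(Np u uV)[E|E|E|E]; auto; by rewrite E ?sa ?sc in us.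
- move=> u; rewrite in_rem => /andP[us uV] uv /(Nx u uV)[E|E|E]; rewrite E ?eqxx // in uv *.
    by rewrite se npv'.
  by rewrite se nqv'.
- move=> u; rewrite in_rem => /andP[us uV] uv /(Nx u uV)[E|E|E]; rewrite E ?eqxx // in uv *.
    by rewrite se nvp'.
  by rewrite se nqp'.
- by rewrite nv'p'.
Qed.

(** Choosing [a], [b], [c] frees [3 * 44]; [v], [p], [q] drop to degree two for 9, and two
    suppressions add 22: one more than the 162 needed. A vertex of [l], isolated by the deletion,
    contributes [34 - 30]. *)
Lemma hex_fin x v p q a b c (l : seq T) : hex x v p q a b c -> uniq l -> size l <= 2 ->
  (forall u, u \in l -> [/\ u \in V, dg e V u = 3, e u a, e u b & e u c]) ->
  conn e (rem V ([:: a; b; c] ++ l)) -> False.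
Proof.
move=> hh ul sl hl cR; set s := [:: a; b; c] ++ l in cR *.
have [hu [aV bV cV'] [ax bx cx] [epa eqa evb] [eqb evc epc]] := hh.
have [[xV vV pV qV] [dx dv dp dq] [exv exp exq] [vp vq pq] Nx] := hu.
have [da eva [ab nab av] Ua] := hex_facts hh.
have [db epb [bc nbc' bp] Ub] := hex_facts (hex_rot hh).
have [dc eqc [ca nca cq] Uc] := hex_facts (hex_rot (hex_rot hh)).
symm.
have [v' [[v'V evv' [xv' bv' cv']] Nv]] := nb4 dv xV bV cV' ltac:(done) evb evc ltac:(neq) ltac:(neq) bc.
have [p' [[p'V epp' [xp' ap' cp']] Np]] := nb4 dp xV aV cV' ltac:(done) epa epc ltac:(neq) ltac:(neq) ltac:(neq).
have [q' [[q'V eqq' [xq' aq' bq']] Nq]] := nb4 dq xV aV bV ltac:(done) eqa eqb ltac:(neq) ltac:(neq) ab.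
symm.
have lu u z : u \in l -> z \in V -> e u z -> [\/ z = a, z = b | z = c].
  by move=> /hl[uV du ua ub uc]; apply: cov3 => //; neq.
have nl y z : z \in l -> y \in V -> y != a -> y != b -> y != c -> e y z = false.
  move=> zl yV ya yb yc; apply/negP; rewrite se => /(lu z y zl yV).
  by case=> E; rewrite E eqxx in ya yb yc.
have nls y y' : y \in V -> e y y' -> y != a -> y != b -> y != c -> y' != a -> y' != b -> y' != c -> y' \notin s.
  move=> yV eyy' ya yb yc y'a y'b y'c; rewrite mem_cat !inE !negb_or y'a y'b y'c /=.
  by apply/negP=> h; rewrite (nl y y') in eyy'.
have vs : v \notin s by apply: (nls x v) => //; neq.
have ps : p \notin s by apply: (nls x p) => //; neq.
have qs : q \notin s by apply: (nls x q) => //; neq.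
have xs : x \notin s by apply: (nls v x) => //; neq.
have v's : v' \notin s by apply: (nls v v') => //; neq.
have p's : p' \notin s by apply: (nls p p') => //; neq.
have q's : q' \notin s by apply: (nls q q') => //; neq.
have [as' bs' cs'] : [/\ a \in s, b \in s & c \in s] by rewrite /s !inE !eqxx !orbT.
(* The outer neighbours [v'], [p'], [q'] do not form a triangle, so two of them are not adjacent and
   their inner partners can be suppressed. *)
have S : slack e (rem V s) 22.
  have [h1|n1] := boolP (e v' p'); last first.
    by apply: (hex_sup22 (v' := v') (p' := p') hh) => //; try neq; exact: negPf.
  have [h2|n2] := boolP (e p' q'); last first.
    by apply: (hex_sup22 (v' := p') (p' := q') (hex_rot hh)) => //; try neq; exact: negPf.
  have h3 : e q' v' = false by rewrite se; apply: (@triangle_freeF _ p').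
  by apply: (hex_sup22 (v' := q') (p' := v') (hex_rot (hex_rot hh))) => //; neq.
have lV u : u \in l -> u \in V by case/hl.
have sV : {subset s <= V}.
  by move=> u; rewrite mem_cat => /orP[|/lV //]; move: u; smem.
have us : uniq s.
  rewrite cat_uniq ul andbT /= !inE !negb_or ab bc (eq_sym a c) ca /=.
  apply/hasPn=> u /hl[uV du ua ub uc]; rewrite !inE !negb_or; spl.
have bv : bonus (dg e V v) (deg_to e s v) by apply: (bonus_deg4 (w1 := b) (w2 := c)).
have bpp : bonus (dg e V p) (deg_to e s p) by apply: (bonus_deg4 (w1 := a) (w2 := c)) => //; neq.
have bqq : bonus (dg e V q) (deg_to e s q) by apply: (bonus_deg4 (w1 := a) (w2 := b)).
apply: ns.
apply: (removal_slack (s := s) (ds := [:: a; b; c]) (ys := [:: v; p; q]) (i := 6 * size l) (K := 22) gV) => //.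
- by suniq.
- by apply/allP; rewrite /= vV vs bv pV ps bpp qV qs bqq.
- move=> A AV cA hA u; rewrite mem_cat => /orP[/hA //|ul'].
  apply: (leaf_notin (y := u) cA AV) => z zV /(lu u z ul' zV) E zA.
  by case: E => E; move: (hA z); rewrite zA E !inE eqxx ?orbT => /(_ isT).
- rewrite /s; case: l ul sl hl nl {lu nls cR vs ps qs xs v's p's q's as' bs' cs' S lV sV us bv bpp bqq s} => [|u1 [|u2 [|//]]] ul sl hl nl.
  + by inner.
  + by have [u1V _ u1a u1b u1c] := hl u1 (mem_head _ _); symm; inner.
  + have [u1V _ u1a u1b u1c] := hl u1 (mem_head _ _).
    have [u2V _ u2a u2b u2c] := hl u2 ltac:(inseq).
    have n12 : e u1 u2 = false by apply: (nl u1 u2); [inseq | done | neq..].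
    by symm; inner.
- rewrite /s big_cat /= !big_cons big_nil da db dc.
  have -> : \sum_(u <- l) (wgt (dg e V u) + 5 * dg e V u) = 34 * size l.
    rewrite (eq_big_seq (fun _ => 34)) ?big_const_seq ?count_predT ?iter_addn_0 //.
    by move=> u /hl[_ -> _ _ _].
  by clear => /=; lia.
Qed.

(** Only [b] and [c] are chosen: [88 + 3] with the bonus at [v], which is then suppressed for 11.
    The missing 6 come from [del_conn] applied to [a] in the suppressed graph: its surplus is 10,
    and its alternative, connectivity after deleting [a], contradicts the assumption that the three
    vertices disconnect. *)
Lemma hex_del x v p q a b c : hex x v p q a b c -> ~~ conn e (rem V [:: a; b; c]) ->
  (forall B : {set T}, part e (rem V [:: a; b; c]) B -> B != set0 -> x \notin B -> 1 < dg e B a) -> False.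
Proof.
move=> hh nc hB.
have [hu [aV bV cV'] [ax bx cx] [epa eqa evb] [eqb evc epc]] := hh.
have [[xV vV pV qV] [dx dv dp dq] [exv exp exq] [vp vq pq] Nx] := hu.
have [da eva [ab nab av] Ua] := hex_facts hh.
have [db epb [bc nbc' bp] Ub] := hex_facts (hex_rot hh).
have [dc eqc [ca nca cq] Uc] := hex_facts (hex_rot (hex_rot hh)).
have [xR vR pR qR] := in_hex hh.
symm.
have [v' [[v'V evv' [xv' bv' cv']] Nv]] := nb4 dv xV bV cV' ltac:(done) evb evc ltac:(neq) ltac:(neq) bc.
pose Z := rem V [:: b; c].
have inZ y : y \in rem V [:: a; b; c] -> y \in Z.
  by rewrite !in_rem !inE !negb_or => /andP[/and3P[_ -> ->] ->].
have gZ : good e Z := good_rem Pl_sub _ gV.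
have cZ : conn e Z := conn_del2 bV cV' db dc bc ltac:(done).
have ZN : #|Z| <= N by apply: (@card_rem_le _ b) => //; inseq.
have v'Z : v' \in Z by rewrite in_rem !inE negb_or; spl.
have NvZ z : z \in Z -> e v z -> z = x \/ z = v'.
  rewrite in_rem !inE negb_or => /andP[/andP[zb zc] zV] /(Nv z zV)[]E; auto;
  by rewrite E eqxx in zb zc.
have npv' : e p v' = false.
  by apply/negP=> h; have := Uc v' v'V ltac:(neq) evv' h => /eqP; rewrite eq_sym (negPf cv').
have nqv' : e q v' = false.
  by apply/negP=> h; have := Ub v' v'V ltac:(neq) h evv' => /eqP; rewrite eq_sym (negPf bv').
have com z : z \in Z -> z != v -> e x z -> e v' z -> False.
  rewrite in_rem => /andP[_ zV] zv /(Nx z zV)[]E; rewrite E ?eqxx // in zv *; by rewrite se ?npv' ?nqv'.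
have evx : e v x by rewrite se.
have [g' c' _ _] := suppress_spec Pl_sup gZ cZ (inZ v vR) (inZ x xR) v'Z xv' evx evv' NvZ com.
set e' := add_edge e x v' in g' c'; set Z' := Z :\ v in g' c'.
have ee' y z : e y z -> e' y z by rewrite /e' /add_edge => ->.
have aZ' : a \in Z' by rewrite in_setD1 av in_rem !inE negb_or ab eq_sym ca.
have xa : x != a by rewrite eq_sym.
have Z'a y : (y \in Z' :\ a) = (y \in rem V [:: a; b; c]) && (y != v).
  by rewrite !in_setD1 !in_rem !inE !negb_or; case: (y != a); case: (y != b); case: (y != c); case: (y != v); rewrite ?andbT ?andbF.
have Z'N : #|Z'| < N.
  by apply: leq_trans ZN; rewrite [X in _ < X](cardsD1 v) (inZ v vR).
have xZ' : x \in Z' :\ a by rewrite Z'a xR /=; neq.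
have R0 : rem V [:: a; b; c] != set0 by apply/set0Pn; exists x.
have h2 (P : {set T}) : part e' (Z' :\ a) P -> P != set0 -> 1 < dg e' P a.
  move=> /partP[PZ hP] P0; have [xP|xP] := boolP (x \in P).
    have pP : p \in P by apply: (hP x); rewrite ?ee' // Z'a pR /=; neq.
    have qP : q \in P by apply: (hP x); rewrite ?ee' // Z'a qR /=; neq.
    by apply: (@dg_ge _ e' P a [:: p; q]); rewrite /= ?inE ?pq // pP qP !ee'.
  have v'P : v' \notin P.
    apply: contra xP => v'P; apply: (hP v') => //.
    by rewrite /e' /add_edge !eqxx !orbT.
  apply: (@leq_trans (dg e P a)); last first.
    by apply/subset_leq_card/subsetP=> y; rewrite !in_nb => /andP[-> /ee' ->].
  apply: hB => //; apply/partP; split; first by apply/subsetP=> y /(subsetP PZ); rewrite Z'a => /andP[].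
  move=> y z yP zR eyz; apply: (hP y); rewrite ?ee' // Z'a zR; apply/eqP=> E; subst z.
  have yZ : y \in Z by apply: inZ; have := subsetP PZ y yP; rewrite Z'a => /andP[].
  by case: (NvZ y yZ ltac:(by rewrite se)) => E; rewrite -?E ?yP // in xP v'P.
have Z'1 : 1 < #|Z'|.
  by rewrite (cardsD1 a) aZ' ltnS card_gt0; apply/set0Pn; exists x.
case: (@del_conn _ _ Pl_sub _ IH e' Z' a g' c' (ltnW Z'N) aZ' Z'1 h2) => [c2|sl].
  have [B [pB B0 xB]] := nconn_avoid x R0 nc.
  have [[vB _ _] _ _] := hex_coords hh pB B0 xB; have [BR hB'] := partP _ _ _ pB.
  have v'B : v' \notin B.
    by apply: contra vB => v'B; apply: (hB' v') => //; rewrite se.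
  have /connP[_ h] := c2; have E : B = Z' :\ a; last by rewrite E xZ' in xB.
  apply: h => //; apply/partP; split.
    apply/subsetP=> y yB; rewrite Z'a (subsetP BR y yB).
    by apply: contraNneq vB => <-.
  move=> y z yB; rewrite Z'a => /andP[zR zv]; rewrite /e' /add_edge => /or3P[eyz|/andP[/eqP E _]|/andP[/eqP E _]].
  - exact: (hB' y).
  - by rewrite -E yB in xB.
  - by rewrite -E yB in v'B.
have S : slack e Z (10 + 11).
  exact: (suppress_slackD Pl_sup gZ cZ (inZ v vR) (inZ x xR) v'Z xv' evx evv' NvZ com).
have bv : bonus (dg e V v) (deg_to e [:: b; c] v) by apply: (bonus_deg4 (w1 := b) (w2 := c)) => //; inseq.
apply: ns.
apply: (removal_slack (s := [:: b; c]) (ds := [:: b; c]) (ys := [:: v]) (i := 0) (K := 10 + 11) gV) => //.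
- by rewrite /= inE bc.
- by smem.
- by sys.
- by inner.
- by arith.
Qed.

(** Each of [a], [b], [c] has an edge to every component avoiding [x], and at most two to all of
    them together, since [hex_coords] also holds for unions. Components with few edges are single
    vertices and are stripped, at most two of them; without such a component only one avoids [x],
    and [hex_del] applies. *)
Lemma no_hex x v p q a b c : hex x v p q a b c -> False.
Proof.
move=> hh; have [hu [aV bV cV'] [ax bx cx] [epa eqa evb] [eqb evc epc]] := hh.
have [[xV vV pV qV] [dx dv dp dq] [exv exp exq] [vp vq pq] Nx] := hu.
have [da eva [ab nab av] Ua] := hex_facts hh.
have [xR vR pR qR] := in_hex hh.
have E1 : [:: b; c; a] =i [:: a; b; c] by move=> y; rewrite !inE orbA orbC.
have E2 : [:: c; a; b] =i [:: a; b; c] by move=> y; rewrite !inE orbC orbA.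
set R := rem V [:: a; b; c] in xR vR pR qR.
have [cR|nc] := boolP (conn e R); first exact: (hex_fin (l := [::]) hh).
have R0 : R != set0 by apply/set0Pn; exists x.
(* Two of the three vertices send at most one edge each: the hypothesis of [hex_single] up to
   rotation. *)
pose low2 (B : {set T}) := [|| (dg e B b <= 1) && (dg e B c <= 1), (dg e B c <= 1) && (dg e B a <= 1) |
                  (dg e B a <= 1) && (dg e B b <= 1)].
have single (B : {set T}) : part e R B -> B != set0 -> x \notin B -> low2 B ->
    exists u, [/\ B = [set u], e u a, e u b, e u c & dg e V u = 3].
  move=> pB B0 xB /or3P[]/andP[l1 l2].
  - exact: (hex_single hh pB B0 xB l1 l2).
  - have pB1 := pB; rewrite /R -(rem_eq E1) in pB1.
    by have [u [? ? ? ? ?]] := hex_single (hex_rot hh) pB1 B0 xB l1 l2; exists u.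
  - have pB1 := pB; rewrite /R -(rem_eq E2) in pB1.
    by have [u [? ? ? ? ?]] := hex_single (hex_rot (hex_rot hh)) pB1 B0 xB l1 l2; exists u.
have [/existsP[B /and4P[pB B0 xB lB]]|nl] :=
    boolP [exists B : {set T}, [&& part e R B, B != set0, x \notin B & low2 B]].
  have [u [BE ua ub uc du]] := single B pB B0 xB lB.
  have [BR hB] := partP _ _ _ pB.
  have uR : u \in R by apply: (subsetP BR); rewrite BE inE.
  have uV : u \in V by move: uR; rewrite in_rem => /andP[].
  have ux : u != x by apply: contraNneq xB => <-; rewrite BE inE.
  have uu : [/\ u \in V, dg e V u = 3, e u a, e u b & e u c] by [].
  have RE (l : seq T) : rem V ([:: a; b; c] ++ l) = rem R l by rewrite rem_cat.
  have iso (y w : T) : y \in R -> w \in R -> [/\ w \in V, dg e V w = 3, e w a, e w b & e w c] -> e y w = false.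
    move=> yR wR [wV dw wa wb wc]; apply/negP; rewrite se => ewy.
    have [db epb [bc nbc' bp] Ub] := hex_facts (hex_rot hh).
    have [dc eqc [ca nca cq] Uc] := hex_facts (hex_rot (hex_rot hh)).
    move: yR; rewrite in_rem !inE !negb_or => /andP[/and3P[ya yb yc] yV].
    have := cov3 dw aV bV cV' wa wb wc ab ltac:(by rewrite eq_sym) bc yV ewy.
    by case=> E; rewrite E eqxx in ya yb yc.
  (* A part avoiding [x] after the removal of isolated vertices is still a part of [R]. *)
  have lift (l : seq T) (P : {set T}) : (forall w, w \in l -> w \in R /\ [/\ w \in V, dg e V w = 3, e w a, e w b & e w c]) ->
      part e (rem R l) P -> part e R P.
    move=> hl /partP[PR hP]; apply/partP; split; first exact: subset_trans PR (rem_sub _ _).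
    move=> y z yP zR eyz; apply: (hP y) => //; rewrite in_rem zR andbT; apply/negP=> /hl[_ hz].
    by rewrite (iso y z) // in eyz; have := subsetP PR y yP; rewrite in_rem => /andP[].
  (* The stripped vertices of [l] and [P] together form one part of [R], so the bound of two edges
     covers both. *)
  have cnt (l : seq T) (P : {set T}) w : uniq l -> P \subset rem R l -> w \in [:: a; b; c] ->
      (forall y, y \in l -> y \in R /\ [/\ y \in V, dg e V y = 3, e y a, e y b & e y c]) ->
      x \notin P -> part e (rem R l) P -> P != set0 -> dg e P w + size l <= 2.
    move=> ul PR wl hl xP pP P0; have pPR := lift l P hl pP.
    pose U := P :|: [set y in l].
    have pU : part e R U.
      apply/partP; split.
        rewrite subUset (subset_trans PR (rem_sub _ _)) /=.
        by apply/subsetP=> y; rewrite inE => /hl[].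
      move=> y z yU zR eyz; apply/setUP; case/setUP: yU => [yP|].
        by left; have [_ h] := partP _ _ _ pPR; apply: (h y).
      by rewrite inE => yl; have [yR hy] := hl y yl; rewrite se (iso z y zR yR hy) in eyz.
    have U0 : U != set0 by case/set0Pn: P0 => y yP; apply/set0Pn; exists y; rewrite inE yP.
    have xl : x \notin l.
      apply/negP=> /hl[_ [_ _ xa _ _]]; have := @triangle_freeF x p a xV pV aV exp epa.
      by rewrite xa.
    have xU : x \notin U by rewrite !inE negb_or xP.
    have [_ _ [h1 h2 h3]] := hex_coords hh pU U0 xU.
    have hw : dg e U w <= 2 by move: wl; rewrite !inE => /or3P[]/eqP->.
    apply: leq_trans hw; have -> : size l = dg e [set y in l] w.
      rewrite dg_set // /deg_to (eq_big_seq (fun _ => 1)) ?sum1_size // => y /hl[_ [_ _ ya yb yc]].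
      by move: wl; rewrite se !inE => /or3P[]/eqP->; rewrite ?ya ?yb ?yc.
    apply: dg_sub2; rewrite ?subsetUl ?subsetUr // -setI_eq0; apply/eqP/setP=> y; rewrite !inE.
    by apply/andP=> -[/(subsetP PR)]; rewrite in_rem => /andP[/negPf->].
  have hl1 w : w \in [:: u] -> w \in R /\ [/\ w \in V, dg e V w = 3, e w a, e w b & e w c].
    by rewrite inE => /eqP->.
  have [c1|nc1] := boolP (conn e (rem R [:: u])).
    by apply: (hex_fin (l := [:: u]) hh) => //; [move=> w /hl1[] | rewrite RE].
  have R10 : rem R [:: u] != set0 by apply/set0Pn; exists x; rewrite in_rem inE eq_sym ux.
  have [P [pP P0 xP]] := nconn_avoid x R10 nc1; have [PR _] := partP _ _ _ pP.
  have lP : low2 P.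
    have hw w : w \in [:: a; b; c] -> dg e P w <= 1.
      by move=> wl; have := cnt [:: u] P w isT PR wl hl1 xP pP P0; rewrite addn1 ltnS.
    by rewrite /low2 (hw b) ?(hw c); inseq.
  have [u2 [PE u2a u2b u2c du2]] := single P (lift _ _ hl1 pP) P0 xP lP.
  have u2P : u2 \in P by rewrite PE inE.
  have := subsetP PR u2 u2P; rewrite in_rem inE => /andP[u2u u2R].
  have u2V : u2 \in V by move: u2R; rewrite in_rem => /andP[].
  have hl2 w : w \in [:: u; u2] -> w \in R /\ [/\ w \in V, dg e V w = 3, e w a, e w b & e w c].
    by rewrite in_cons mem_seq1 => /orP[]/eqP->.
  have ul2 : uniq [:: u; u2] by rewrite /= inE eq_sym u2u.
  have [c2|nc2] := boolP (conn e (rem R [:: u; u2])).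
    by apply: (hex_fin (l := [:: u; u2]) hh) => //; [move=> w /hl2[] | rewrite RE].
  have R20 : rem R [:: u; u2] != set0.
    by apply/set0Pn; exists x; rewrite in_rem xR andbT in_cons mem_seq1 negb_or eq_sym ux; apply: contraNneq xP => ->.
  have [Q [pQ Q0 xQ]] := nconn_avoid x R20 nc2; have [QR _] := partP _ _ _ pQ.
  have := cnt _ _ a ul2 QR ltac:(inseq) hl2 xQ pQ Q0.
  have [_ [a0 _ _] _] := hex_coords hh (lift _ _ hl2 pQ) Q0 xQ.
  by move: a0; clear => /=; lia.
have many (B : {set T}) : part e R B -> B != set0 -> x \notin B -> low2 B = false.
  by move=> pB B0 xB; apply: contraNF nl => l; apply/existsP; exists B; rewrite pB B0 xB.
have [B [pB B0 xB]] := nconn_avoid x R0 nc.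
have big (P : {set T}) : part e R P -> P != set0 -> x \notin P -> 5 <= dg e P a + dg e P b + dg e P c.
  move=> pP P0 xP; have := many P pP P0 xP; have [_ [h1 h2 h3] _] := hex_coords hh pP P0 xP.
  by rewrite /low2; move: h1 h2 h3; clear; lia.
(* By [big] each such part takes at least five of the at most six edges, so two disjoint ones do not
   fit. *)
have uniqB (P : {set T}) : part e R P -> P != set0 -> x \notin P -> P = B.
  move=> pP P0 xP.
  have two (X Y : {set T}) : part e R X -> part e R Y -> x \notin X -> x \notin Y -> [disjoint X & Y] ->
      X != set0 -> Y != set0 -> False.
    move=> pX pY xX xY dXY X0 Y0; have b1 := big X pX X0 xX; have b2 := big Y pY Y0 xY.
    have pU : part e R (X :|: Y).
      have [XR hX] := partP _ _ _ pX; have [YR hY] := partP _ _ _ pY; apply/partP; split.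
        by rewrite subUset XR.
      by move=> y z yU zR eyz; apply/setUP; case/setUP: yU => [yX|yY]; [left; apply: (hX y) | right; apply: (hY y)].
    have U0 : X :|: Y != set0 by case/set0Pn: X0 => y yX; apply/set0Pn; exists y; rewrite inE yX.
    have xU : x \notin X :|: Y by rewrite !inE negb_or xX.
    have [_ _ [h1 h2 h3]] := hex_coords hh pU U0 xU.
    have d w : dg e X w + dg e Y w <= dg e (X :|: Y) w by apply: dg_sub2; rewrite ?subsetUl ?subsetUr.
    by move: (d a) (d b) (d c) b1 b2 h1 h2 h3; clear; lia.
  have key (X Y : {set T}) : part e R X -> x \notin X -> part e R Y -> x \notin Y -> Y != set0 -> X \subset Y.
    move=> pX xX pY xY Y0; rewrite -setD_eq0; apply: contraT => D0; exfalso.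
    apply: (two (X :\: Y) Y) => //.
    - have -> : X :\: Y = X :&: (R :\: Y).
        by have [XR _] := partP _ _ _ pX; rewrite setIDA (setIidPl XR).
      by apply: partI => //; apply: partD.
    - by rewrite in_setD negb_and xX orbT.
    - by rewrite -setI_eq0; apply/eqP/setP=> y; rewrite in_setI in_setD in_set0; case: (y \in Y); rewrite ?andbF.
  by apply/eqP; rewrite eqEsubset !key.
have fin (w : T) : 1 < dg e B w -> forall P : {set T}, part e R P -> P != set0 -> x \notin P -> 1 < dg e P w.
  by move=> h P pP P0 xP; rewrite (uniqB P).
have [|la] := ltnP 1 (dg e B a); first by move/fin; apply: hex_del hh nc.
have [|lb] := ltnP 1 (dg e B b).
  by move/fin => h; apply: (hex_del (hex_rot hh)); rewrite (rem_eq E1).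
by have := many B pB B0 xB; rewrite /low2 la lb !orbT.
Qed.

Lemma no_hub x v p q : hub x v p q -> False.
Proof.
move=> hu; have [c [[cV' cx evc epc] _]] := hub_common hu.
have [a [[aV ax epa eqa] _]] := hub_common (hub_rot hu).
have [b [[bV bx eqb evb] _]] := hub_common (hub_rot (hub_rot hu)).
exact: (@no_hex x v p q a b c).
Qed.

Lemma no_mixed x v : x \in V -> v \in V -> e x v -> dg e V x = 3 -> dg e V v = 4 -> False.
Proof.
by move=> xV vV exv dx dv; have [p [q]] := hub_of xV vV dx dv exv; apply: no_hub.
Qed.

(** The cubic analogue of [common_nb]: deleting [v] frees only 34, but all three of its neighbours
    fall to degree two, and [34 + 9 + 11] is exactly 54. *)
Lemma cubic_common_nb x v p q : (forall y, y \in V -> dg e V y = 3) -> x \in V -> v \in V -> p \in V -> q \in V ->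
  e x v -> e x p -> e x q -> v != p -> v != q -> p != q ->
  exists r, [/\ r \in V, r != x, e p r & e q r].
Proof.
move=> d3 xV vV pV qV exv exp exq vp vq pq; have dx := d3 x xV; have dv := d3 v vV.
have cx := cov3 dx vV pV qV exv exp exq vp vq pq.
have [/existsP[r /and4P[]]|nh] := boolP [exists r, [&& r \in V, r != x, e p r & e q r]].
  by move=> *; exists r.
exfalso; apply: ns; symm.
have [y [z [[yV zV evy evz] [[xy xz yz] _]]]] := nb3a dv xV ltac:(done).
symm; have bx : bonus (dg e V x) (deg_to e [:: v] x) by apply: (bonus_deg3 (w := v)) => //; inseq.
have bY : bonus (dg e V y) (deg_to e [:: v] y) by apply: (bonus_deg3 (w := v)) => //; [exact: d3 | inseq].
have bz : bonus (dg e V z) (deg_to e [:: v] z) by apply: (bonus_deg3 (w := v)) => //; [exact: d3 | inseq].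
apply: (removal_slack (s := [:: v]) (ds := [:: v]) (ys := [:: x; y; z]) (i := 0) (K := 11) gV) => //.
- by smem.
- by suniq.
- by sys.
- apply: (@suppress_slack _ _ Pl_sup _ IH _ _ x p q) => //; rewrite ?in_rem ?inE.
  + exact: good_rem.
  + exact: conn1.
  + by apply: (@card_rem_le _ v) => //; inseq.
  + by spl.
  + by spl.
  + by spl.
  + move=> u; rewrite in_rem inE => /andP[uv uV] /(cx u uV)[E|E|E]; auto.
    by rewrite E eqxx in uv.
  + move=> u; rewrite in_rem inE => /andP[uv uV] ux pu qu; case/negP: nh; apply/existsP; exists u.
    by rewrite uV ux pu.
- by inner.
- by arith.
Qed.

(** Any two neighbours of a vertex have a second common neighbour. One shared by all three would
    give a [K_{2,3}], which also disposes of [K_{3,3}]; otherwise the second neighbours close up to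
    the cube, where [54 * 3 = 8 * 19 + 10]. *)
Lemma no_cubic x : x \in V -> (forall y, y \in V -> dg e V y = 3) -> False.
Proof.
move=> xV d3.
have [a [b [[aV bV exa exb ab] _]]] : exists a b, [/\ a \in V, b \in V, e x a, e x b & a != b] /\ true.
  have [a [aV ea _]] : exists z, [/\ z \in V, e x z & z \notin [::]] by apply: extend; rewrite d3.
  have [b [bV eb]] : exists z, [/\ z \in V, e x z & z \notin [:: a]] by apply: extend; rewrite d3.
  by rewrite inE eq_sym => ab; exists a, b.
have dx := d3 x xV; have da := d3 a aV; have db := d3 b bV.
have [c [[cV' exc ac bc] cx]] := nb3 dx aV bV exa exb ab; have dc := d3 c cV'.
have [r [rV rx ear ebr]] := cubic_common_nb d3 xV cV' aV bV exc exa exb ltac:(by rewrite eq_sym) ltac:(by rewrite eq_sym) ab.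
have [s' [sV sx eas ecs]] := cubic_common_nb d3 xV bV aV cV' exb exa exc ltac:(by rewrite eq_sym) bc ac.
have [t [tV tx ebt ect]] := cubic_common_nb d3 xV aV bV cV' exa exb exc ab ac bc.
symm; have k23 z : z \in V -> z != x -> e a z -> e b z -> e c z -> False.
  move=> zV zx az bz cz; apply: (@no_K23 x z a b c) => //; rewrite ?d3 // ?(se z) //; neq.
have rs : r != s' by apply/eqP=> E; apply: (k23 r) => //; rewrite E.
have rt : r != t by apply/eqP=> E; apply: (k23 r) => //; rewrite E.
have st : s' != t by apply/eqP=> E; apply: (k23 t) => //; rewrite -E.
have ca := cov3 da xV rV sV ltac:(done) ear eas ltac:(neq) ltac:(neq) rs.
have cb := cov3 db xV rV tV ltac:(done) ebr ebt ltac:(neq) ltac:(neq) rt.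
have cc := cov3 dc xV sV tV ltac:(done) ecs ect ltac:(neq) ltac:(neq) st.
have [y [[yV ery ay by'] cr]] := nb3 (d3 r rV) aV bV ltac:(done) ltac:(done) ab.
have esy : e s' y.
  have [z [zV za erz esz]] := cubic_common_nb d3 aV xV rV sV ltac:(done) ear eas ltac:(neq) ltac:(neq) rs.
  case: (cr z zV erz) => E; subst z => //; first by rewrite eqxx in za.
  have ebs : e b s' by rewrite se.
  by case: (cb s' sV ebs) => E; [rewrite E eqxx in sx | rewrite E eqxx in rs | rewrite E eqxx in st].
have ety : e t y.
  have [z [zV zb erz etz]] := cubic_common_nb d3 bV xV rV tV ltac:(done) ebr ebt ltac:(neq) ltac:(neq) rt.
  case: (cr z zV erz) => E; subst z => //; last by rewrite eqxx in zb.
  have eat : e a t by rewrite se.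
  by case: (ca t tV eat) => E; [rewrite E eqxx in tx | rewrite E eqxx in rt | rewrite E eqxx in st].
sat.
have nat : e a t = false.
  by apply/negP=> /(ca _ tV)[]E; [rewrite E eqxx in tx | rewrite E eqxx in rt | rewrite E eqxx in st].
have nbs : e b s' = false.
  by apply/negP=> /(cb _ sV)[]E; [rewrite E eqxx in sx | rewrite E eqxx in rs | rewrite E eqxx in st].
have ncr : e c r = false.
  by apply/negP=> /(cc _ rV)[]E; [rewrite E eqxx in rx | rewrite E eqxx in rs | rewrite E eqxx in rt].
symm; have cy' : c != y by neq.
have cs := cov3 (d3 s' sV) aV cV' yV ltac:(done) ltac:(done) esy ac ay ltac:(neq).
have ct := cov3 (d3 t tV) bV cV' yV ltac:(done) ltac:(done) ety bc by' ltac:(neq).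
have cy := cov3 (d3 y yV) rV sV tV ltac:(done) ltac:(done) ltac:(done) rs rt st.
have nxy : e x y = false.
  by apply/negP=> /(cx _ yV)[]E; [rewrite E eqxx in ay | rewrite E eqxx in by' | rewrite E eqxx in cy'].
symm.
have VE : V = [set u in [:: y] ++ [:: x; a; b; c; r; s'; t]].
  apply: (conn_all (a := x) (conn1 yV)); rewrite ?inE ?eqxx //; last by smem.
    move=> u; rewrite in_rem !inE => /or4P[|||/or4P[]]/eqP->; spl.
  move=> u w; rewrite !inE => /or4P[|||/or4P[]]/eqP-> wV h.
  - by case: (cx w wV h) => ->; rewrite eqxx ?orbT.
  - by case: (ca w wV h) => ->; rewrite eqxx ?orbT.
  - by case: (cb w wV h) => ->; rewrite eqxx ?orbT.
  - by case: (cc w wV h) => ->; rewrite eqxx ?orbT.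
  - by case: (cr w wV h) => ->; rewrite eqxx ?orbT.
  - by case: (cs w wV h) => ->; rewrite eqxx ?orbT.
  - by case: (ct w wV h) => ->; rewrite eqxx ?orbT.
have dr := d3 r rV; have ds := d3 s' sV; have dt := d3 t tV; have dy := d3 y yV.
apply: ns; apply: (removal_slack (s := [:: y; x; a; b; c; r; s'; t]) (ds := [:: a; b; c]) (ys := [::]) (i := 24) (K := 10) gV) => //.
- by suniq.
- by smem.
- move=> A AV cA hA.
  have aA : a \notin A by apply: hA; inseq.
  have bA : b \notin A by apply: hA; inseq.
  have cA' : c \notin A by apply: hA; inseq.
  have xA : x \notin A.
    apply: (leaf_notin (y := y) cA AV) => u uV eu uA.
    by case: (cx u uV eu) => E; rewrite E ?(negPf aA) ?(negPf bA) ?(negPf cA') in uA.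
  have rA : r \notin A.
    apply: (leaf_notin (y := y) cA AV) => u uV eu uA.
    by case: (cr u uV eu) => E //; rewrite E ?(negPf aA) ?(negPf bA) ?(negPf cA') in uA.
  have sA : s' \notin A.
    apply: (leaf_notin (y := y) cA AV) => u uV eu uA.
    by case: (cs u uV eu) => E //; rewrite E ?(negPf aA) ?(negPf bA) ?(negPf cA') in uA.
  have tA : t \notin A.
    apply: (leaf_notin (y := y) cA AV) => u uV eu uA.
    by case: (ct u uV eu) => E //; rewrite E ?(negPf aA) ?(negPf bA) ?(negPf cA') in uA.
  have yA : y \notin A.
    apply: (leaf_notin (y := y) cA AV) => u uV eu uA.
    by case: (cy u uV eu) => E; rewrite E ?(negPf rA) ?(negPf sA) ?(negPf tA) in uA.
  by move=> u; rewrite !inE => /or4P[|||/or4P[|||/orP[]]]/eqP->.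
- have -> : rem V [:: y; x; a; b; c; r; s'; t] = set0; last exact: slack0.
  by apply/setP=> u; rewrite in_rem VE /= !inE andNb.
- by inner.
- by arith.
Qed.

(** All degrees are 3 or 4 and no edge joins the two kinds, so by connectivity one vertex of degree
    3 makes the graph cubic. Its existence is what sets 4-regular graphs aside. *)
Lemma no_counterexample : (exists2 x, x \in V & dg e V x <= 3) -> False.
Proof.
case=> x xV dx; pose A := [set y in V | dg e V y == 3].
have AV : A \subset V by apply/subsetP=> y; rewrite inE => /andP[].
have xA : x \in A by rewrite inE xV; case: (deg34 xV) => d; rewrite d // in dx *.
have [E|AnV] := eqVneq A V.
  by apply: (no_cubic xV) => y; rewrite -{1}E inE => /andP[_ /eqP].
have A0 : A != set0 by apply/set0Pn; exists x.
have /card_gt0P[[y z]] := cut_gt0 AV A0 AnV; rewrite in_cut => /and3P[yA zA eyz].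
move: yA zA; rewrite !inE => /andP[yV /eqP dy] /andP[zA zV].
apply: (no_mixed yV zV eyz dy); case: (deg34 zV) => // dz.
by rewrite zV dz eqxx in zA.
Qed.

End Counterexample.

(** * The bound for all graphs of the class *)

Section FeedbackBound.
Variable T : finType.
Implicit Types (e : rel T) (V A : {set T}) (x p q : T).
Variable Pl : rel T -> {set T} -> Prop.
Hypothesis Pl_sub : forall e V A, A \subset V -> Pl e V -> Pl e A.
Hypothesis Pl_sup : forall e V x p q, symmetric e -> Pl e V ->
  x \in V -> p \in V -> q \in V -> p != x -> q != x -> e x p -> e x q ->
  Pl (add_edge e p q) (V :\ x).
Hypothesis Pl_edges : forall e V, good Pl e V -> V != set0 ->
  \sum_(x in V) dg e V x + 4 <= 4 * #|V|.

Lemma exists_deg_le3 e V : good Pl e V -> V != set0 -> exists2 x, x \in V & dg e V x <= 3.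
Proof.
move=> gV V0; have [/existsP[x /andP[xV dx]]|h] := boolP [exists x, (x \in V) && (dg e V x <= 3)].
  by exists x.
have h4 : \sum_(x in V) 4 <= \sum_(x in V) dg e V x.
  apply: leq_sum => x xV; rewrite ltnNge; apply: contra h => l.
  by apply/existsP; exists x; rewrite xV.
by have := Pl_edges gV V0; move: h4; rewrite sum_nat_const; lia.
Qed.

Lemma slack_conn e V : good Pl e V -> conn e V -> slack e V 0.
Proof.
have [n] := ubnP #|V|; elim: n e V => // n IHn e V VN gV cV.
have IH e' V' : good Pl e' V' -> conn e' V' -> #|V'| < n -> slack e' V' 0.
  by move=> g c l; exact: IHn.
rewrite /slack; apply: contraT => ns; exfalso.
apply: (no_counterexample Pl_sub Pl_sup IH gV cV VN); first exact/negP.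
by apply: exists_deg_le3 => //; case/connP: cV.
Qed.

Theorem tau_bound e V : good Pl e V -> 9 * tau e V <= 4 * #|V|.
Proof.
have [n] := ubnP #|V|; elim: n V => // n IHn V VN gV.
have [->|V0] := eqVneq V set0; first by rewrite tau0.
have [cV|/(nconn_part V0)[A [pA A0 AV]]] := boolP (conn e V).
  have wt_le : wt e V <= 4 * #|V| + 5 * \sum_(x in V) dg e V x.
    rewrite /wt big_distrr -[4 * #|V|]mulnC -sum_nat_const -big_split /=.
    by apply: leq_sum => x _; apply: wgt_le.
  by have := slack_conn gV cV; have := Pl_edges gV V0; move: wt_le; rewrite /slack; lia.
have se := gsym gV; have [AsV _] := partP _ _ _ pA.
have cA : #|A| < #|V| by apply: proper_card; rewrite properEneq AV.
have cB := cardsID A V; rewrite (setIidPr AsV) in cB.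
have B0 : 0 < #|A| by rewrite card_gt0.
have hA := IHn A ltac:(lia) (good_sub Pl_sub AsV gV).
have hB := IHn (V :\: A) ltac:(lia) (good_sub Pl_sub (subsetDl V A) gV).
by have := tau_split se pA; lia.
Qed.

End FeedbackBound.

(** * Minors of the square grid *)

Definition cell := (nat * nat)%type.

(* [(true, c)] is the edge from [c] to its right neighbour, [(false, c)] the one to its upper neighbour. *)
Definition gedge := (bool * cell)%type.
Definition gend (g : gedge) : cell := (g.2.1 + g.1, g.2.2 + ~~ g.1).

(* A square is named by its lower left corner; [g.2] and [gside g] are the two squares along [g]. *)
Definition gside (g : gedge) : cell := (g.2.1 - ~~ g.1, g.2.2 - g.1).

Definition joins (g : gedge) (c d : cell) := g.2 = c /\ gend g = d \/ g.2 = d /\ gend g = c.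

Lemma joinsC g c d : joins g c d -> joins g d c.
Proof. by case; [right|left]. Qed.

(** Connectivity as an induction principle: a property passed on along lattice edges inside [B]
    spreads from one point to all. In [path_chain] this property is the existence of a chain. *)
Definition gconn (B : cell -> Prop) := (exists c, B c) /\
  forall P : cell -> Prop, (forall g c d, B c -> B d -> joins g c d -> P c -> P d) ->
  forall c d, B c -> B d -> P c -> P d.

(** A single partial colouring [beta] makes the branch sets disjoint by construction. Coloured
    points keep off the border, where truncated predecessors and finite sums would need special
    care. *)
Definition gminor (T : finType) (e : rel T) (V : {set T}) :=
  exists (K : nat) (beta : cell -> option T),
  [/\ forall c u, beta c = Some u -> (0 < c.1 < K) && (0 < c.2 < K),
      forall u, u \in V -> gconn (fun c => beta c = Some u) &
      forall u v, u \in V -> v \in V -> e u v ->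
        exists g c d, [/\ joins g c d, beta c = Some u & beta d = Some v] ].

Section GridMinor.
Variable T : finType.
Implicit Types (e : rel T) (V W : {set T}) (x p q u v : T).

Lemma gminor_sub e V W : W \subset V -> gminor e V -> gminor e W.
Proof.
move=> /subsetP WV [K [b [bK bc be]]]; exists K, b; split=> // [u /WV|u v /WV uV /WV vV]; first exact: bc.
exact: be.
Qed.

(** The branch set of [x] is merged into that of [p]; the union is connected through the lattice
    edge for [x p], and the one for [x q] realises the new edge. *)
Lemma gminor_sup e V x p q : symmetric e -> gminor e V -> x \in V -> p \in V -> q \in V ->
  p != x -> q != x -> e x p -> e x q -> gminor (add_edge e p q) (V :\ x).
Proof.
move=> se [K [b [bK bc be]]] xV pV qV px qx exp exq.
pose b' c := if b c == Some x then Some p else b c.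
have b'u c u : u != x -> b c = Some u -> b' c = Some u.
  by move=> ux E; rewrite /b' E; case: eqP => // -[E']; rewrite E' eqxx in ux.
have b'x c : b c = Some x -> b' c = Some p by rewrite /b' => ->; rewrite eqxx.
have b'E c u : b' c = Some u -> b c = Some u /\ u != x \/ b c = Some x /\ u = p.
  rewrite /b'; case: eqP => [-> [<-]|ne E]; first by right.
  by left; split=> //; apply/eqP=> ux; rewrite E ux in ne.
exists K, b'; split.
- by move=> c u /b'E[[E _]|[E _]]; apply: bK E.
- move=> u; rewrite !inE => /andP[ux uV]; have [up|up] := eqVneq u p; last first.
    have [[c bcu] h] := bc u uV; split; first by exists c; apply: b'u.
    have uE c' : b' c' = Some u -> b c' = Some u by case/b'E=> [[]|[_ E]] //; rewrite E eqxx in up.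
    move=> P hP c1 c2 /uE h1 /uE h2; apply: h h1 h2 => g c3 c4 h3 h4; apply: hP; exact: b'u.
  subst u; have [[c bcp] hp] := bc p pV; have [_ hx] := bc x xV.
  split; first by exists c; apply: b'u.
  move=> P hP; have [g [cx [cp [jg bx bp]]]] := be x p xV pV exp.
  have stp c1 c2 : b c1 = Some p -> b c2 = Some p -> P c1 -> P c2.
    by apply: hp => g' c3 c4 h3 h4; apply: hP; apply: b'u.
  have stx c1 c2 : b c1 = Some x -> b c2 = Some x -> P c1 -> P c2.
    by apply: hx => g' c3 c4 h3 h4; apply: hP; apply: b'x.
  have xp : P cx -> P cp by apply: (hP g) => //; [exact: b'x | exact: b'u].
  have px' : P cp -> P cx by apply: (hP g); [exact: b'u | exact: b'x | exact: joinsC].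
  move=> c1 c2 /b'E[[h1 _]|[h1 _]] /b'E[[h2 _]|[h2 _]] P1.
  + exact: stp h1 h2 P1.
  + by apply: (stx cx) => //; apply: px'; apply: stp P1.
  + by apply: (stp cp) => //; apply: xp; apply: stx P1.
  + exact: stx h1 h2 P1.
- move=> u v; rewrite !inE => /andP[ux uV] /andP[vx vV] /or3P[euv|/andP[/eqP-> /eqP->]|/andP[/eqP-> /eqP->]].
  + have [g [c [d [j h1 h2]]]] := be u v uV vV euv.
    by exists g, c, d; split=> //; apply: b'u.
  + have [g [c [d [j h1 h2]]]] := be x q xV qV exq.
    by exists g, c, d; split=> //; [exact: b'x | exact: b'u].
  + have [g [c [d [j h1 h2]]]] := be x q xV qV exq.
    by exists g, d, c; split; [exact: joinsC | exact: b'u | exact: b'x].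
Qed.

End GridMinor.

(** * Grid minors from discretised drawings *)

Section DiscreteDrawing.
Variables (T : finType) (e : rel T) (c : T -> T -> nat -> cell) (H K : nat).
Implicit Types (x y z w : T) (m : nat) (d : cell).
(* [c x y] is a lattice walk along the arc from [x] to [y]: its steps up to [H] run
   in the star of [x], those from [H] to [2 H] along the middle third of the arc. *)
Hypotheses (se : symmetric e) (ie : irreflexive e).
Hypothesis cK : forall x y m, m <= H.*2 -> (0 < (c x y m).1 < K) && (0 < (c x y m).2 < K).
Hypothesis c_step : forall x y m, m < H.*2 -> c x y m = c x y m.+1 \/ exists g, joins g (c x y m) (c x y m.+1).
Hypothesis c_start : forall x y z, c x y 0 = c x z 0.
Hypothesis c_end : forall x y, e x y -> c x y H.*2 = c y x H.
Hypothesis star_star : forall x y z w m n, x != z -> m <= H -> n <= H -> c x y m <> c z w n.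
Hypothesis mid_star : forall x y z w m n, e x y -> z != x -> z != y -> H <= m <= H.*2 -> n <= H ->
  c x y m <> c z w n.
Hypothesis mid_mid : forall x y z w m n, e x y -> e z w -> [set x; y] != [set z; w] ->
  H <= m <= H.*2 -> H <= n <= H.*2 -> c x y m <> c z w n.

(* The branch set of [x] is its star, extended along the middle thirds of the arcs
   to larger neighbours [y] until the star of [y] is reached. *)
Let star x d := exists y m, m <= H /\ d = c x y m.
Let tail x y m := [/\ e x y, enum_rank x < enum_rank y, H <= m <= H.*2 &
  forall n, H <= n <= m -> ~ star y (c x y n)].
Let branch x d := star x d \/ exists y m, tail x y m /\ d = c x y m.

Lemma H_le m : m <= H -> m <= H.*2.
Proof. by clear; lia. Qed.

(** The end of smaller [enum_rank] owns the middle third of an arc, so two tails never lie on one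
    arc traversed in opposite directions; and a tail stops before the star of the other end. *)
Lemma branch_disjoint x z d : branch x d -> branch z d -> x = z.
Proof.
move=> bx bz; apply/eqP; apply: contraT => xz; exfalso.
have ts a b a' d' : a != a' -> star a' d' -> forall m, tail a b m -> d' = c a b m -> False.
  move=> aa' sa m [eab _ mH nb] E; have [E'|nb'] := eqVneq a' b.
    by apply: (nb m); [case/andP: mH => -> _ /= | rewrite -E -E'].
  by case: sa => y [n [nH E2]]; apply: (mid_star (w := y) eab _ nb' mH nH); [rewrite eq_sym | rewrite -E E2].
case: bx bz => [sx|[y [m [t E]]]] [sz|[w [n [t' E']]]].
- by case: sx => y [m [mH ->]] in sz *; case: sz => w [n [nH]]; apply: star_star.
- by apply: (ts z w x d _ sx n t' E'); rewrite eq_sym.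
- exact: (ts x y z d xz sz m t E).
- case: t t' => exy l1 mH _ [ezw l2 nH _]; apply: (mid_mid exy ezw _ mH nH); last by rewrite -E.
  apply/eqP=> /setP S; have := S x; have := S z; rewrite !inE !eqxx /= (eq_sym z x) (negPf xz) /=.
  by move=> /eqP Ez /esym/eqP Ex; move: l1 l2; rewrite Ez -Ex => l1; rewrite ltnNge ltnW.
Qed.

Lemma branch_gconn x : gconn (branch x).
Proof.
pose r := c x x 0; have br : branch x r by left; exists x, 0.
split; first by exists r.
move=> P hP; have eqvP m y : m < H.*2 -> branch x (c x y m) -> branch x (c x y m.+1) ->
    (P (c x y m) <-> P (c x y m.+1)).
  move=> mH b1 b2; case: (c_step x y mH) => [->//|[g j]]; split; first exact: (hP g).
  by apply: (hP g) => //; apply: joinsC.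
have star_r y m : m <= H -> (P (c x y m) <-> P r).
  elim: m => [|m IHm] mH; first by rewrite (c_start x y x).
  apply: iff_trans (IHm (ltnW mH)); apply: iff_sym; apply: eqvP; first by move: mH; clear; lia.
    by left; exists y, m; split=> //; apply: ltnW.
  by left; exists y, m.+1.
have tail_r y m : tail x y (H + m) -> (P (c x y (H + m)) <-> P r).
  elim: m => [|m IHm]; first by rewrite addn0 => _; apply: star_r.
  rewrite addnS => t; have t' : tail x y (H + m).
    case: t => h1 h2 h3 h4; split=> //; first by move: h3; clear; lia.
    by move=> n hn; apply: h4; move: hn; clear => /andP[-> /leqW].
  apply: iff_trans (IHm t'); apply: iff_sym; apply: eqvP; first by case: t => _ _ h _; move: h; clear; lia.
    by right; exists y, (H + m).
  by right; exists y, (H + m).+1.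
have all_r d : branch x d -> (P d <-> P r).
  case=> [[y [m [mH ->]]]|[y [m [t ->]]]]; first exact: star_r.
  have E : m = H + (m - H) by case: t => _ _ /andP[h _] _; rewrite subnKC.
  by rewrite E in t *; apply: tail_r.
by move=> d1 d2 /all_r h1 /all_r h2 /h1 /h2.
Qed.

(** The walk from [x] reaches the star of [y] at step [2 H] at the latest. The point before its
    first arrival still belongs to the tail of [x], so the arriving step is a proper lattice
    edge. *)
Lemma branch_adj x y : e x y -> enum_rank x < enum_rank y ->
  exists g d d', [/\ joins g d d', branch x d & branch y d'].
Proof.
move=> exy lxy; pose hit m := `[< H <= m <= H.*2 /\ star y (c x y m) >].
have ex : exists m, hit m.
  exists H.*2; apply/asboolP; split; first by clear; lia.
  by rewrite c_end //; exists x, H.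
case: (ex_minnP ex) => l /asboolP[lH sl] min_l.
have lH' : l != H.
  apply/eqP=> E; case: sl => w [n [nH E2]]; apply: (@star_star x y y w l n) => //; last by rewrite E.
  by apply: contraTneq exy => ->; rewrite ie.
have [k Ek] : exists k, l = k.+1 by exists l.-1; move: lH lH'; clear; lia.
subst l; have kH : H <= k <= H.*2 by move: lH lH'; clear; lia.
have nk n : H <= n <= k -> ~ star y (c x y n).
  move=> hn s; have : hit n by apply/asboolP; split=> //; move: hn kH; clear; lia.
  by move/min_l; move: hn; clear; lia.
have tk : tail x y k by split.
case: (c_step x y (_ : k < H.*2)); first by move: lH; clear; lia.
  by move=> E; case: (nk k); [move: kH; clear; lia | rewrite E].
by case=> g j; exists g, (c x y k), (c x y k.+1); split=> //; [right; exists y, k | left].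
Qed.

Theorem discrete_gminor : gminor e [set: T].
Proof.
have [beta bP] : {beta : cell -> option T & forall d x, beta d = Some x <-> branch x d}.
  have h d : exists o : option T, forall x, o = Some x <-> branch x d.
    have [[x bx]|nx] := pselect (exists x, branch x d).
      exists (Some x) => z; split=> [[<-] //|bz]; congr Some; exact: branch_disjoint bz.
    by exists None => z; split=> // bz; case: nx; exists z.
  by have [f hf] := choice h; exists f.
exists K, beta; split.
- move=> d x /bP[[y [m [mH ->]]]|[y [m [[_ _ mH _] ->]]]]; first by apply: cK; apply: H_le.
  by apply: cK; case/andP: mH.
- move=> x _; have [[d bd] h] := branch_gconn x; split; first by exists d; apply/bP.
  move=> P hP d1 d2 /bP b1 /bP b2; apply: h => // g c1 c2 h1 h2; apply: hP; exact/bP.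
- move=> x y _ _ exy; have : enum_rank x != enum_rank y :> nat.
    by apply: contraTneq exy => /val_inj/enum_rank_inj->; rewrite ie.
  rewrite neq_ltn => /orP[l|l].
    have [g [d [d' [j b1 b2]]]] := branch_adj exy l.
    by exists g, d, d'; split=> //; apply/bP.
  have [g [d [d' [j b1 b2]]]] := branch_adj (ltac:(by rewrite se) : e y x) l.
  by exists g, d', d; split; [exact: joinsC | exact/bP | exact/bP].
Qed.

End DiscreteDrawing.

(** * Edge bound for triangle-free grid minors *)

Import GRing.Theory.
Local Open Scope ring_scope.

(** * Chains, boundaries and coboundaries over [F_2] on the grid *)

Section Chains.
Local Notation F2 := 'F_2.
Implicit Types (Y : gedge -> F2) (chi : cell -> F2) (b : cell -> F2).

Lemma F2xx (x : F2) : x + x = 0.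
Proof. by apply: addrr_pchar2; apply: pchar_Fp. Qed.

(** The boundary of a chain: the parity of its edges at the lattice point [c]. If a coordinate is 0,
    the truncated predecessor counts one edge twice, hence the positivity assumptions on points
    below. *)
Definition bd Y (c : cell) :=
  Y (true, c) + Y (true, (c.1.-1, c.2)) + (Y (false, c) + Y (false, (c.1, c.2.-1))).
Definition cob chi (g : gedge) := chi g.2 + chi (gside g).
Definition edge1 (g0 : gedge) : gedge -> F2 := fun g => (g == g0)%:R.

(** Each of the four squares around a lattice point lies along two of the four edges there. *)
Lemma bd_cob chi c : bd (cob chi) c = 0.
Proof.
case: c => i j; rewrite /bd /cob /gside /= !subn0 !subn1.
move: (chi (i, j)) (chi (i, j.-1)) (chi (i.-1, j)) (chi (i.-1, j.-1)) => x y z t.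
by case: x => [[|[|?]] ?] //; case: y => [[|[|?]] ?] //; case: z => [[|[|?]] ?] //;
   case: t => [[|[|?]] ?] //; apply: val_inj.
Qed.

Lemma bd_edge1 g c : (0 < c.1)%N -> (0 < c.2)%N ->
  bd (edge1 g) c = (c == g.2)%:R + (c == gend g)%:R.
Proof.
case: g => h [i j]; case: c => k l /= k0 l0; rewrite /bd /edge1 /gend /= !xpair_eqE.
case: h => /=; rewrite ?addr0 ?add0r ?addn0 ?addn1.
  by rewrite -[k in (k == i.+1)](prednK k0) eqSS.
by rewrite -[l in (l == j.+1)](prednK l0) eqSS.
Qed.

Lemma bdD Y1 Y2 c : bd (fun g => Y1 g + Y2 g) c = bd Y1 c + bd Y2 c.
Proof. by rewrite /bd [X in X + _ = _]addrACA [X in _ + X = _]addrACA [LHS]addrACA. Qed.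

Lemma bd_sum (I : finType) (P : pred I) (a : I -> F2) (Y : I -> gedge -> F2) c :
  bd (fun g => \sum_(i | P i) a i * Y i g) c = \sum_(i | P i) a i * bd (Y i) c.
Proof. by rewrite /bd -!big_split /=; apply: eq_bigr => i _; rewrite -!mulrDr. Qed.

(** Summation by parts. The shift of indices loses no term because [b] vanishes outside the interior
    of the grid. *)
Lemma sum_bd K b Y : (forall c, b c != 0 -> (0 < c.1 < K)%N && (0 < c.2 < K)%N) ->
  \sum_(i < K.+1) \sum_(j < K.+1) b (i : nat, j : nat) * bd Y (i : nat, j : nat) =
  \sum_(i < K.+1) \sum_(j < K.+1) \sum_(h : bool)
     Y (h, (i : nat, j : nat)) * (b (i : nat, j : nat) + b (gend (h, (i : nat, j : nat)))).
Proof.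
move=> bK; have b0 c : ~~ ((0 < c.1 < K)%N && (0 < c.2 < K)%N) -> b c = 0.
  by move=> h; apply/eqP; apply: contraNT h => /bK.
have sh (f : nat -> nat -> F2) : (forall j, f 0%N j = 0) -> (forall j, f K.+1 j = 0) -> forall j,
    \sum_(i < K.+1) f i j = \sum_(i < K.+1) f i.+1 j.
  by move=> f0 fK j; rewrite big_ord_recl f0 add0r [RHS]big_ord_recr /= fK addr0; apply: eq_bigr.
transitivity (\sum_(i < K.+1) \sum_(j < K.+1) (b (i : nat, j : nat) * Y (true, (i : nat, j : nat)) + b (i : nat, j : nat) * Y (false, (i : nat, j : nat))) +
   (\sum_(i < K.+1) \sum_(j < K.+1) b (i : nat, j : nat) * Y (true, (i.-1, j : nat)) +
    \sum_(i < K.+1) \sum_(j < K.+1) b (i : nat, j : nat) * Y (false, (i : nat, j.-1)))).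
  rewrite -!big_split /=; apply: eq_bigr => i _; rewrite -!big_split /=; apply: eq_bigr => j _.
  by rewrite /bd /= !mulrDr addrACA.
have -> : \sum_(i < K.+1) \sum_(j < K.+1) b (i : nat, j : nat) * Y (true, (i.-1, j : nat)) =
          \sum_(i < K.+1) \sum_(j < K.+1) b (i.+1, j : nat) * Y (true, (i : nat, j : nat)).
  rewrite exchange_big [RHS]exchange_big; apply: eq_bigr => j _.
  apply: (sh (fun i j => b (i, j) * Y (true, (i.-1, j)))) => l; rewrite b0 ?mul0r //=.
  by rewrite [(K.+1 < K)%N]ltnNge leqnSn ?andbF.
have -> : \sum_(i < K.+1) \sum_(j < K.+1) b (i : nat, j : nat) * Y (false, (i : nat, j.-1)) =
          \sum_(i < K.+1) \sum_(j < K.+1) b (i : nat, j.+1) * Y (false, (i : nat, j : nat)).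
  apply: eq_bigr => i _; apply: (sh (fun j i => b (i, j) * Y (false, (i, j.-1)))) => l; rewrite b0 ?mul0r //= ?andbF //.
  by rewrite [(K.+1 < K)%N]ltnNge leqnSn ?andbF.
rewrite -!big_split /=; apply: eq_bigr => i _; rewrite -!big_split /=; apply: eq_bigr => j _.
rewrite big_bool /= /gend /= !addn0 !addn1 !mulrDr ![Y _ * _]mulrC.
by rewrite addrACA.
Qed.

(** The induction principle of [gconn] extends the chain by one edge at a time; over [F_2] the
    intermediate end cancels. *)
Lemma path_chain (B : cell -> Prop) r c : gconn B -> (forall c, B c -> (0 < c.1)%N && (0 < c.2)%N) ->
  B r -> B c -> exists Y, (forall g, Y g != 0 -> B g.2 /\ B (gend g)) /\
  forall d, (0 < d.1)%N -> (0 < d.2)%N -> bd Y d = (d == c)%:R + (d == r)%:R.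
Proof.
move=> [_ cB] B0 Br Bc.
pose P c := exists Y, (forall g, Y g != 0 -> B g.2 /\ B (gend g)) /\
  forall d, (0 < d.1)%N -> (0 < d.2)%N -> bd Y d = (d == c)%:R + (d == r)%:R.
apply: (cB P _ r c Br Bc); last first.
  exists (fun=> 0); split; first by move=> g; rewrite eqxx.
  by move=> d _ _; rewrite F2xx /bd !addr0.
move=> g c1 c2 B1 B2 j [Y [hY bY]]; exists (fun g' => Y g' + edge1 g g'); split.
  move=> g'; have [->|ne] := eqVneq g' g.
    by case: j => -[-> ->].
  by rewrite /edge1 (negPf ne) addr0; apply: hY.
move=> d d1 d2; rewrite bdD bY // bd_edge1 //.
case: j => -[<- <-].
  by rewrite [X in X + _]addrC addrA -[X in X + _]addrA F2xx addr0 addrC.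
by rewrite [X in X + _]addrC [X in _ + X]addrC addrA -[X in X + _]addrA F2xx addr0 addrC.
Qed.

End Chains.

Lemma rank_rows (F : fieldType) m n (D : 'M[F]_(m, n)) :
  (\rank D <= #|[set i | row i D != 0%R]|)%N.
Proof.
have sub : (D <= \sum_(i in [set i | row i D != 0]) <<row i D>>)%MS.
  apply/row_subP=> i; have [->|ri] := eqVneq (row i D) 0; first exact: sub0mx.
  by apply: (sumsmx_sup i); rewrite ?inE // genmxE.
apply: leq_trans (mxrankS sub) _; rewrite -sum1_card.
elim/big_rec2: _ => [|i r M _ le]; first by rewrite mxrank0.
apply: leq_trans (mxrank_adds_leqif _ _) _.
by rewrite leq_add // genmxE rank_leq_row.
Qed.

(** * Faces and cycle space of a grid minor *)

Section EdgeBound.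
Variables (T : finType) (e : rel T) (V : {set T}) (K : nat) (beta : cell -> option T).
Implicit Types (w : T * T) (u : T).
Hypotheses (se : symmetric e) (ie : irreflexive e) (te : tfree e V).
Hypothesis bK : forall c u, beta c = Some u -> (0 < c.1 < K)%N && (0 < c.2 < K)%N.
Hypothesis bc : forall u, u \in V -> gconn (fun c => beta c = Some u).
Variable p : T * T -> gedge.
Let E := [set w : T * T | [&& w.1 \in V, w.2 \in V, e w.1 w.2 & (enum_rank w.1 < enum_rank w.2)%N]].
Hypothesis pE : forall w, w \in E -> exists c d, [/\ joins (p w) c d, beta c = Some w.1 & beta d = Some w.2].
Hypothesis V0 : V != set0.

Let inc w u : 'F_2 := (u == w.1)%:R + (u == w.2)%:R.
Let ind u c : 'F_2 := (beta c == Some u)%:R.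

Lemma E_neq w : w \in E -> w.1 != w.2.
Proof. by rewrite inE => /and4P[_ _ h _]; apply: contraTneq h => ->; rewrite ie. Qed.

Lemma ind_inc w u : w \in E -> ind u (p w).2 + ind u (gend (p w)) = inc w u.
Proof.
move=> /pE[c [d [j bc1 bd1]]]; rewrite /ind /inc ![u == _]eq_sym.
by case: j => -[-> ->]; rewrite bc1 bd1 //= addrC.
Qed.

Lemma p_inj : {in E &, injective p}.
Proof.
move=> w w' wE w'E; have [c [d [j h1 h2]]] := pE wE; have [c' [d' [j' h1' h2']]] := pE w'E.
move=> pp; rewrite -pp in j'.
have {j j' pp} cd : c = c' /\ d = d' \/ c = d' /\ d = c'.
  by case: j => -[<- <-]; case: j' => -[<- <-]; [left|right|right|left].
case: w w' wE w'E h1 h2 h1' h2' => x y [x' y'] /= wE w'E h1 h2 h1' h2'.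
case: cd => -[E1 E2]; first by subst; move: h1' h2'; rewrite h1 h2 => -[->] [->].
subst; move: h1' h2'; rewrite h1 h2 => -[Ex] [Ey]; subst.
by move: wE w'E; rewrite !inE /= => /and4P[_ _ _ l1] /and4P[_ _ _]; rewrite ltnNge ltnW.
Qed.

Let GE := (bool * ('I_K.+1 * 'I_K.+1))%type.
Let ge (g : GE) : gedge := (g.1, (g.2.1 : nat, g.2.2 : nat)).
Let q w : GE := ((p w).1, (inord (p w).2.1, inord (p w).2.2)).

Lemma geq w : w \in E -> ge (q w) = p w.
Proof.
move=> /pE[c [d [j bc1 bd1]]].
have [l1 l2] : ((p w).2.1 < K.+1)%N /\ ((p w).2.2 < K.+1)%N.
  have h c' u : beta c' = Some u -> (c'.1 < K.+1)%N /\ (c'.2 < K.+1)%N.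
    by case/bK/andP => /andP[_ h1] /andP[_ h2]; split; apply: leqW.
  by case: j => -[-> _]; [exact: h bc1 | exact: h bd1].
by rewrite /ge /q /= !inordK //; case: (p w) => ? [].
Qed.

(* The grid edges realising the graph: those inside a branch set and one for each edge. *)
Definition live (g : gedge) :=
  [exists u in V, (beta g.2 == Some u) && (beta (gend g) == Some u)] || [exists w in E, g == p w].

(** Summation by parts against the indicator of the branch set of [u]. The boundary of a coboundary
    vanishes, a live edge inside a branch set has both ends counted or none, and edges that are not
    live contribute nothing. What remains are the edges [p w]. *)
Lemma even_face (chi : cell -> 'F_2) u : u \in V ->
  (forall g : GE, ~~ live (ge g) -> cob chi (ge g) = 0) -> \sum_(w in E) cob chi (p w) * inc w u = 0.
Proof.
move=> uV hchi; have := @sum_bd K (ind u) (cob chi) _.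
have bu c : ind u c != 0 -> (0 < c.1 < K)%N && (0 < c.2 < K)%N.
  by rewrite /ind; have [/bK-> //|_] := eqVneq (beta c); rewrite eqxx.
move=> /(_ bu); rewrite big1; last first.
  by move=> i _; rewrite big1 // => j _; rewrite bd_cob mulr0.
pose phi g := cob chi g * (ind u g.2 + ind u (gend g)).
have -> : \sum_(i < K.+1) \sum_(j < K.+1) \sum_(h : bool) cob chi (h, (i : nat, j : nat)) *
     (ind u (i : nat, j : nat) + ind u (gend (h, (i : nat, j : nat)))) = \sum_(g : GE) phi (ge g).
  rewrite pair_bigA exchange_big pair_bigA /=; apply: eq_bigr => -[h [i j]] _ //.
move=> H0; transitivity (\sum_(g : GE) phi (ge g)); last exact: esym.
symmetry; rewrite (bigID (mem (q @: E))) /= [X in _ + X]big1 ?addr0; last first.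
  move=> g gE; rewrite /phi; have [lg|lg] := boolP (live (ge g)); last by rewrite hchi // mul0r.
  case/orP: lg => [/existsP[u' /and3P[u'V /eqP h1 /eqP h2]]|/existsP[w /andP[wE /eqP gp]]].
    by rewrite /ind h1 h2 F2xx mulr0.
  case/negP: gE; apply/imsetP; exists w => //.
  have : ge g = ge (q w) by rewrite geq.
  case: g gp => h [i j] _; rewrite /ge /= => -[-> Ei Ej].
  by congr (_, (_, _)); apply: val_inj; rewrite /= ?Ei ?Ej.
rewrite big_imset /=; last first.
  by move=> w w' wE w'E /(congr1 ge); rewrite !geq //; apply: p_inj.
by apply: eq_bigr => w wE; rewrite /phi geq // ind_inc.
Qed.

Let SQ := ('I_K.+1 * 'I_K.+1)%type.
Let sq (c : cell) : SQ := (inord c.1, inord c.2).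
(** Faces of the minor are the components of the squares under crossing edges that are not live;
    [face s] will be the indicator of the component with root [s], and zero if [s] is no root. *)
Definition cross : rel SQ := fun s t => [exists g : GE, ~~ live (ge g) &&
  ((s == sq (ge g).2) && (t == sq (gside (ge g))) || (t == sq (ge g).2) && (s == sq (gside (ge g))))].
Let face (s : SQ) (c : cell) : 'F_2 := (fingraph.root cross (sq c) == s)%:R.

Lemma cross_sym : symmetric cross.
Proof. by move=> s t; apply: eq_existsb => g; rewrite orbC. Qed.

Lemma cross_root (g : GE) : ~~ live (ge g) ->
  fingraph.root cross (sq (ge g).2) = fingraph.root cross (sq (gside (ge g))).
Proof.
move=> lg; apply/fingraph.rootP; first exact: sym_connect_sym cross_sym.
by apply/connect1/existsP; exists g; rewrite lg !eqxx.
Qed.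

Lemma face_cob s (g : GE) : ~~ live (ge g) -> cob (face s) (ge g) = 0.
Proof. by move=> lg; rewrite /cob /face cross_root // F2xx. Qed.

(** [A] is the incidence matrix of the graph, so its left kernel is the cycle space; the rows of [D]
    are the boundaries of the faces. *)
Let A : 'M['F_2]_(#|E|, #|V|) := \matrix_(i, j) inc (enum_val i) (enum_val j).
Let D : 'M['F_2]_(#|{: SQ}|, #|E|) := \matrix_(i, j) cob (face (enum_val i)) (p (enum_val j)).

(** Every edge has two ends, so the columns of [A] sum to zero over [F_2]. *)
Lemma rank_A : (\rank A < #|V|)%N.
Proof.
have Vn0 : (0 < #|V|)%N by rewrite card_gt0.
have A1 : A *m const_mx 1 = 0 :> 'M_(_, 1).
  apply/matrixP=> i j; rewrite !mxE.
  under eq_bigr do rewrite !mxE mulr1.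
  rewrite -(big_enum_val (fun u => inc (enum_val i) u)) /inc big_split /=.
  have := enum_valP i; rewrite inE => /and4P[h1 h2 _ _].
  have s1 u0 : u0 \in V -> \sum_(u in V) (u == u0)%:R = 1 :> 'F_2.
    by move=> u0V; rewrite (bigD1 u0) //= eqxx big1 ?addr0 // => u /andP[_ /negPf->].
  by rewrite !s1 // F2xx.
have rB : (0 < \rank (const_mx 1%R : 'M['F_2]_(#|V|, 1)))%N.
  rewrite lt0n mxrank_eq0; apply/eqP=> /matrixP/(_ (Ordinal Vn0) 0); rewrite !mxE => /eqP.
  by rewrite oner_eq0.
by apply: leq_trans (mulmx0_rank_max A1); rewrite -addn1 leq_add2l.
Qed.

Let cv (c : SQ) : cell := (c.1 : nat, c.2 : nat).

Lemma sqK (c : SQ) : sq (cv c) = c.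
Proof. by case: c => i j; rewrite /sq /= !inord_val. Qed.

Lemma cvK c : (c.1 <= K)%N -> (c.2 <= K)%N -> cv (sq c) = c.
Proof. by case: c => i j /= h1 h2; rewrite /cv /sq /= !inordK. Qed.

Lemma sum_cell (phi : cell -> 'F_2) d : (d.1 <= K)%N -> (d.2 <= K)%N ->
  \sum_(c : SQ) phi (cv c) * (cv c == d)%:R = phi d.
Proof.
move=> d1 d2; rewrite (bigD1 (sq d)) //= cvK // eqxx mulr1 big1 ?addr0 // => c ne.
by rewrite (_ : (cv c == d) = false) ?mulr0 //; apply: contraNF ne => /eqP <-; rewrite sqK.
Qed.

Lemma color_le c u : beta c = Some u -> (c.1 <= K)%N /\ (c.2 <= K)%N.
Proof. by case/bK/andP=> /andP[_ /ltnW ->] /andP[_ /ltnW ->]. Qed.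

Lemma p_ends w : w \in E -> exists u v, [/\ beta (p w).2 = Some u, beta (gend (p w)) = Some v,
  u != v & u \in V /\ v \in V].
Proof.
move=> wE; have ne := E_neq wE; have [c [d [j bc1 bd1]]] := pE wE.
have [h1 h2] : w.1 \in V /\ w.2 \in V by move: wE; rewrite inE => /and4P[].
case: j => -[-> ->]; [exists w.1, w.2 | exists w.2, w.1] => //.
by split=> //; rewrite eq_sym.
Qed.

Let col c := if beta c is Some u then u \in V else false.

(** An even edge set of the graph, realised by the lattice edges [p w], has its odd lattice points
    inside branch sets, evenly many in each. Chains inside the branch sets cancel them. *)
Lemma lift_chain (zf : T * T -> 'F_2) : (forall u, u \in V -> \sum_(w in E) zf w * inc w u = 0) ->
  exists Y : gedge -> 'F_2, [/\ forall d, (0 < d.1)%N -> (0 < d.2)%N -> bd Y d = 0,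
    forall g, Y g != 0 -> live g /\ (0 < g.2.1)%N && (0 < g.2.2)%N &
    forall w, w \in E -> Y (p w) = zf w].
Proof.
move=> hz; pose Y0 g := \sum_(w in E) zf w * edge1 (p w) g.
have [r rP] : {r : T -> cell & forall u, u \in V -> beta (r u) = Some u}.
  have h u : exists c, u \in V -> beta c = Some u.
    by have [/bc[[c bcu] _]|_] := boolP (u \in V); [exists c | exists (0%N, 0%N)].
  by have [f hf] := choice h; exists f.
have pos c u : beta c = Some u -> (0 < c.1)%N && (0 < c.2)%N.
  by move/bK => /andP[/andP[-> _] /andP[-> _]].
have [Yp hYp] : {Yp : cell -> gedge -> 'F_2 & forall c u, u \in V -> beta c = Some u ->
     (forall g, Yp c g != 0 -> beta g.2 = Some u /\ beta (gend g) = Some u) /\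
     forall d, (0 < d.1)%N -> (0 < d.2)%N -> bd (Yp c) d = (d == c)%:R + (d == r u)%:R}.
  have h c : exists Y : gedge -> 'F_2, forall u, u \in V -> beta c = Some u ->
     (forall g, Y g != 0 -> beta g.2 = Some u /\ beta (gend g) = Some u) /\
     forall d, (0 < d.1)%N -> (0 < d.2)%N -> bd Y d = (d == c)%:R + (d == r u)%:R.
    case Ec: (beta c) => [u|]; last by exists (fun=> 0).
    have [uV|uV] := boolP (u \in V); last first.
      by exists (fun=> 0) => u' u'V [E']; rewrite -E' (negPf uV) in u'V.
    have [Y hY] := path_chain (bc uV) (fun c => @pos c u) (rP u uV) Ec.
    by exists Y => u' u'V [<-].
  by have [f hf] := choice h; exists f.
pose tau c := bd Y0 c.
(* Each odd point is connected to the representative [r u] of its branch set; at [r u] itself the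
   corrections cancel by [tau_sum]. *)
pose Y g := Y0 g + \sum_(c : SQ | col (cv c)) tau (cv c) * Yp (cv c) g.
have colP c : col c -> exists2 u, u \in V & beta c = Some u.
  by rewrite /col; case: (beta c) => [u uV|//]; exists u.
have tauE d : (0 < d.1)%N -> (0 < d.2)%N ->
    tau d = \sum_(w in E) zf w * ((d == (p w).2)%:R + (d == gend (p w))%:R).
  by move=> d1 d2; rewrite /tau bd_sum; apply: eq_bigr => w _; rewrite bd_edge1.
have tau0 d : (0 < d.1)%N -> (0 < d.2)%N -> ~~ col d -> tau d = 0.
  move=> d1 d2 cd; rewrite tauE // big1 // => w wE.
  have [u [v [b1 b2 _ [uV vV]]]] := p_ends wE.
  have n1 : (d == (p w).2) = false by apply: contraNF cd => /eqP->; rewrite /col b1.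
  have n2 : (d == gend (p w)) = false by apply: contraNF cd => /eqP->; rewrite /col b2.
  by rewrite n1 n2 addr0 mulr0.
have tau_sum u : u \in V -> \sum_(c : SQ) ind u (cv c) * tau (cv c) = 0.
  move=> uV; rewrite -[RHS](hz u uV).
  transitivity (\sum_(c : SQ) \sum_(w in E) zf w * (ind u (cv c) * (cv c == (p w).2)%:R + ind u (cv c) * (cv c == gend (p w))%:R)).
    apply: eq_bigr => c _; have [bu|nb] := eqVneq (beta (cv c)) (Some u).
      have /andP[c1 c2] := pos _ _ bu; rewrite tauE // big_distrr /=; apply: eq_bigr => w _.
      by rewrite -mulrDr mulrCA.
    by rewrite /ind (negPf nb) mul0r big1 // => w _; rewrite !mul0r addr0 mulr0.
  rewrite exchange_big /=; apply: eq_bigr => w wE; rewrite -big_distrr big_split /=; congr (_ * _).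
  have [u1 [v1 [b1 b2 _ _]]] := p_ends wE.
  have [l1 l2] := color_le b1; have [l3 l4] := color_le b2.
  by rewrite !sum_cell // ind_inc.
exists Y; split.
- move=> d d1 d2.
  have -> : bd Y d = tau d + \sum_(c : SQ | col (cv c)) tau (cv c) * bd (Yp (cv c)) d.
    by rewrite /Y bdD; congr (_ + _); exact: bd_sum.
  have E1 : \sum_(c : SQ | col (cv c)) tau (cv c) * bd (Yp (cv c)) d =
     \sum_(c : SQ | col (cv c)) tau (cv c) * (d == cv c)%:R +
     \sum_(c : SQ | col (cv c)) tau (cv c) * (if beta (cv c) is Some u then d == r u else false)%:R.
    rewrite -big_split /=; apply: eq_bigr => c /colP[u uV bu]; rewrite -mulrDr bu.
    by have [_ ->] := hYp _ _ uV bu.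
  rewrite E1; have [cd|cd] := boolP (col d); last first.
    rewrite tau0 // !big1 ?addr0 //.
      move=> c /colP[u uV bu]; rewrite bu (_ : (d == r u) = false) ?mulr0 //.
      by apply: contraNF cd => /eqP->; rewrite /col rP.
    by move=> c cc; rewrite (_ : (d == cv c) = false) ?mulr0 //; apply: contraNF cd => /eqP->.
  have [u uV bu] := colP _ cd; have [l1 l2] := color_le bu.
  have -> : \sum_(c : SQ | col (cv c)) tau (cv c) * (d == cv c)%:R = tau d.
    rewrite big_mkcond /= -[RHS](sum_cell _ l1 l2); apply: eq_bigr => c _; rewrite [d == _]eq_sym.
    case: ifP => // nc; rewrite (_ : (cv c == d) = false) ?mulr0 //.
    by apply: contraFF nc => /eqP->.
  rewrite addrA F2xx add0r.
  transitivity ((d == r u)%:R * \sum_(c : SQ) ind u (cv c) * tau (cv c)); last by rewrite tau_sum ?mulr0.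
  rewrite big_mkcond big_distrr /=; apply: eq_bigr => c _; case: ifP => [/colP[u' u'V bu']|nc].
    rewrite bu' /ind bu'; have [->|ne] := eqVneq u' u.
      by rewrite eqxx mul1r mulrC.
    rewrite (_ : (Some u' == Some u) = false) ?mul0r ?mulr0; last by apply/eqP=> -[E']; rewrite E' eqxx in ne.
    rewrite (_ : (d == r u') = false) ?mulr0 //; apply/eqP=> E'; move: bu; rewrite E' rP // => -[E''].
    by rewrite E'' eqxx in ne.
  rewrite /ind (_ : (beta (cv c) == Some u) = false) ?mul0r ?mulr0 //.
  by apply: contraFF nc => /eqP; rewrite /col => ->.
- move=> g; have [lg|] := boolP (live g && ((0 < g.2.1)%N && (0 < g.2.2)%N)).
    by case/andP: lg.
  move=> ng; case/negP; apply/eqP; rewrite /Y /Y0 !big1 ?addr0 //.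
    move=> c /colP[u uV bu]; apply/eqP; rewrite mulf_eq0; apply/orP; right; apply: contraNT ng => nz.
    have [h1 _] := hYp _ _ uV bu; have [b1 b2] := h1 g nz; rewrite (pos _ _ b1) andbT.
    by apply/orP; left; apply/existsP; exists u; rewrite uV b1 b2 !eqxx.
  move=> w wE; rewrite /edge1; case: eqP => [gp|_]; last by rewrite mulr0.
  case/negP: ng; have [u [v [b1 _ _ _]]] := p_ends wE.
  rewrite gp (pos _ _ b1) andbT; apply/orP; right; apply/existsP; exists w.
  by rewrite wE eqxx.
- move=> w wE; rewrite /Y /Y0 [X in _ + X]big1 ?addr0.
    rewrite (bigD1 w) //= /edge1 eqxx mulr1 big1 ?addr0 // => w' /andP[w'E ne].
    rewrite (_ : (p w == p w') = false) ?mulr0 //; apply: contraNF ne => /eqP/(p_inj wE w'E)->.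
    exact: eqxx.
  move=> c /colP[u uV bu]; apply/eqP; rewrite mulf_eq0; apply/orP; right; apply: contraT => nz.
  have [h1 _] := hYp _ _ uV bu; have [b1 b2] := h1 _ nz; have [u1 [v1 [c1 c2 ne _]]] := p_ends wE.
  by move: ne; rewrite -(inj_eq (@Some_inj _)) -c1 -c2 b1 b2 eqxx.
Qed.

(* The sum of [Y] along the vertical ray below a square is a potential of [Y]. *)
Lemma potential (Y : gedge -> 'F_2) : (forall d, (0 < d.1)%N -> (0 < d.2)%N -> bd Y d = 0) ->
  (forall g, Y g != 0 -> (0 < g.2.1)%N && (0 < g.2.2)%N) ->
  exists S : cell -> 'F_2, forall g, cob S g = Y g.
Proof.
move=> bY pY; exists (fun c => \sum_(j < c.2.+1) Y (true, (c.1, j : nat))).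
have Y0 g : ~~ ((0 < g.2.1)%N && (0 < g.2.2)%N) -> Y g = 0.
  by move=> h; apply/eqP; apply: contraNT h => /pY.
case=> [[] [i j]]; rewrite /cob /gside /= ?subn0.
  case: j => [|j] /=; first by rewrite F2xx Y0 //= andbF.
  by rewrite subn1 /= [X in X + _]big_ord_recr /= addrAC F2xx add0r.
rewrite subn1; case: i => [|i] /=; first by rewrite F2xx Y0.
(* For a vertical edge, moving up one row changes the two sides by edges meeting at one lattice
   point, where the boundary vanishes. *)
elim: j => [|j IHj]; first by rewrite !big_ord1 !Y0 ?addr0 //= ?andbF.
have key (a b c d : 'F_2) : a + b + (c + d) = 0 -> d + (a + b) = c.
  move=> h; rewrite -[LHS]addr0 -(F2xx c) addrA [d + _]addrC -[a + b + d + c]addrA [d + c]addrC.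
  by rewrite h add0r.
rewrite big_ord_recr /= [X in _ + X]big_ord_recr /= addrACA IHj.
exact: key (bY (i.+1, j.+1) isT isT).
Qed.

(** A cycle of the graph lifts to an even chain of the grid and so has a potential [S]. The chain
    consists of live edges, hence [S] is constant on each face, and its values are the coefficients
    of the face boundaries. *)
Lemma face_span (z : 'rV['F_2]_#|E|) : z *m A = 0 -> (z <= D)%MS.
Proof.
move=> zA; pose zf w := \sum_(j | enum_val j == w) z 0 j.
have zfE j : zf (enum_val j) = z 0 j.
  by rewrite /zf (big_pred1 j) // => k; rewrite (inj_eq enum_val_inj).
have hz u : u \in V -> \sum_(w in E) zf w * inc w u = 0.
  move=> uV; have /rowP/(_ (enum_rank_in uV u)) := zA; rewrite !mxE => h.
  rewrite -[RHS]h big_enum_val; apply: eq_bigr => j _.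
  by rewrite zfE mxE enum_rankK_in.
have [Y [bY lY pY]] := lift_chain hz.
have [S hS] := potential bY (fun g h => (lY g h).2).
have Scross s t : cross s t -> S (cv s) = S (cv t).
  case/existsP=> g /andP[lg h].
  have E0 : S (ge g).2 = S (gside (ge g)).
    apply/eqP; rewrite -subr_eq0 oppr_pchar2 ?pchar_Fp // -/(cob S (ge g)) hS.
    by apply/eqP; apply: contraNeq lg => /lY[].
  have [g1 g2] : cv (sq (ge g).2) = (ge g).2 /\ cv (sq (gside (ge g))) = gside (ge g).
    split; apply: cvK; case: (g) => h' [i j]; rewrite /ge /gside /= ?leq_subLR.
    - by rewrite -ltnS.
    - by rewrite -ltnS.
    - by apply: leq_trans (leq_addl _ _); rewrite -ltnS.
    - by apply: leq_trans (leq_addl _ _); rewrite -ltnS.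
  by case/orP: h => /andP[/eqP-> /eqP->]; rewrite g1 g2 E0.
have Sroot s : S (cv (fingraph.root cross s)) = S (cv s).
  have /connectP[pth hp ->] := connect_root cross s.
  elim: pth s hp => //= t pth IHp s /andP[/Scross-> hp].
  exact: IHp.
suff -> : z = (\row_i S (cv (enum_val i))) *m D by exact: submxMl.
apply/rowP=> j; rewrite mxE -zfE; have wE := enum_valP j; set w := enum_val j in wE *.
rewrite -pY // -hS; transitivity (\sum_(s : SQ) S (cv s) * cob (face s) (p w)); last first.
  rewrite (big_enum_val (fun s => S (cv s) * cob (face s) (p w))).
  by apply: eq_bigr => i _; rewrite !mxE.
have [u [v [b1 _ _ _]]] := p_ends wE; have [l1 l2] := color_le b1.
have E1 c : (c.1 <= K)%N -> (c.2 <= K)%N -> \sum_(s : SQ) S (cv s) * face s c = S c.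
  move=> c1 c2; rewrite (bigD1 (fingraph.root cross (sq c))) //= /face eqxx mulr1 Sroot cvK //.
  by rewrite big1 ?addr0 // => s; rewrite eq_sym => /negPf->; rewrite mulr0.
rewrite /cob; under eq_bigr do rewrite mulrDr.
rewrite big_split /= !E1 // /gside /= ?leq_subLR.
  by apply: leq_trans (leq_addl _ _).
by apply: leq_trans (leq_addl _ _).
Qed.

(** A face boundary has even degree everywhere. From an edge [w0] it continues at both ends, by [w1]
    and [w2]; without triangles their far ends differ, and it continues at one of these by a fourth
    edge. *)
Lemma face_size s : (exists2 w, w \in E & cob (face s) (p w) != 0) ->
  (4 <= #|[set w in E | cob (face s) (p w) != 0%R]|)%N.
Proof.
set M := [set w in E | _]; case=> w0 w0E w0n.
have w0M : w0 \in M by rewrite inE w0E.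
have hu u : u \in V -> \sum_(w in E) cob (face s) (p w) * inc w u = 0.
  by move=> uV; apply: even_face => // g; apply: face_cob.
pose at_ w u := (u == w.1) || (u == w.2).
have inc1 w u : w \in E -> inc w u = (at_ w u)%:R.
  move=> wE; have := E_neq wE; rewrite /inc /at_; have [->|n1] := eqVneq u w.1.
    by move=> /negPf->; rewrite addr0.
  by rewrite add0r.
have MV w : w \in M -> [/\ w \in E, w.1 \in V, w.2 \in V & e w.1 w.2].
  by rewrite inE => /andP[wE _]; split=> //; move: wE; rewrite inE => /and4P[].
have other w u : w \in M -> at_ w u -> exists w', [/\ w' \in M, w' != w & at_ w' u].
  move=> wM wu; have [wE w1 w2 _] := MV w wM.
  have uV : u \in V by case/orP: wu => /eqP->.
  have [/existsP[w' /and3P[? ? ?]]|h] := boolP [exists w', [&& w' \in M, w' != w & at_ w' u]].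
    by exists w'.
  have := hu u uV; rewrite (bigD1 w) //= inc1 // wu mulr1 big1 ?addr0.
    by move=> E0; move: wM; rewrite inE E0 eqxx andbF.
  move=> w' /andP[w'E ne]; rewrite inc1 //; apply/eqP; apply: contraR h => nz.
  apply/existsP; exists w'; rewrite inE w'E ne /=.
  by move: nz; rewrite mulf_eq0 negb_or => /andP[->]; case: (at_ w' u); rewrite ?eqxx.
have opp w u : w \in M -> at_ w u -> exists v, [/\ v \in V, u != v, e u v, at_ w v & forall t, at_ w t -> t = u \/ t = v].
  move=> wM; have [wE w1 w2 ew] := MV w wM; have ne := E_neq wE.
  case/orP=> /eqP->.
    exists w.2; split=> //; first by rewrite /at_ eqxx orbT.
    by move=> t /orP[]/eqP->; [left|right].
  exists w.1; split=> //; rewrite 1?se 1?eq_sym //; first by rewrite /at_ eqxx.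
  by move=> t /orP[]/eqP->; [right|left].
have same w w' a b : w \in M -> w' \in M -> a != b -> at_ w a -> at_ w b -> at_ w' a -> at_ w' b -> w = w'.
  move=> wM w'M ab; have [wE _ _ _] := MV w wM; have [w'E _ _ _] := MV w' w'M.
  case: w w' wE w'E {wM w'M} => x y [x' y']; rewrite !inE /at_ /= => /and4P[_ _ _ l1] /and4P[_ _ _ l2].
  case/orP=> /eqP ?; subst; case/orP=> /eqP ?; subst; rewrite ?eqxx // in ab *;
    case/orP=> /eqP ?; subst; case/orP=> /eqP ?; subst; rewrite ?eqxx // in ab *;
    by move: l2; rewrite ltnNge ltnW.
have a0 : at_ w0 w0.1 by rewrite /at_ eqxx.
have [b [bV ab eab b0 t0]] := opp w0 w0.1 w0M a0; set a := w0.1 in a0 ab eab t0.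
have [w1 [w1M w10 a1]] := other w0 a w0M a0; have [c [cV ac eac c1 t1]] := opp w1 a w1M a1.
have [w2 [w2M w20 b2]] := other w0 b w0M b0; have [d [dV bd' ebd d2 t2]] := opp w2 b w2M b2.
have aV : a \in V by have [_ ->] := MV w0 w0M.
have cb : c != b.
  by apply/eqP=> E'; case/eqP: w10; apply: (same w1 w0 a b) => //; rewrite -E'.
have da : d != a.
  by apply/eqP=> E'; case/eqP: w20; apply: (same w2 w0 a b) => //; rewrite -E'.
have cd : c != d.
  by apply/eqP=> E'; subst d; apply: (te aV bV cV) => //; rewrite se.
have [w3 [w3M w31 c3]] := other w1 c w1M c1.
have w30 : w3 != w0.
  apply/eqP=> E'; rewrite E' in c3; case: (t0 c c3) => E2; first by rewrite E2 eqxx in ac.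
  by rewrite E2 eqxx in cb.
have w32 : w3 != w2.
  apply/eqP=> E'; rewrite E' in c3; case: (t2 c c3) => E2; first by rewrite E2 eqxx in cb.
  by rewrite E2 eqxx in cd.
have w12 : w1 != w2.
  apply/eqP=> E'; rewrite -E' in b2; case: (t1 b b2) => E2; first by rewrite E2 eqxx in ab.
  by rewrite E2 eqxx in cb.
have us : uniq [:: w0; w1; w2; w3].
  by rewrite /= !inE !negb_or w12 ![w0 == _]eq_sym w10 w20 w30 ![_ == w3]eq_sym w31 w32.
rewrite -(card_uniqP us : _ = 4%N); apply: subset_leq_card; apply/subsetP=> w.
by rewrite !in_cons in_nil orbF => /or4P[]/eqP->.
Qed.

(** The cycle space lies in the row space of [D], whose dimension is at most the number of nonzero
    rows; counting the nonzero entries of [D] by rows and by columns bounds that number. *)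
Lemma edge_count : (2 * #|E| + 4 <= 4 * #|V|)%N.
Proof.
have rk : (#|E| - \rank A <= \rank D)%N.
  rewrite -mxrank_ker; apply/mxrankS/row_subP=> i; apply: face_span.
  by apply/sub_kermxP; exact: row_sub.
have := rank_A; have := rank_rows D; set Rs := [set i | _] => h1 h2.
have hR i : i \in Rs -> (4 <= #|[set j | D i j != 0%R]|)%N.
  rewrite inE => /rV0Pn[j]; rewrite !mxE => nz.
  have := @face_size (enum_val i) (ex_intro2 _ _ (enum_val j) (enum_valP j) nz).
  move/leq_trans; apply; rewrite -(card_imset _ (@enum_val_inj _ (mem E))).
  apply: subset_leq_card; apply/subsetP=> w; rewrite inE => /andP[wE wn].
  by apply/imsetP; exists (enum_rank_in wE w); rewrite ?inE ?mxE ?enum_rankK_in.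
have hC j : (#|[set i | D i j != 0%R]| <= 2)%N.
  pose w : T * T := enum_val j.
  apply: leq_trans (_ : #|[set enum_rank (fingraph.root cross (sq (p w).2)); enum_rank (fingraph.root cross (sq (gside (p w))))]| <= 2)%N; last by rewrite cards2; case: eqP.
  apply: subset_leq_card; apply/subsetP=> i; rewrite !inE mxE /cob /face -/w => h.
  apply: contraR h; rewrite negb_or => /andP[n1 n2].
  have nn t : i != enum_rank t -> (t == enum_val i) = false.
    by move=> ne; apply: contraNF ne => /eqP->; rewrite enum_valK.
  by rewrite !nn // addr0.
have s1 : (4 * #|Rs| <= \sum_i \sum_j (D i j != 0%R))%N.
  rewrite mulnC -sum_nat_const big_mkcond /=; apply: leq_sum => i _.
  case: ifP => // /hR/leq_trans; apply; rewrite -sum1_card big_mkcond /=.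
  by apply: leq_sum => j _; rewrite inE; case: (D i j != 0).
have s2 : (\sum_i \sum_j (D i j != 0%R) <= 2 * #|E|)%N.
  rewrite exchange_big /= mulnC -[X in (_ <= X * _)%N]card_ord -sum_nat_const; apply: leq_sum => j _.
  apply: leq_trans (hC j); rewrite -sum1_card [X in (_ <= X)%N]big_mkcond /=.
  by apply: leq_sum => i _; rewrite inE; case: (D i j != 0).
by move: rk h1 h2 s1 s2; clear; lia.
Qed.

End EdgeBound.

Lemma gminor_edges (T : finType) (e : rel T) (V : {set T}) : good (@gminor T) e V -> V != set0 ->
  (\sum_(x in V) dg e V x + 4 <= 4 * #|V|)%N.
Proof.
move=> [se ie te [K [beta [bK bc be]]]] V0.
pose E := [set w : T * T | [&& w.1 \in V, w.2 \in V, e w.1 w.2 & (enum_rank w.1 < enum_rank w.2)%N]].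
have hp w : exists g, w \in E -> exists c d, [/\ joins g c d, beta c = Some w.1 & beta d = Some w.2].
  have [|_] := boolP (w \in E); last by exists (true, (0%N, 0%N)).
  by rewrite inE => /and4P[h1 h2 h3 _]; have [g [c [d h]]] := be _ _ h1 h2 h3; exists g => _; exists c, d.
have [p pE] := choice hp.
apply: leq_trans (edge_count se ie te bK bc pE V0); rewrite leq_add2r.
under eq_bigr do rewrite dg_sum.
rewrite pair_big_dep /= -/E.
have -> : (\sum_(w : T * T | (w.1 \in V) && (w.2 \in V)) e w.1 w.2 =
   #|[set w : T * T | [&& w.1 \in V, w.2 \in V & e w.1 w.2]]|)%N.
  rewrite -sum1_card big_mkcond [RHS]big_mkcond /=; apply: eq_bigr => w _; rewrite inE.
  by case: (w.1 \in V); case: (w.2 \in V); case: (e w.1 w.2).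
pose flip (w : T * T) := (w.2, w.1).
have fi : injective flip by case=> ? ? [? ?] [-> ->].
rewrite mul2n -addnn -{2}(card_imset E fi).
apply: leq_trans (leq_card_setU _ _); apply: subset_leq_card; apply/subsetP=> w; rewrite !inE => /and3P[h1 h2 h3].
have : enum_rank w.1 != enum_rank w.2 :> nat.
  by apply: contraTneq h3 => /val_inj/enum_rank_inj->; rewrite ie.
rewrite neq_ltn => /orP[l|l]; first by rewrite h1 h2 h3 l.
apply/orP; right; apply/imsetP; exists (flip w); last by case: (w).
by rewrite inE /= h1 h2 se h3.
Qed.

From mathcomp Require Import all_classical all_reals all_analysis.
Import Order.TTheory GRing.Theory Num.Theory.
Import numFieldNormedType.Exports.
Local Open Scope ring_scope.

(** * From arcs in the plane to lattice walks *)

Section Compactness.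
Variable R : realType.
Implicit Types (a b c d s t eps eta : R) (n : nat).

(** Compactness of the rectangle, in the form of near coverings, makes a threshold valid around each
    point valid everywhere. *)
Lemma eventually_uniform a b c d (Q : nat -> R -> R -> Prop) :
  (forall s0 t0, s0 \in `[a, b] -> t0 \in `[c, d] -> exists2 eps, 0 < eps &
     exists n0, forall n s t, (n0 <= n)%N -> s \in `[a, b] -> t \in `[c, d] ->
       `|s - s0| < eps -> `|t - t0| < eps -> Q n s t) ->
  exists n0, forall n s t, (n0 <= n)%N -> s \in `[a, b] -> t \in `[c, d] -> Q n s t.
Proof.
move=> h.
have := compact_setX (@segment_compact R a b) (@segment_compact R c d).
rewrite compact_near_coveringP -near_covering_withinP.
move=> /(_ nat (nbhs (\oo)%classic) (fun n st => Q n st.1 st.2) _) [].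
  move=> [s0 t0] [/= s0I t0I]; have [eps e0 [n0 hn]] := h s0 t0 s0I t0I.
  exists ([set st : R * R | ball (s0, t0) eps st]%classic, [set n | (n0 <= n)%N]%classic).
    split=> /=; first exact: nbhsx_ballx.
    by exists n0.
  move=> [[s t] n] /= [[b1 b2] nn] [sI tI]; apply: hn => //.
    by rewrite distrC; move: b1; rewrite /= -ball_normE.
  by rewrite distrC; move: b2; rewrite /= -ball_normE.
move=> n0 _ hn; exists n0 => n s t nn sI tI.
exact: (hn n nn (s, t)).
Qed.

Lemma within_continuous_eps (f : R -> R * R) : {within `[0, 1], continuous f}%classic ->
  forall s0 eta, s0 \in `[0, 1] -> 0 < eta -> exists2 eps, 0 < eps &
    forall s, s \in `[0, 1] -> `|s - s0| < eps ->
      `|(f s).1 - (f s0).1| < eta /\ `|(f s).2 - (f s0).2| < eta.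
Proof.
move=> /subspace_continuousP cf s0 eta s0I eta0.
have := cf s0 s0I (ball (f s0) eta) (nbhsx_ballx _ _ eta0).
rewrite /= /within /= => /nbhs_ballP[eps /= e0 he]; exists eps => // s sI sd.
have [|b1 b2] := he s _ sI; first by rewrite /= -ball_normE /= distrC.
by move: b1 b2; rewrite -!ball_normE /= => b1 b2; rewrite distrC b1 distrC b2.
Qed.

End Compactness.

Lemma eventually_forall (I : finType) (P : I -> nat -> Prop) :
  (forall i, exists n0, forall n, (n0 <= n)%N -> P i n) ->
  exists n0, forall n, (n0 <= n)%N -> forall i, P i n.
Proof.
move=> h; have [f hf] := choice h; exists (\max_i f i)%N => n hn i; apply: hf.
exact: leq_trans (leq_bigmax i) hn.
Qed.

Section Drawing.
Variables (R : realType) (G : sgraph) (D : plane_drawing R G).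
Implicit Types (x y z w : G) (s t eta : R) (n m k : nat) (p q : R * R).

Lemma exists_inv_lt (a : R) eta : 0 < eta -> exists n0, forall n, (n0 <= n)%N -> a / n.+1%:R < eta.
Proof.
move=> e0; exists (Num.bound (`|a| / eta)) => n hn.
have h1 : `|a| / eta < n.+1%:R.
  apply: lt_le_trans (archi_boundP _) _; first by rewrite divr_ge0 // ltW.
  by rewrite ler_nat; apply: leqW.
rewrite ltr_pdivrMr ?ltr0n // mulrC -ltr_pdivrMr //.
by apply: le_lt_trans h1; rewrite ler_pM2r ?invr_gt0 // ler_norm.
Qed.

(** The 3 stands for one mesh width between two points of the same cell and one more for each of the
    two walks, whose first coordinate may be sampled one step ahead of the second. *)
Definition close n p q := `|p.1 - q.1| < 3 / n.+1%:R /\ `|p.2 - q.2| < 3 / n.+1%:R.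

(** Where [f s0] and [g t0] differ by [r] in a coordinate, moving either parameter slightly costs
    less than [r / 4], and so does the tolerance of [close] for large [n]; three quarters do not
    bridge the gap. Compactness makes this uniform. *)
Lemma separated (f g : R -> R * R) (a b c d : R) :
  {within `[0, 1], continuous f}%classic -> {within `[0, 1], continuous g}%classic ->
  0 <= a -> b <= 1 -> 0 <= c -> d <= 1 ->
  (forall s t, s \in `[a, b] -> t \in `[c, d] -> f s <> g t) ->
  exists n0, forall n, (n0 <= n)%N -> forall s t, s \in `[a, b] -> t \in `[c, d] ->
    ~ close n (f s) (g t).
Proof.
move=> cf cg a0 b1 c0 d1 ne.
have sub (u v : R) s : 0 <= u -> v <= 1 -> s \in `[u, v] -> s \in `[0, 1].
  by move=> u0 v1; rewrite !in_itv /= => /andP[h1 h2]; rewrite (le_trans u0) // (le_trans h2).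
have [|n0 hn] := @eventually_uniform R a b c d (fun n s t => ~ close n (f s) (g t)); last first.
  by exists n0 => n nn s t; apply: hn.
move=> s0 t0 s0I t0I; have fg := ne _ _ s0I t0I.
have coord (pr : R * R -> R) :
   (forall p q, close 0 p q -> True) ->
   (forall s0 eta, s0 \in `[0, 1] -> 0 < eta -> exists2 eps, 0 < eps & forall s, s \in `[0, 1] -> `|s - s0| < eps -> `|pr (f s) - pr (f s0)| < eta) ->
   (forall s0 eta, s0 \in `[0, 1] -> 0 < eta -> exists2 eps, 0 < eps & forall s, s \in `[0, 1] -> `|s - s0| < eps -> `|pr (g s) - pr (g s0)| < eta) ->
   (forall n p q, close n p q -> `|pr p - pr q| < 3 / n.+1%:R) ->
   pr (f s0) != pr (g t0) -> exists2 eps, 0 < eps &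
     exists n0, forall n s t, (n0 <= n)%N -> s \in `[a, b] -> t \in `[c, d] ->
       `|s - s0| < eps -> `|t - t0| < eps -> ~ close n (f s) (g t).
  move=> _ hf hg hc ne0.
  pose r := `|pr (f s0) - pr (g t0)|; have r0 : 0 < r by rewrite normr_gt0 subr_eq0.
  have r4 : 0 < r / 4 by rewrite divr_gt0.
  have [e1 e10 he1] := hf s0 (r / 4) (sub _ _ _ a0 b1 s0I) r4.
  have [e2 e20 he2] := hg t0 (r / 4) (sub _ _ _ c0 d1 t0I) r4.
  have [n0 hn0] := exists_inv_lt 3 r4.
  exists (Num.min e1 e2); first by rewrite lt_min e10.
  exists n0 => n s t nn sI tI; rewrite !lt_min => /andP[s1 _] /andP[_ t2] /hc h3.
  have h1 := he1 s (sub _ _ _ a0 b1 sI) s1; have h2 := he2 t (sub _ _ _ c0 d1 tI) t2.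
  have {}h3 := lt_trans h3 (hn0 n nn).
  have tri : r <= `|pr (f s) - pr (f s0)| + (`|pr (f s) - pr (g t)| + `|pr (g t) - pr (g t0)|).
    rewrite /r; apply: le_trans (ler_distD (pr (f s)) _ _) _; rewrite [`|pr (f s0) - _|]distrC lerD2l.
    exact: ler_distD.
  by move: tri h1 h2 h3 r0; clearbody r; clear; lra.
have [e1|e1] := eqVneq (f s0).1 (g t0).1.
  have e2 : (f s0).2 != (g t0).2.
    by apply/eqP=> e2; apply: fg; rewrite [f s0]surjective_pairing e1 e2 -surjective_pairing.
  apply: (coord snd) => //.
  - move=> s1 eta h1 h2; have [eps h3 h4] := within_continuous_eps cf h1 h2.
    by exists eps => // s h5 h6; case: (h4 s h5 h6).
  - move=> s1 eta h1 h2; have [eps h3 h4] := within_continuous_eps cg h1 h2.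
    by exists eps => // s h5 h6; case: (h4 s h5 h6).
  - by move=> n p q [].
apply: (coord fst) => //.
- move=> s1 eta h1 h2; have [eps h3 h4] := within_continuous_eps cf h1 h2.
  by exists eps => // s h5 h6; case: (h4 s h5 h6).
- move=> s1 eta h1 h2; have [eps h3 h4] := within_continuous_eps cg h1 h2.
  by exists eps => // s h5 h6; case: (h4 s h5 h6).
- by move=> n p q [].
Qed.

(** Uniform continuity from [eventually_uniform]: near a diagonal point continuity there suffices,
    and near any other point the parameters are eventually too far apart for the hypothesis. *)
Lemma equicontinuous (f : R -> R * R) eta : {within `[0, 1], continuous f}%classic -> 0 < eta ->
  exists n0, forall n, (n0 <= n)%N -> forall s t, s \in `[0, 1] -> t \in `[0, 1] -> `|s - t| <= n.+1%:R^-1 ->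
    `|(f s).1 - (f t).1| < eta /\ `|(f s).2 - (f t).2| < eta.
Proof.
move=> cf eta0.
have [|n0 hn] := @eventually_uniform R 0 1 0 1 (fun n s t => `|s - t| <= n.+1%:R^-1 ->
    `|(f s).1 - (f t).1| < eta /\ `|(f s).2 - (f t).2| < eta); last first.
  by exists n0 => n nn s t; apply: hn.
move=> s0 t0 s0I t0I; have [E|ne] := eqVneq s0 t0.
  subst t0; have e2 : 0 < eta / 2 by rewrite divr_gt0.
  have [eps e0 he] := within_continuous_eps cf s0I e2; exists eps => //; exists 0%N => n s t _ sI tI ds dt _.
  have [a1 a2] := he s sI ds; have [b1 b2] := he t tI dt.
  by split; [apply: le_lt_trans (ler_distD (f s0).1 _ _) _ | apply: le_lt_trans (ler_distD (f s0).2 _ _) _];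
    rewrite [X in _ + X]distrC [ltRHS]splitr ltrD.
pose r := `|s0 - t0|; have r0 : 0 < r by rewrite normr_gt0 subr_eq0.
have r4 : 0 < r / 4 by rewrite divr_gt0.
have [n0 hn0] := exists_inv_lt 1 r4.
exists (r / 4) => //; exists n0 => n s t nn _ _ ds dt dst; exfalso.
have := hn0 n nn; rewrite div1r => /(le_lt_trans dst) {}dst.
have tri : r <= `|s - s0| + (`|s - t| + `|t - t0|).
  rewrite /r; apply: le_trans (ler_distD s _ _) _; rewrite [`|s0 - _|]distrC lerD2l.
  exact: ler_distD.
by move: tri ds dt dst r0; clearbody r; clear; lra.
Qed.

(** Non-adjacent pairs get the constant arc at [pos D x], so that a walk exists for every ordered
    pair and the conditions on stars hold for all of them. *)
Definition arc x y : R -> R * R := if adj x y then curve D x y else fun=> pos D x.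

Lemma arc_continuous x y : {within `[0, 1], continuous (arc x y)}%classic.
Proof.
rewrite /arc; case: ifP => [/(curve_arc D)[]//|_].
by apply: continuous_subspaceT => ?; apply: cst_continuous.
Qed.

Lemma arc0 x y : arc x y 0 = pos D x.
Proof. by rewrite /arc; case: ifP => // /(curve_arc D)[]. Qed.

Lemma arc_rev x y t : adj x y -> t \in `[0, 1] -> arc y x t = arc x y (1 - t).
Proof. by move=> a tI; rewrite /arc adj_sym a; apply: curve_rev. Qed.

Lemma arc_spec x y t : 0 <= t < 1 -> arc x y t = pos D x \/ [/\ adj x y, t \in `]0, 1[ & arc x y t = curve D x y t].
Proof.
case/andP; rewrite le_eqVlt => /orP[/eqP<-|t0] t1; first by left; apply: arc0.
rewrite /arc; case: ifP => a; last by left.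
by right; split=> //; rewrite in_itv /= t0.
Qed.

(** The delicate case is one edge traversed from both ends: a common point would give [s = 1 - t],
    but both parameters are at most one third. *)
Lemma star_arcs x y z w s t : x != z -> s \in `[0, 3^-1] -> t \in `[0, 3^-1] -> arc x y s <> arc z w t.
Proof.
move=> xz; rewrite !in_itv /= => /andP[s0 s3] /andP[t0 t3].
have s1 : 0 <= s < 1 by rewrite s0 /=; lra.
have t1 : 0 <= t < 1 by rewrite t0 /=; lra.
case: (arc_spec x y s1) => [->|[axy sI ->]]; case: (arc_spec z w t1) => [->|[azw tI ->]].
- by move/(@pos_inj _ _ D)=> E; rewrite E eqxx in xz.
- by move/esym; apply: curve_pos.
- exact: curve_pos.
have [E|ne] := eqVneq [set x; y]%SET [set z; w]%SET; last exact: curve_disjoint.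
have [Ez Ew] : z = y /\ w = x.
  move/finset.setP: E => E; have := E x; have := E z; rewrite !inE !eqxx /= (eq_sym z x) (negPf xz) /=.
  by move=> /eqP -> /esym/eqP ->.
subst z w; rewrite (curve_rev D axy); last by rewrite in_itv /= t0 /=; lra.
have [_ inj _ _] := curve_arc D axy; move=> E'.
have : s = 1 - t by apply: inj => //; rewrite in_itv /=; apply/andP; split; lra.
by clear E'; lra.
Qed.

Lemma mid_star_arcs x y z w s t : adj x y -> z != x -> z != y -> s \in `[3^-1, 2 / 3] -> t \in `[0, 3^-1] ->
  arc x y s <> arc z w t.
Proof.
move=> axy zx zy; rewrite !in_itv /= => /andP[s0 s3] /andP[t0 t3].
have t1 : 0 <= t < 1 by rewrite t0 /=; lra.
have sI : s \in `]0, 1[ by rewrite in_itv /=; apply/andP; split; lra.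
rewrite /arc axy -/(arc z w); case: (arc_spec z w t1) => [->|[azw tI ->]]; first exact: curve_pos.
apply: curve_disjoint => //; apply/eqP=> /finset.setP/(_ z); rewrite !inE eqxx (negPf zx) (negPf zy).
by [].
Qed.

Lemma mid_arcs x y z w s t : adj x y -> adj z w -> [set x; y]%SET != [set z; w]%SET ->
  s \in `[3^-1, 2 / 3] -> t \in `[3^-1, 2 / 3] -> arc x y s <> arc z w t.
Proof.
move=> axy azw ne; rewrite !in_itv /= => /andP[s0 s3] /andP[t0 t3].
by rewrite /arc axy azw; apply: curve_disjoint => //; rewrite in_itv /=; apply/andP; split; lra.
Qed.

Lemma floor_dist (a b : R) : `|a - b| < 1 -> (`|Num.floor a - Num.floor b| <= 1)%R.
Proof.
rewrite ltr_norml => /andP[h1 h2]; have /andP[a1 a2] := floor_itv a; have /andP[b1 b2] := floor_itv b.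
rewrite ler_norml; apply/andP; split.
  rewrite -ltzD1 addrC -subr_lt0 -(ltr_int R) !rmorphD /= !rmorphN /= in a2 b2 *; lra.
by rewrite -ltzD1 -(ltr_int R) !rmorphD /= !rmorphN /= in a2 b2 *; lra.
Qed.

Lemma floor_eq_dist (a b : R) : Num.floor a = Num.floor b -> `|a - b| < 1.
Proof.
move=> E; have /andP[a1 a2] := floor_itv a; have /andP[b1 b2] := floor_itv b.
by rewrite E in a1 a2; rewrite ltr_norml rmorphD /= in a2 b2 *; apply/andP; split; lra.
Qed.

Lemma joins_near (i j k : nat) : `|i%:Z - j%:Z| <= 1 ->
  ((i, k) = (j, k) \/ exists g, joins g (i, k) (j, k)) /\
  ((k, i) = (k, j) \/ exists g, joins g (k, i) (k, j)).
Proof.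
move=> h; have [->|[->|->]] : i = j \/ i = j.+1 \/ j = i.+1 by lia.
- by split; left.
- split; right.
    by exists (true, (j, k)); right; rewrite /gend /= addn1 addn0.
  by exists (false, (k, j)); right; rewrite /gend /= addn1 addn0.
- split; right.
    by exists (true, (i, k)); left; rewrite /gend /= addn1 addn0.
  by exists (false, (k, i)); left; rewrite /gend /= addn1 addn0.
Qed.

End Drawing.

(** The mesh [1 / (L + 1)] is so fine that disjoint pieces of arcs are never within three mesh
    widths; then [N] is so large that consecutive samples move by less than one. Rounding the
    samples gives the walks. *)
Lemma planar_gminor (R : realType) (G : sgraph) : plane_drawing R G ->
  gminor (@adj G) [set: G]%SET.
Proof.
move=> D; pose a (i : G * G) := arc D i.1 i.2.
have ac i : {within `[0, 1], continuous (a i)}%classic by exact: arc_continuous.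
have sep1 (i j : G * G) : exists n0, forall n, (n0 <= n)%N -> i.1 != j.1 -> forall s t,
    s \in `[0, 3^-1] -> t \in `[0, 3^-1] -> ~ close n (a i s) (a j t).
  have [E|ne] := eqVneq i.1 j.1; first by exists 0%N.
  have [|||||n0 hn] := @separated R (a i) (a j) 0 3^-1 0 3^-1 (ac i) (ac j) ; try lra.
    by move=> s t; apply: star_arcs.
  by exists n0 => n nn _; apply: hn.
have sep2 (i j : G * G) : exists n0, forall n, (n0 <= n)%N -> adj i.1 i.2 -> j.1 != i.1 -> j.1 != i.2 -> forall s t,
    s \in `[3^-1, 2 / 3] -> t \in `[0, 3^-1] -> ~ close n (a i s) (a j t).
  have [/and3P[h1 h2 h3]|ne] := boolP [&& adj i.1 i.2, j.1 != i.1 & j.1 != i.2]; last first.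
    by exists 0%N => n _ h1 h2 h3; rewrite h1 h2 h3 in ne.
  have [|||||n0 hn] := @separated R (a i) (a j) 3^-1 (2 / 3) 0 3^-1 (ac i) (ac j) ; try lra.
    by move=> s t; apply: mid_star_arcs.
  by exists n0 => n nn _ _ _; apply: hn.
have sep3 (i j : G * G) : exists n0, forall n, (n0 <= n)%N -> adj i.1 i.2 -> adj j.1 j.2 ->
    [set i.1; i.2]%SET != [set j.1; j.2]%SET -> forall s t,
    s \in `[3^-1, 2 / 3] -> t \in `[3^-1, 2 / 3] -> ~ close n (a i s) (a j t).
  have [/and3P[h1 h2 h3]|ne] := boolP [&& adj i.1 i.2, adj j.1 j.2 & [set i.1; i.2]%SET != [set j.1; j.2]%SET]; last first.
    by exists 0%N => n _ h1 h2 h3; rewrite h1 h2 h3 in ne.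
  have [|||||n0 hn] := @separated R (a i) (a j) 3^-1 (2 / 3) 3^-1 (2 / 3) (ac i) (ac j) ; try lra.
    by move=> s t; apply: mid_arcs.
  by exists n0 => n nn _ _ _; apply: hn.
have [n1 h1] := eventually_forall (fun i => eventually_forall (sep1 i)).
have [n2 h2] := eventually_forall (fun i => eventually_forall (sep2 i)).
have [n3 h3] := eventually_forall (fun i => eventually_forall (sep3 i)).
pose L := maxn n1 (maxn n2 n3).
have {}h1 := h1 L (leq_maxl _ _).
have {}h2 := h2 L (leq_trans (leq_maxl _ _) (leq_maxr _ _)).
have {}h3 := h3 L (leq_trans (leq_maxr _ _) (leq_maxr _ _)).
have L0 : 0 < (L.+1%:R^-1 : R) by rewrite invr_gt0 ltr0n.
have [n4 h4] := eventually_forall (fun i => equicontinuous (ac i) L0).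
(* A multiple of three, so that the thirds of the parameter interval are sample points. *)
pose M := n4.+1; pose N := (3 * M)%N.
have N0 : 0 < (N%:R : R) by rewrite ltr0n.
have NE : N = (3 * M).-1.+1 by [].
have {}h4 i s t : s \in `[0, 1] -> t \in `[0, 1] -> `|s - t| <= N%:R^-1 ->
    `|(a i s).1 - (a i t).1| < L.+1%:R^-1 /\ `|(a i s).2 - (a i t).2| < L.+1%:R^-1.
  by rewrite NE; apply: h4; rewrite /M; clear; lia.
pose tk (k : nat) : R := k%:R / N%:R.
have tkI k : (k <= N)%N -> tk k \in `[0, 1].
  by move=> kN; rewrite in_itv /= divr_ge0 ?ler0n //= ler_pdivrMr // mul1r ler_nat.
have third : 3^-1 = M%:R / N%:R :> R.
  by rewrite /N natrM invfM mulrCA mulfV ?mulr1 // pnatr_eq0.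
have tk1 k : (k <= M)%N -> tk k \in `[0, 3^-1].
  by move=> kM; rewrite in_itv /= divr_ge0 ?ler0n //= third ler_pM2r ?invr_gt0 // ler_nat.
have tk2 k : (M <= k <= M.*2)%N -> tk k \in `[3^-1, 2 / 3].
  case/andP=> k1 k2; rewrite in_itv /= third mulrA -natrM mul2n.
  by rewrite !ler_pM2r ?invr_gt0 // !ler_nat k1.
have tkS k : `|tk k - tk k.+1| <= N%:R^-1.
  by rewrite distrC /tk -mulrBl -natrB // subSnn mul1r ger0_norm // invr_ge0 ltW.
pose fx i k := Num.floor (L.+1%:R * (a i (tk k)).1); pose fy i k := Num.floor (L.+1%:R * (a i (tk k)).2).
(* A strict bound on all rounded coordinates; shifting by [C] puts them strictly between 0 and
   [2 C]. *)
pose C := (\max_(u : (G * G) * 'I_N.+1) (`|fx u.1 u.2| + `|fy u.1 u.2|)%N).+1.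
have bnd i k : (k <= N)%N -> `|fx i k| < C%:Z /\ `|fy i k| < C%:Z.
  move=> kN; have kE : k = (inord k : 'I_N.+1) :> nat by rewrite inordK.
  have := leq_bigmax (F := fun u : (G * G) * 'I_N.+1 => (`|fx u.1 u.2| + `|fy u.1 u.2|)%N) (i, inord k).
  rewrite /= -kE /C; move: (\max_u _)%N (fx i k) (fy i k) => mx p q; clear; lia.
pose nx i k := absz (fx i k + C%:Z); pose ny i k := absz (fy i k + C%:Z).
have nxE i k : (k <= N)%N -> (nx i k)%:Z = fx i k + C%:Z.
  by move=> /(bnd i)[h _]; rewrite /nx; move: (fx i k) h => p; clear; lia.
have nyE i k : (k <= N)%N -> (ny i k)%:Z = fy i k + C%:Z.
  by move=> /(bnd i)[_ h]; rewrite /ny; move: (fy i k) h => p; clear; lia.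
(* The two coordinates move alternately, so that the walk has no diagonal steps. *)
pose c x y m : cell := (nx (x, y) (uphalf m), ny (x, y) m./2).
have mN m : (m <= (M.*2).*2)%N -> (uphalf m <= N)%N /\ (m./2 <= N)%N.
  by rewrite /N; clear; lia.
have L1 : 0 < (L.+1%:R : R) by rewrite ltr0n.
have scale (p q : R) : `|L.+1%:R * p - L.+1%:R * q| < 1 <-> `|p - q| < L.+1%:R^-1.
  by rewrite -mulrBr normrM gtr0_norm // mulrC -ltr_pdivlMr // div1r.
have closeE x y z w m n : (m <= (M.*2).*2)%N -> (n <= (M.*2).*2)%N -> c x y m = c z w n ->
    close L (a (x, y) (tk m./2)) (a (z, w) (tk n./2)).
  move=> /mN[m1 m2] /mN[n1' n2'] [/(congr1 Posz) E1 /(congr1 Posz) E2].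
  rewrite !nxE // in E1; rewrite !nyE // in E2; move/addIr: E1 => E1; move/addIr: E2 => E2.
  have d1 := (scale _ _).1 (floor_eq_dist E1); have d2 := (scale _ _).1 (floor_eq_dist E2).
  have near i k : (uphalf k <= N)%N -> (k./2 <= N)%N -> `|(a i (tk (uphalf k))).1 - (a i (tk k./2)).1| < L.+1%:R^-1.
    move=> k1 k2; have [E|E] : uphalf k = k./2 \/ uphalf k = (k./2).+1 by clear; lia.
      by rewrite E subrr normr0.
    by have [] := h4 i _ _ (tkI _ k1) (tkI _ k2); rewrite ?E distrC.
  have e1 := near (x, y) m m1 m2; have e2 := near (z, w) n n1' n2'.
  have three : 3 / L.+1%:R = L.+1%:R^-1 + (L.+1%:R^-1 + L.+1%:R^-1) :> R.
    by rewrite mulrDl -[in RHS]mulr2n mulrDl !div1r mulr2n -?addrA.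
  split; last first.
    apply: lt_le_trans d2 _; rewrite ler_pdivlMr // mulVf ?gt_eqF //; lra.
  rewrite three; apply: le_lt_trans (ler_distD (a (x, y) (tk (uphalf m))).1 _ _) _.
  rewrite [X in X + _]distrC ltrD //.
  apply: le_lt_trans (ler_distD (a (z, w) (tk (uphalf n))).1 _ _) _.
  by rewrite ltrD.
have half2 m : (m <= M.*2)%N -> (m./2 <= M)%N by clear; lia.
have halfm m : (M.*2 <= m <= (M.*2).*2)%N -> (M <= m./2 <= M.*2)%N by clear; lia.
apply: (@discrete_gminor G (@adj G) c M.*2 (C.*2)).
- exact: adj_sym.
- exact: adj_irr.
- move=> x y m /mN[m1 m2]; have [b1 _] := bnd (x, y) _ m1; have [_ b2] := bnd (x, y) _ m2.
  have aux (B u v : nat) (p q : int) : `|p| < B%:Z -> `|q| < B%:Z -> u%:Z = p + B%:Z -> v%:Z = q + B%:Z ->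
      ((0 < u < B.*2) && (0 < v < B.*2))%N by clear; lia.
  exact: aux b1 b2 (nxE (x, y) _ m1) (nyE (x, y) _ m2).
- move=> x y m mH; have [m1 m2] := mN m.+1 mH; have [m3 m4] := mN m (ltnW mH).
  have k2 : ((m./2).+1 <= N)%N := m1.
  have [d1 d2] := h4 (x, y) _ _ (tkI _ m4) (tkI _ k2) (tkS _).
  rewrite /c /=; have [E|E] : uphalf m = m./2 \/ uphalf m = (m./2).+1 by clear; lia.
    rewrite E; apply: (@joins_near _ _ _ _).1; rewrite !nxE // opprD addrACA subrr addr0.
    by apply: floor_dist; apply: (scale _ _).2.
  rewrite E; apply: (@joins_near _ _ _ _).2; rewrite !nyE // opprD addrACA subrr addr0.
  by apply: floor_dist; apply: (scale _ _).2.
- by move=> x y z; rewrite /c /nx /ny /fx /fy /a /tk /= mul0r !arc0.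
- move=> x y exy; rewrite /c !uphalf_double !doubleK /nx /ny /fx /fy /a /=.
  have -> : arc D y x (tk M) = arc D x y (tk M.*2); last by [].
  rewrite arc_rev ?tkI //; last by rewrite /N; clear; lia.
  congr (arc D x y _); rewrite /tk -third -mul2n natrM -mulrA -third; lra.
- move=> x y z w m n xz mH nH E; apply: (h1 (x, y) (z, w) xz _ _ (tk1 _ (half2 _ mH)) (tk1 _ (half2 _ nH))).
  by apply: closeE E; move: mH nH; clear; lia.
- move=> x y z w m n exy zx zy mH nH E.
  apply: (h2 (x, y) (z, w) exy zx zy _ _ (tk2 _ (halfm _ mH)) (tk1 _ (half2 _ nH))).
  by apply: closeE E; move: mH nH; clear; lia.
- move=> x y z w m n exy ezw ne mH nH E.
  apply: (h3 (x, y) (z, w) exy ezw ne _ _ (tk2 _ (halfm _ mH)) (tk2 _ (halfm _ nH))).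
  by apply: closeE E; move: mH nH; clear; lia.
Qed.

(** On a cycle of length at least three, the successor and the predecessor of a vertex are distinct,
    so its vertices form a core, which the hitting set would have to meet. *)
Lemma compl_fvs_forest (G : sgraph) (F : {set G}) : fvs (@adj G) [set: G]%SET F ->
  induced_forest (~: F)%SET.
Proof.
move=> /fvsP hF s /andP[cs us]; rewrite ltnNge; apply/negP=> s3.
pose A := [set val x | x in s]%SET.
have cA : core (@adj G) A.
  apply/coreP; split.
    by case: s s3 {cs us} @A => // x s _ A; apply/set0Pn; exists (val x); apply/imsetP; exists x; rewrite ?mem_head.
  (* Rotating the cycle to start at [x] exhibits the two neighbours: the second entry and the
     last. *)
  move=> _ /imsetP[x xs ->]; have [i s' Es] := rot_to xs.
  have [cs' us'] : cycle (@induced_adj G (~: F)%SET) (x :: s') /\ uniq (x :: s') by rewrite -Es rot_cycle rot_uniq.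
  have sz : (2 < size (x :: s'))%N by rewrite -Es size_rot.
  case: s' Es cs' us' sz => [|y [|z s']] // Es cs' us' _.
  have [exy elx] : adj (val x) (val y) /\ adj (val (last z s')) (val x).
    by move: cs'; rewrite /= rcons_path => /and4P[? _ _ ?].
  have yl : y != last z s'.
    by case/and3P: us' => _ yN _; apply: contraNneq yN => ->; apply: mem_last.
  have inA w : w \in x :: y :: z :: s' -> val w \in A.
    by rewrite -Es mem_rot => ws; apply/imsetP; exists w.
  apply: (@leq_trans #|[set val y; val (last z s')]%SET|); first by rewrite cards2 (inj_eq val_inj) yl.
  apply/subset_leq_card/fintype.subsetP=> w; rewrite in_nb !finset.inE => /orP[]/eqP->.
    by rewrite inA ?exy // !in_cons eqxx orbT.
  rewrite inA; first by rewrite adj_sym elx.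
  by rewrite !in_cons; have := mem_last z s'; rewrite in_cons => ->; rewrite !orbT.
have [y yA yF] := hF A (finset.subsetT _) cA.
by case/imsetP: yA => x _ E; have := valP x; rewrite -E finset.in_setC yF.
Qed.

Unset Implicit Arguments.
Set Strict Implicit.
Set Printing Implicit Defensive.

Theorem corollary1p3 (R : realType) (a b c d : R)
  (h1 : 0 <= a) (h2 : 0 <= 1 - a) (h3 : 0 <= b) (h4 : 0 <= c) (h5 : 0 <= d)
  (h6 : 0 <= 1 - a + b - c) (h7 : 0 <= 1 - a + b - d) (h8 : 0 <= 5 * b - a)
  (h9 : 0 <= 5 - 8 * a + 12 * b + c) (h10 : 0 <= 4 - 6 * a + 8 * b + d)
  (h11 : 0 <= 5 - 8 * a + 13 * b)
  (h12 : 0 <= 5 + 13 * b - 8 * a + c - d) (h13 : 0 <= 4 + 9 * b - 6 * a - d)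
  (h14 : 0 <= 5 - 8 * a + 14 * b - d) (h15 : 0 <= 5 - 8 * a + 14 * b - c)
  (h16 : 0 <= 5 - 8 * a + 15 * b - c - d)
  (h17 : 0 <= 3 - 5 * a + 10 * b - c) (h18 : 0 <= 3 - 5 * a + 10 * b - d)
  (h19 : 0 <= 3 - 4 * a + 4 * b)
  (G : sgraph) (Gplanar : planar R G) (Gtriangle_free : triangle_free G)
  (GnoQ3 : ~ exists S : {set G}, Q3_1minus_subgraph S)
  (GnoT6 : ~ exists S : {set G}, T6_component S) :
  exists S : {set G}, induced_forest S /\ (a - 2 * b) * #|G|%:R <= #|S|%:R.
Proof.
have [D] := Gplanar.
have gG : good (@gminor G) (@adj G) [set: G]%SET.
  split; [exact: adj_sym | exact: adj_irr | | exact: planar_gminor D].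
  by move=> x y z _ _ _ xy yz zx; apply: (Gtriangle_free x y z).
have := tau_bound (@gminor_sub G) (@gminor_sup G) (@gminor_edges G) gG.
have [F fF <-] := tau_fvs (@adj G) [set: G]%SET; rewrite cardsT => bF.
exists (~: F)%SET; split; first exact: compl_fvs_forest.
have nS : (5 * #|G| <= 9 * #|(~: F)%SET|)%N by have := finset.cardsC F; move: bF; clear; lia.
(* One ninth of the sum of [h8] and [h11]. *)
have ab : a - 2 * b <= 5 / 9 by move: h8 h11; clear; lra.
apply: le_trans (ler_wpM2r (ler0n _ _) ab) _.
by move: nS; rewrite -(ler_nat R) !natrM; clear; lra.
Qed.
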